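(* Let $\mu$ be an $S$-stable profile (viewed as a stationary solution of the quasineutral Vlasov equation $\partial_t f+v\partial_xf-\partial_xV\partial_vf=0$, $\int f\,dv=1$), written $\mu(v)=\varphi\bigl(-\frac{|v-\bar v|^2}{2}\bigr)$, and let $Q$ be an associated admissible function with Casimir functional $H_Q$. Assume that there exists $\eta>0$ such that $$\int_{\mathbb R} \mu(v)(1+|v|^{2+\eta})\,dv<+\infty.$$ For all $\varepsilon>0$, let $(f_\varepsilon,V_\varepsilon)$ be a global strong solution to $$\partial_t f_\varepsilon + v\,\partial_x f_\varepsilon - \partial_x V_\varepsilon\,\partial_v f_\varepsilon=0,\qquad -\varepsilon^2\partial_x^2 V_\varepsilon=\int_{\mathbb R} f_\varepsilon\,dv-1 \qquad (x\in\mathbb T,\ v\in\mathbb R),$$ with initial datum $f_{0,\varepsilon}$. For any smooth potential $V_0:\mathbb T\to\mathbb R$ such that $\partial_{xxx}V_0\in L^\infty$, define the modulated free energy $$\mathcal L^O_\varepsilon(t):=H_Q\Bigl[f_\varepsilon\bigl(t,x,v-\partial_xV_0(x-\bar vt)\sin\tfrac t\varepsilon\bigr)\Bigr]+\frac12\int_{\mathbb T}\Bigl[\varepsilon\,\partial_xV_\varepsilon-\partial_xV_0(x-\bar vt)\cos\tfrac t\varepsilon\Bigr]^2dx.$$ Then there exists a constant $K>0$, depending on $\|\partial_{xx}V_0\|_\infty$ and $\|\partial_{xxx}V_0\|_\infty$, such that $$\forall t\ge0,\qquad \mathcal L^O_\varepsilon(t)\le e^{2\|\partial_{xx}V_0\|_{L^\infty}t}\Bigl[\mathcal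 L^O_\varepsilon(0)+K\varepsilon\bigl(1+\mathcal E_{\varepsilon,0}+\mathcal Q_{\varepsilon,0}\bigr)\Bigr],$$ where $$\mathcal E_{\varepsilon,0}:=\mathcal E_\varepsilon[f_{0,\varepsilon}],\qquad \mathcal Q_{\varepsilon,0}:=\int\Bigl(|Q|(f_{0,\varepsilon})+\frac{Q^2(f_{0,\varepsilon})}{f_{0,\varepsilon}}\Bigr)dv\,dx.$$
   Context: $\mathbb T=\mathbb R/\mathbb Z$. Standing assumptions: $f_{0,\varepsilon}\in L^1(\mathbb T\times\mathbb R)$, $f_{0,\varepsilon}\ge0$, $\int f_{0,\varepsilon}\,dv\,dx=1$, and the initial energy is finite, where $\mathcal E_\varepsilon[f]=\frac12\int f|v|^2\,dv\,dx+\frac{\varepsilon^2}{2}\int|\partial_xV_\varepsilon[f]|^2dx$. Solutions are global strong solutions; for them the energy is preserved, and so is $\int Q(f_\varepsilon)\,dx\,dv$ for any continuous function $Q$. $S$-stable profile: $\mu:\mathbb R\to\mathbb R^+$ with $\int\mu\,dv=1$ such that (i) $\mu$ is continuous; (ii) $\int\mu(v)v^2dv<\infty$; (iii) there is $\bar v\in\mathbb R$ such that $\mu$ is increasing for $v<\bar v$ and decreasing for $v>\bar v$, so $\mu$ reaches its unique maximum at $\bar v$; (iv) $\mu(2\bar v-v)=\mu(v)$ for all $v$. Then there is a unique continuous increasing $\varphi:(-\infty,0]\to\mathbb R^+$ with $\mu(v)=\varphi(-\frac{|v-\bar v|^2}2)$ and $\int_{-\infty}^0\varphi(u)\sqrt{-u}\,du<\infty$.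 Admissible $Q$ and Casimir functional: $Q:\mathbb R^+\to\mathbb R$ satisfies $Q(0)=0$, $Q'=\varphi^{-1}$ on the range of $\varphi$; outside this range the only condition is that $Q'$ is increasing and continuous, so that $Q$ is globally convex and $C^1$ on $\mathbb R^+$. Then $$H_Q(f):=\int_{\mathbb T\times\mathbb R}\bigl(Q(f)-Q(\mu)-Q'(\mu)(f-\mu)\bigr)\,dv\,dx\in[0,+\infty].$$ *)

(* Defs.v *)
From HB Require Import structures.
From mathcomp Require Import all_boot all_order all_algebra.
From mathcomp Require Import all_classical all_reals all_analysis.
Set Implicit Arguments.
Unset Strict Implicit.
Unset Printing Implicit Defensive.
Import Order.TTheory GRing.Theory Num.Theory.
Import numFieldNormedType.Exports.
Local Open Scope classical_set_scope.
Local Open Scope ring_scope.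

(** MathComp-Analysis, over an arbitrary [R : realType].

    The torus T = R/Z is encoded by 1-periodic functions of x in R, with
    integrals over T taken on [0, 1].  Densities are everywhere-defined
    representatives. *)

Definition periodic1 (R : realType) (T : Type) (h : R -> T) : Prop :=
  forall x, h (x + 1) = h x.

Definition torus (R : realType) : set R := `[0, 1]%classic.

Definition phase (R : realType) : set (R * R) := @torus R `*` setT.

Definition phase_int (R : realType) (g : R -> R -> R) : \bar R :=
  (\int[@lebesgue_measure R \x @lebesgue_measure R]_(z in @phase R)
     (g z.1 z.2)%:E)%E.

Definition torus_int (R : realType) (g : R -> R) : \bar R :=
  (\int[@lebesgue_measure R]_(x in @torus R) (g x)%:E)%E.

Definition Linfty_norm (R : realType) (g : R -> R) : \bar R :=
  'N[@lebesgue_measure R]_+oo[EFin \o g]%E.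

Definition smooth (R : realType) (g : R -> R) : Prop :=
  forall (n : nat) (x : R), derivable (derive1n n g) x 1.

(** * S-stable profiles and their Casimir functionals *)

Record S_stable (R : realType) (mu : R -> R) (vb : R) : Prop := {
  S_stable_ge0 : forall v, 0 <= mu v;
  S_stable_mass : (\int[@lebesgue_measure R]_v (mu v)%:E = 1)%E;
  S_stable_continuous : continuous mu;
  S_stable_moment2 : (\int[@lebesgue_measure R]_v (mu v * v ^+ 2)%:E < +oo)%E;
  S_stable_increasing : forall v w, v < w -> w < vb -> mu v < mu w;
  S_stable_decreasing : forall v w, vb < v -> v < w -> mu w < mu v;
  S_stable_symmetric : forall v, mu (2 * vb - v) = mu v }.

(** The function phi on ]-oo, 0] with mu v = phi (- (v - vb)^2 / 2); it is
    determined by mu there, and its values on ]0, +oo[ are irrelevant.  All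
    the other clauses follow from the last one when mu is S-stable. *)
Record profile_function (R : realType) (mu : R -> R) (vb : R) (phi : R -> R)
    : Prop := {
  profile_ge0 : forall u, u <= 0 -> 0 <= phi u;
  profile_continuous : {within `]-oo, 0]%classic, continuous phi};
  profile_increasing : forall u w, u < w -> w <= 0 -> phi u < phi w;
  profile_integrable :
    (\int[@lebesgue_measure R]_(u in `]-oo, 0%R]) (phi u * Num.sqrt (- u))%:E
       < +oo)%E;
  profile_eq : forall v, mu v = phi (- (`|v - vb| ^+ 2 / 2)) }.

(** Q is only relevant on [0, +oo[.  The range of phi is ]0, phi 0], and
    Q' = phi^-1 tends to -oo at 0: so "C^1 on R+" can only mean C^1 on
    ]0, +oo[ and continuous on [0, +oo[.  Strict monotonicity of Q' outside
    the range of phi is not required. *)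
Record admissible (R : realType) (phi Q : R -> R) : Prop := {
  admissible0 : Q 0 = 0;
  admissible_continuous : {within `[0, +oo[%classic, continuous Q};
  admissible_derivable : forall s, 0 < s -> derivable Q s 1;
  admissible_derive_continuous :
    forall s, 0 < s -> {for s, continuous (derive1 Q)};
  admissible_derive_nondecreasing :
    forall s r, 0 < s -> s <= r -> derive1 Q s <= derive1 Q r;
  admissible_derive_inverse : forall u, u <= 0 -> derive1 Q (phi u) = u }.

Definition casimir (R : realType) (mu Q : R -> R) (f : R -> R -> R) : \bar R :=
  phase_int (fun x v =>
    Q (f x v) - Q (mu v) - derive1 Q (mu v) * (f x v - mu v)).

(** * Vlasov-Poisson system *)

(** The energy of f, the potential V being the one generated by f. *)
Definition energy (R : realType) (eps : R) (f : R -> R -> R) (V : R -> R)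
    : \bar R :=
  ((2^-1)%:E * phase_int (fun x v => f x v * `|v| ^+ 2)%R +
   (eps ^+ 2 / 2)%:E * torus_int (fun x => `|derive1 V x| ^+ 2)%R)%E.

(** Standing assumptions on the initial datum [f0]; [V0] is its potential. *)
Record initial_datum (R : realType) (eps : R) (f0 : R -> R -> R) (V0 : R -> R)
    : Prop := {
  initial_periodic : periodic1 f0;
  initial_ge0 : forall x v, 0 <= f0 x v;
  initial_measurable : measurable_fun setT (fun z : R * R => f0 z.1 z.2);
  initial_mass : phase_int f0 = 1%E;
  initial_energy : (energy eps f0 V0 < +oo)%E }.

(** - eps^2 V'' = \int f dv - 1 with a right-hand side in L^1: V is C^1, and
    V' is a primitive of V''. *)
Record poisson (R : realType) (eps : R) (f : R -> R -> R) (V : R -> R)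
    : Prop := {
  poisson_periodic : periodic1 V;
  poisson_derivable : forall x, derivable V x 1;
  poisson_eq : forall a b, a <= b ->
    - eps ^+ 2 * (derive1 V b - derive1 V a) =
    \int[@lebesgue_measure R]_(x in `[a, b])
      ((\int[@lebesgue_measure R]_v f x v) - 1) }.

Definition d_t (R : realType) (psi : R -> R -> R -> R) : R -> R -> R -> R :=
  fun t x v => derive1 (fun s => psi s x v) t.
Definition d_x (R : realType) (psi : R -> R -> R -> R) : R -> R -> R -> R :=
  fun t x v => derive1 (fun y => psi t y v) x.
Definition d_v (R : realType) (psi : R -> R -> R -> R) : R -> R -> R -> R :=
  fun t x v => derive1 (fun w => psi t x w) v.

Definition continuous3 (R : realType) (psi : R -> R -> R -> R) : Prop :=
  continuous (fun z : R * R * R => psi z.1.1 z.1.2 z.2).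

(** C^1 test functions on R x T x R, compactly supported in v. *)
Record test_function (R : realType) (psi : R -> R -> R -> R) : Prop := {
  test_periodic : forall t, periodic1 (psi t);
  test_support : exists r : R, forall t x v, r <= `|v| -> psi t x v = 0;
  test_derivable_t : forall t x v, derivable (fun s => psi s x v) t 1;
  test_derivable_x : forall t x v, derivable (fun y => psi t y v) x 1;
  test_derivable_v : forall t x v, derivable (fun w => psi t x w) v 1;
  test_continuous : continuous3 psi;
  test_continuous_t : continuous3 (d_t psi);
  test_continuous_x : continuous3 (d_x psi);
  test_continuous_v : continuous3 (d_v psi) }.

(** d_t g + v d_x g - V' d_v g = 0 in the sense of distributions, with the
    values of g taken at every time t >= 0. *)
Definition vlasov (R : realType) (V : R -> R -> R) (g : R -> R -> R -> R)
    : Prop :=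
  forall (psi : R -> R -> R -> R) (t : R), test_function psi -> 0 <= t ->
    fine (phase_int (fun x v => g t x v * psi t x v)) -
    fine (phase_int (fun x v => g 0 x v * psi 0 x v)) =
    \int[@lebesgue_measure R]_(s in `[0, t])
      fine (phase_int (fun x v =>
        g s x v * (d_t psi s x v + v * d_x psi s x v
                   - derive1 (V s) x * d_v psi s x v))).

(** Global strong solutions, with initial datum [f0].  Rather than fixing a
    differentiability class for f (the data are only L^1), the record collects
    what such regularity provides: continuity in time with values in L^1, the
    equation for f and, as given by the chain rule, for beta(f), and the
    preservation of the energy and of the integral of G(f) for every
    continuous G on R+.  Every nonnegative solution, with data as in
    [initial_datum], which is C^1 in (t, x, v) and
    satisfies the equations pointwise is an instance.

    In [strong_casimir] both integrals follow the library's convention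
    (positive minus negative part, with +oo - +oo = -oo); as G is arbitrary,
    the two parts are preserved separately. *)
Record strong_solution (R : realType) (eps : R) (f0 : R -> R -> R)
    (f : R -> R -> R -> R) (V : R -> R -> R) : Prop := {
  strong_initial : f 0 = f0;
  strong_periodic : forall t, 0 <= t -> periodic1 (f t);
  strong_ge0 : forall t x v, 0 <= t -> 0 <= f t x v;
  strong_measurable : forall t, 0 <= t ->
    measurable_fun setT (fun z : R * R => f t z.1 z.2);
  strong_continuous : forall t, 0 <= t ->
    phase_int (fun x v => `|f s x v - f t x v|)
      @[s --> within [set s | 0 <= s] (nbhs t)] --> 0%E;
  strong_poisson : forall t, 0 <= t -> poisson eps (f t) (V t);
  strong_vlasov : vlasov V f;
  strong_chain_rule : forall beta : R -> R, beta 0 = 0 ->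
    (forall s, derivable beta s 1) -> continuous (derive1 beta) ->
    (exists C : R, forall s, `|derive1 beta s| <= C) ->
    vlasov V (fun t x v => beta (f t x v));
  strong_energy : forall t, 0 <= t ->
    energy eps (f t) (V t) = energy eps (f 0) (V 0);
  strong_casimir : forall G : R -> R,
    {within `[0, +oo[%classic, continuous G} -> forall t, 0 <= t ->
    phase_int (fun x v => G (f t x v)) = phase_int (fun x v => G (f 0 x v)) }.

(** * Modulated free energy *)

Definition modulated_free_energy (R : realType) (mu Q : R -> R) (vb : R)
    (V0 : R -> R) (eps : R) (f : R -> R -> R -> R) (V : R -> R -> R) (t : R)
    : \bar R :=
  (casimir mu Q
     (fun x v => f t x (v - derive1 V0 (x - vb * t) * sin (t / eps)))%R +
   (2^-1)%:E * torus_int (fun x =>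
     (eps * derive1 (V t) x - derive1 V0 (x - vb * t) * cos (t / eps)) ^+ 2)%R)%E.

(** Since x / 0 = 0 in the library, the quotient is 0 where f0 vanishes. *)
Definition initial_Q (R : realType) (Q : R -> R) (f0 : R -> R -> R) : \bar R :=
  phase_int (fun x v => `|Q (f0 x v)| + Q (f0 x v) ^+ 2 / f0 x v).

(* Main.v *)
Require Import Defs.
From HB Require Import structures.
From mathcomp Require Import all_boot all_order all_algebra.
From mathcomp Require Import all_classical all_reals all_analysis.
From mathcomp Require Import measurable_realfun ess_sup_inf.
From mathcomp Require Import ring lra.
Import Order.TTheory GRing.Theory Num.Theory.
Import numFieldNormedType.Exports.
Local Open Scope classical_set_scope.
Local Open Scope ring_scope.
Set Implicit Arguments.
Unset Strict Implicit.
Unset Printing Implicit Defensive.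

(** The modulated density is f sheared in velocity by the field a = s W, where
    W (t, x) = V0' (x - vb t), s = sin (t / eps) and c = cos (t / eps); the
    modulating electric field is c W.  Write E for V_eps', L for the modulated
    free energy, and w for v - vb.  As Q' (mu v) = - w^2 / 2, expanding L gives
    the conserved energy and Casimir invariant, a constant, and quantities that
    are linear in f or in E, or depend on W alone ([casimir_value],
    [modulated_energy_split]).  The Poisson equation expresses the last two as
    moments of f as well ([poisson_weak]).  Hence L is, up to O(eps), a constant
    plus the integral of f against a polynomial of degree 1 in v
    ([momentum_weight]), whose time derivative is given by the transport
    equation.

    In that derivative the terms of order 1 / eps cancel, since (s W, c W) solves
    the plasma oscillation.  The cross terms in w W W' and E W W' have no sign;
    they oscillate at frequency 2 / eps without resonance, and a corrector
    of size eps inside [momentum_weight] turns them into the cross terms of two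
    squares ([transported_int]).  What remains of order 1 is the integral of
    s W' against f (w + a)^2, minus half the integral of s W' against
    (eps E - c W)^2.  The latter is controlled by L.  The former would be the
    integral of 2 s W' against the Casimir integrand if 2 Q(f) were added to
    f (w + a)^2, because the rest of the integrand depends on mu only and
    integrates to 0 against W' ([casimir_weighted]).  So the integral of 2 s W'
    against Q(f) has to be small, and it is, because it oscillates in time:
    it is the derivative of an integral of size eps, up to eps times an integral
    of w W'' Q(f).  This is where the third derivative of V0 enters, and where
    the inequality |w Q(f)| <= (w^2 f + Q(f)^2 / f) / 2 requires Q^2 / f; its
    integral at time t is bounded by the initial one ([solution_Q2]).  In total

      d/dt (L + O(eps)) <= 2 lam L + O(eps),   lam the supremum of |V0''|,

    and Gronwall's inequality concludes ([free_energy_growth]).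

    The solution is only a weak one.  The transport equation is used in its
    integrated form, for test functions affine in v, obtained from compactly
    supported ones by the energy bound ([vlasov_affine]); and Q, whose derivative
    is unbounded near 0, is replaced by C^1 approximants ([linearized]) obtained
    by freezing Q' outside a compact subinterval of ]0, +oo[.  The error
    that they cause is constant in time, as the integral of a continuous
    function of f is conserved, and it tends to 0. *)

(** * Real-valued integrals *)

Section real_integral.
Context d (T : measurableType d) (R : realType).
Variables (mu : {measure set T -> \bar R}) (D : set T).
Hypothesis mD : measurable D.
Implicit Types (f g : T -> R) (s : seq (R * (T -> R))).

Definition rintegrable f := mu.-integrable D (EFin \o f).

(** Linear combinations are lists of coefficients and functions: integrability
    and value of a long combination then follow together from a single
    pointwise identity, closed by [ring]. *)
Fixpoint rintegrable_all s : Prop :=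
  if s is p :: s' then rintegrable p.2 /\ rintegrable_all s' else True.
Fixpoint lincomb s (z : T) : R :=
  if s is p :: s' then p.1 * p.2 z + lincomb s' z else 0.
Fixpoint lincomb_int s : R :=
  if s is p :: s' then p.1 * \int[mu]_(z in D) p.2 z + lincomb_int s' else 0.

Lemma rintegrableZ (k : R) f : rintegrable f -> rintegrable (fun z => k * f z).
Proof. by move=> fi; apply: (integrableZl mD k fi). Qed.

Lemma rintegrableD f g : rintegrable f -> rintegrable g ->
  rintegrable (fun z => f z + g z).
Proof. by move=> fi gi; apply: (integrableD mD fi gi). Qed.

Lemma rintegrableB f g : rintegrable f -> rintegrable g ->
  rintegrable (fun z => f z - g z).
Proof. by move=> fi gi; apply: (integrableB mD fi gi). Qed.

Lemma eq_rintegrable f g : (forall z, D z -> f z = g z) ->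
  rintegrable f -> rintegrable g.
Proof.
move=> fg; apply: eq_integrable => // z; rewrite inE => Dz.
by rewrite /= fg.
Qed.

Lemma le_rintegrable f g : measurable_fun D f -> rintegrable g ->
  (forall z, D z -> `|f z| <= g z) -> rintegrable f.
Proof.
move=> mf gi fg; apply: (le_integrable mD _ _ gi); first exact/measurable_EFinP.
by move=> z Dz /=; rewrite lee_fin (le_trans (fg _ Dz))// ler_norm.
Qed.

Lemma rintegrable_measurable f : rintegrable f -> measurable_fun D f.
Proof. by move=> /measurable_int /measurable_EFinP. Qed.

Lemma rintegrable_norm f : rintegrable f -> rintegrable (fun z => `|f z|).
Proof. by move=> fi; apply: (integrable_norm fi). Qed.

Lemma Rintegral_lincomb s f : rintegrable_all s ->
  (forall z, D z -> f z = lincomb s z) ->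
  rintegrable f /\ \int[mu]_(z in D) f z = lincomb_int s.
Proof.
move=> si fs.
have {}si : rintegrable (lincomb s) /\ \int[mu]_(z in D) lincomb s z = lincomb_int s.
  elim: s si {fs} => [_|p s IH /= [pi /IH[si <-]]] /=.
    split; last by rewrite Rintegral_cst// mul0r.
    exact: integrable0.
  split; first by apply: rintegrableD => //; exact: rintegrableZ.
  by rewrite RintegralD// ?RintegralZl//; exact: rintegrableZ.
case: si => [si <-]; split.
  by apply: eq_rintegrable si => z Dz; rewrite fs.
by apply: eq_Rintegral => z; rewrite inE => Dz; rewrite fs.
Qed.

Lemma le_Rintegral_norm f g : measurable_fun D f -> rintegrable g ->
  (forall z, D z -> `|f z| <= g z) ->
  `|\int[mu]_(z in D) f z| <= \int[mu]_(z in D) g z.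
Proof.
move=> mf gi fg; have fi := le_rintegrable mf gi fg.
apply: le_trans (le_normr_Rintegral mD fi) _.
by apply: le_Rintegral => //; exact: rintegrable_norm.
Qed.

Lemma ge0_rintegrableP f : measurable_fun D f -> (forall z, D z -> 0 <= f z) ->
  (\int[mu]_(z in D) (f z)%:E < +oo)%E ->
  rintegrable f /\ (\int[mu]_(z in D) (f z)%:E)%E = (\int[mu]_(z in D) f z)%:E.
Proof.
move=> mf f0 fy.
have fi : rintegrable f.
  apply/integrableP; split; first exact/measurable_EFinP.
  under eq_integral => z; first (rewrite inE => Dz; rewrite /= ger0_norm ?f0//; over).
  exact: fy.
by split => //; rewrite /Rintegral fineK//; exact: integrable_fin_num.
Qed.

Lemma rintegrable_fineK f : rintegrable f ->
  (\int[mu]_(z in D) (f z)%:E)%E = (\int[mu]_(z in D) f z)%:E.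
Proof. by move=> fi; rewrite /Rintegral fineK//; exact: integrable_fin_num. Qed.

Lemma Rintegral_dominated (f_ : (T -> R)^nat) f g :
  (forall n, measurable_fun D (f_ n)) ->
  (forall z, D z -> f_ ^~ z @ \oo --> f z) -> rintegrable g ->
  (forall n z, D z -> `|f_ n z| <= g z) ->
  rintegrable f /\ \int[mu]_(z in D) f_ n z @[n --> \oo] --> \int[mu]_(z in D) f z.
Proof.
move=> mf ff gi fg.
have mfl : measurable_fun D f by apply: (measurable_fun_cvg mf).
have [] := @dominated_convergence _ _ _ mu D mD (fun n => EFin \o f_ n)
  (EFin \o f) (EFin \o g).
- by move=> n; exact/measurable_EFinP.
- exact/measurable_EFinP.
- by apply: aeW => z Dz; apply: cvg_EFin; [exact: nearW|exact: ff].
- exact: gi.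
- by apply: aeW => z n Dz; rewrite /= lee_fin fg.
move=> fi _ H; split => //.
by apply: fine_cvg; rewrite -(rintegrable_fineK fi).
Qed.

End real_integral.

Section stability.
Context {R : realType}.
Notation mu := (@lebesgue_measure R).
Notation mu2 := (mu \x mu)%E.
Notation Iph g := (\int[mu2]_(z in @phase R) g z).
Notation Jt g := (\int[mu]_(x in @torus R) g x).
Notation iph := (rintegrable mu2 (@phase R)).
Notation jt := (rintegrable mu (@torus R)).

(** * Calculus on the real line *)

Section calculus.
Implicit Types (g q f : R -> R).

(** A convex function with a continuous subgradient q is differentiable: the
    difference quotient between x and x + h lies between q x and q (x + h). *)
Lemma is_derive_subgradient g q :
  (forall x y, g x + q x * (y - x) <= g y) -> continuous q ->
  forall x, is_derive x (1 : R) g (q x).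
Proof.
move=> bq cq x.
have H : h^-1 *: ((g \o shift x) (h *: (1 : R)) - g x) @[h --> 0^'] --> q x.
  apply/cvgrPdist_le => e e0.
  have cqh : q (h + x) @[h --> 0^'] --> q x.
    apply: cvg_within_filter; rewrite -[in X in _ --> X](add0r x).
    by apply: (@continuous_comp _ _ _ (fun h => h + x) q);
      [apply: cvgD; [exact: cvg_id|exact: cvg_cst]|exact: cq].
  near=> h.
  have h0 : h != 0 by near: h; exact: nbhs_dnbhs_neq.
  rewrite [h *: 1]mulr1 /=.
  have : `|q x - q (h + x)| <= e.
    by near: h; move/cvgrPdist_le : cqh; apply.
  have h1 := bq x (h + x); have h2 := bq (h + x) x.
  set D := g (h + x) - g x.
  have D1 : q x * h <= D by rewrite /D lerBrDl; move: h1; rewrite addrK.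
  have D2 : D <= q (h + x) * h.
    by rewrite /D lerBlDr -lerBlDl; move: h2; rewrite opprD addrCA subrr addr0 mulrN.
  have -> : h^-1 *: D = D / h by rewrite mulrC.
  move: h0; rewrite neq_lt => /orP[h0|h0] qe.
  - rewrite ler_norml; move: qe; rewrite ler_norml => /andP[q1 q2].
    have : D / h <= q x by rewrite ler_ndivrMr.
    have : q (h + x) <= D / h by rewrite ler_ndivlMr.
    by move=> ? ?; apply/andP; split; lra.
  - rewrite ler_norml; move: qe; rewrite ler_norml => /andP[q1 q2].
    have : q x <= D / h by rewrite ler_pdivlMr.
    have : D / h <= q (h + x) by rewrite ler_pdivrMr.
    by move=> ? ?; apply/andP; split; lra.
by apply: DeriveDef; [apply/cvg_ex; exists (q x)|apply/cvg_lim].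
Unshelve. all: by end_near. Qed.

Lemma is_derive_mulr f g x df dg : is_derive x (1 : R) f df ->
  is_derive x (1 : R) g dg ->
  is_derive x (1 : R) (fun t => f t * g t) (df * g x + f x * dg).
Proof.
move=> fd gd; have := is_deriveM fd gd => H.
by apply: (is_derive_eq H); rewrite /GRing.scale /=; ring.
Qed.

Lemma is_derive_addr f g x df dg : is_derive x (1 : R) f df ->
  is_derive x (1 : R) g dg ->
  is_derive x (1 : R) (fun t => f t + g t) (df + dg).
Proof. by move=> fd gd; exact: is_deriveD. Qed.

Lemma is_derive_subr f g x df dg : is_derive x (1 : R) f df ->
  is_derive x (1 : R) g dg ->
  is_derive x (1 : R) (fun t => f t - g t) (df - dg).
Proof. by move=> fd gd; exact: is_deriveB. Qed.

Lemma is_derive_compr f g x df dg : is_derive (g x) (1 : R) f df ->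
  is_derive x (1 : R) g dg ->
  is_derive x (1 : R) (fun t => f (g t)) (df * dg).
Proof. by move=> fd gd; have := is_derive1_comp fd gd => H; apply: (is_derive_eq H). Qed.

Lemma is_derive_scale (k : R) x : is_derive x (1 : R) (fun t => k * t) k.
Proof.
have := is_derive_mulr (is_derive_cst k x 1) (is_derive_id x 1) => H.
by apply: (is_derive_eq H); rewrite mul0r add0r mulr1.
Qed.

Lemma is_derive_shiftr (k : R) x : is_derive x (1 : R) (fun t => t + k) 1.
Proof.
have := is_derive_addr (is_derive_id x 1) (is_derive_cst k x 1) => H.
by apply: (is_derive_eq H); rewrite addr0.
Qed.

Lemma is_deriveE f x d : is_derive x (1 : R) f d -> derive1 f x = d.
Proof. by move=> H; rewrite derive1E derive_val. Qed.

Lemma derivable_continuousT f : (forall x, derivable f x 1) -> continuous f.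
Proof. by move=> df x; apply/differentiable_continuous/derivable1_diffP. Qed.

Lemma is_derive_continuous f df : (forall x, is_derive x (1 : R) f (df x)) ->
  continuous f.
Proof.
by move=> fd; apply: derivable_continuousT => x; have := fd x => ?; exact: ex_derive.
Qed.

Lemma derivable_within f a b :
  (forall x, derivable f x 1) -> {within `[a, b]%classic, continuous f}.
Proof. by move=> df; apply/continuous_subspaceT/derivable_continuousT. Qed.

Lemma continuous_cstr (k : R) : continuous (fun _ : R => k).
Proof. by move=> x; exact: cst_continuous. Qed.

Lemma continuous_idr : continuous (fun x : R => x).
Proof. by move=> x; exact: cvg_id. Qed.

Lemma continuous_mulr f g : continuous f -> continuous g ->
  continuous (fun x => f x * g x).
Proof. by move=> cf cg x; apply: continuousM; [exact: cf|exact: cg]. Qed.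

Lemma continuous_addr f g : continuous f -> continuous g ->
  continuous (fun x => f x + g x).
Proof. by move=> cf cg x; apply: continuousD; [exact: cf|exact: cg]. Qed.

Lemma continuous_subr f g : continuous f -> continuous g ->
  continuous (fun x => f x - g x).
Proof. by move=> cf cg x; apply: continuousB; [exact: cf|exact: cg]. Qed.

Lemma continuous_oppr f : continuous f -> continuous (fun x => - f x).
Proof. by move=> cf x; apply: continuousN; exact: cf. Qed.

Lemma continuous_maxr f g : continuous f -> continuous g ->
  continuous (fun x => Num.max (f x) (g x)).
Proof. by move=> cf cg x; apply: (@continuous_max R R f g); [exact: cf|exact: cg]. Qed.

Lemma continuous_compr f g : continuous f -> continuous g ->
  continuous (fun x => g (f x)).
Proof. by move=> cf cg x; apply: continuous_comp; [exact: cf|exact: cg]. Qed.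

Lemma is_derive_lipschitz f df (C : R) :
  (forall x, is_derive x (1 : R) f (df x)) -> (forall x, `|df x| <= C) ->
  forall x y, `|f y - f x| <= C * `|y - x|.
Proof.
move=> fdf dfC x y; wlog xy : x y / x <= y.
  move=> H; have [|/ltW] := leP x y; first exact: H.
  by rewrite distrC [`|y - x|]distrC; exact: H.
have cf : {within `[x, y]%classic, continuous f}.
  by apply: derivable_within => z; have := fdf z => ?; exact: ex_derive.
have [c _ ->] := MVT_segment xy (fun z _ => fdf z) cf.
by rewrite normrM ler_wpM2r.
Qed.

(** With z the integral on the right-hand side of the hypothesis, the function
    exp (- k t) (y 0 + n + z t) is nonincreasing. *)
Lemma gronwall_ineq (y : R -> R) (k n T : R) :
  0 <= k -> 0 <= n -> 0 <= T -> {within `[0, T]%classic, continuous y} ->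
  (forall t, 0 <= t <= T -> y t <= y 0 +
    \int[@lebesgue_measure R]_(s in `[0, t]) (k * (y s + n))) ->
  y T <= expR (k * T) * (y 0 + n).
Proof.
move=> k0 n0; rewrite le_eqVlt => /predU1P[<- _ _|T0 cy yle].
  by rewrite mulr0 expR0 mul1r lerDl.
have cg : {within `[0, T]%classic, continuous (fun s => k * (y s + n))}.
  move=> x; apply: (@continuousM _ _ (cst k : subspace _ -> R)
    (fun s => y s + n)); first exact: cst_continuous.
  by apply: (@continuousD _ _ _ (y : subspace _ -> R) (cst n));
    [exact: cy|exact: cst_continuous].
have ig : (@lebesgue_measure R).-integrable `[0, T]
    (EFin \o (fun s => k * (y s + n))).
  by apply: continuous_compact_integrable => //; exact: segment_compact.
pose z t := \int[@lebesgue_measure R]_(s in `[0, t]) (k * (y s + n)).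
pose u t := expR (- k * t) * (y 0 + n + z t).
have dz t : t \in `]0, T[ -> is_derive t (1 : R) z (k * (y t + n)).
  rewrite in_itv /= => /andP[t0 tT].
  have [|dzt <-] := @continuous_FTC1_closed R _ 0 t T tT ig t0.
    by have /(continuous_within_itvP _ T0)[+ _ _] := cg; apply;
      rewrite in_itv /= t0.
  by rewrite derive1E; apply: derivableP.
have du t : t \in `]0, T[ ->
    is_derive t (1 : R) u (expR (- k * t) * (k * (y t + n) - k * (y 0 + n + z t))).
  move=> tT; have := is_derive_mulr
    (is_derive_compr (is_derive_expR (- k * t)) (is_derive_scale (- k) t))
    (is_derive_addr (is_derive_cst (y 0 + n) t (1 : R)) (dz _ tT)) => H.
  by apply: (is_derive_eq H); rewrite /=; ring.
have uu : u T <= u 0.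
  apply: (@ler0_derive1_le_cc _ u 0 T) => //.
  - by move=> t tT; have := du _ tT => dut; exact: ex_derive.
  - move=> t tT; rewrite (is_deriveE (du _ tT)).
    rewrite pmulr_rle0 ?expR_gt0// subr_le0 ler_wpM2l//.
    move: tT; rewrite in_itv /= => /andP[t0 tT].
    have := yle t; rewrite (ltW t0) (ltW tT) => /(_ isT) yt.
    by rewrite addrAC lerD2r.
  - have cz := parameterized_integral_continuous (ltW T0) ig.
    move=> x; apply: (@continuousM _ _ ((fun t => expR (- k * t)) : subspace _ -> R)
      (fun t => y 0 + n + z t)).
      apply: continuous_subspaceT => t.
      by apply: continuous_comp; [apply: mulrl_continuous|exact: continuous_expR].
    by apply: (@continuousD _ _ _ (cst (y 0 + n) : subspace _ -> R) z);
      [exact: cst_continuous|exact: cz].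
  - by rewrite in_itv /= lexx ltW.
  - by rewrite in_itv /= lexx ltW.
  - exact: ltW.
have z0 : z 0 = 0 by rewrite /z set_itv1 Rintegral_set1.
move: uu; rewrite /u z0 mulr0 expR0 addr0 mul1r mulNr expRN ler_pdivrMl ?expR_gt0//.
apply: le_trans.
have := yle T; rewrite lexx ltW// => /(_ isT) yT.
by rewrite addrAC -/(z T) (le_trans yT)// lerDl.
Qed.
End calculus.

Section measurability.

Lemma measurable_fun_fst (p : R -> R) : measurable_fun setT p ->
  measurable_fun setT (fun z : R * R => p z.1).
Proof. by move=> mp; apply: (measurableT_comp mp); exact: measurable_fst. Qed.

Lemma measurable_fun_snd (p : R -> R) : measurable_fun setT p ->
  measurable_fun setT (fun z : R * R => p z.2).
Proof. by move=> mp; apply: (measurableT_comp mp); exact: measurable_snd. Qed.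

Lemma continuous_measurableT (p : R -> R) : continuous p -> measurable_fun setT p.
Proof. exact: continuous_measurable_fun. Qed.

End measurability.

(** * Absolutely continuous functions *)

Section absolutely_continuous.
Implicit Types (a b : R) (k l F G : R -> R).

Lemma within_continuous_bounded a b F : a <= b ->
  {within `[a, b]%classic, continuous F} ->
  exists2 M, 0 <= M & forall x, a <= x <= b -> `|F x| <= M.
Proof.
move=> ab cF; have [c _ cM] := EVT_max ab cF; have [c' _ cm] := EVT_min ab cF.
exists (`|F c| + `|F c'|) => [|x xab]; first by rewrite addr_ge0.
have := cM x; have := cm x; rewrite in_itv /= => /(_ xab) m1 /(_ xab) m2.
have := ler_norm (F c); have := ler_norm (- F c'); rewrite normrN => n1 n2.
have := normr_ge0 (F c); have := normr_ge0 (F c') => n3 n4.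
by rewrite ler_norml; apply/andP; split; lra.
Qed.

Lemma within_continuous_measurable a b F :
  {within `[a, b]%classic, continuous F} -> measurable_fun `[a, b] F.
Proof. by move=> cF; apply: subspace_continuous_measurable_fun. Qed.

Lemma within_continuous_rintegrable a b F :
  {within `[a, b]%classic, continuous F} -> rintegrable mu `[a, b] F.
Proof.
by move=> cF; apply: continuous_compact_integrable => //; exact: segment_compact.
Qed.

Lemma rintegrableM_continuous a b k G : a <= b -> rintegrable mu `[a, b] k ->
  {within `[a, b]%classic, continuous G} ->
  rintegrable mu `[a, b] (fun x => k x * G x).
Proof.
move=> ab ki cG; have [M M0 GM] := within_continuous_bounded ab cG.
apply: (@le_rintegrable _ _ _ mu `[a, b] _ _ (fun x => M * `|k x|)) => //.
- apply: measurable_funM; first exact: (rintegrable_measurable ki).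
  exact: within_continuous_measurable.
- by apply: rintegrableZ => //; exact: rintegrable_norm.
- move=> z; rewrite /= in_itv /= => /GM zM.
  by rewrite normrM mulrC ler_wpM2r.
Qed.

(** Absolutely continuous functions, given with a density k that need only be
    integrable. *)
Definition primitive a b k F :=
  forall x, a <= x <= b -> F x = F a + \int[mu]_(s in `[a, x]) k s.

Lemma primitive_continuous a b k F : a <= b -> rintegrable mu `[a, b] k ->
  primitive a b k F -> {within `[a, b]%classic, continuous F}.
Proof.
move=> ab ki Fk; have ck := parameterized_integral_continuous ab ki.
have cG : {within `[a, b]%classic, continuous
    (fun x => F a + parameterized_integral mu a x k)}.
  by move=> x; apply: (@continuousD _ _ _ (cst (F a) : subspace _ -> R)
    (fun x => parameterized_integral mu a x k)); [exact: cst_continuous|exact: ck].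
apply: subspace_eq_continuous cG => x; rewrite inE /= in_itv /= => xab.
by rewrite /from_subspace (Fk x xab).
Qed.

Lemma integral_indicator (c : R) (D : set R) (g : R -> R) : measurable D ->
  rintegrable mu D g -> forall h : R -> R,
  (forall y, h y = if y \in D then c * g y else 0) ->
  (\int[mu]_y (h y)%:E = (c * \int[mu]_(y in D) g y)%:E)%E.
Proof.
move=> mD gi h hE; rewrite -(@RintegralZl _ _ _ mu D g c mD gi) -rintegrable_fineK//; last first.
  exact: rintegrableZ.
rewrite [RHS]integral_mkcond; apply: eq_integral => y _.
by rewrite hE patchE; case: ifP.
Qed.

(** The densities being merely integrable, the product rule comes from Fubini's
    theorem for k x l y on the triangle y <= x of the square. *)
Lemma AC_by_parts a b k l F G : a <= b ->
  rintegrable mu `[a, b] k -> rintegrable mu `[a, b] l ->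
  primitive a b k F -> primitive a b l G ->
  \int[mu]_(x in `[a, b]) (k x * G x + F x * l x) = F b * G b - F a * G a.
Proof.
move=> ab ki li Fk Gl.
have cF := primitive_continuous ab ki Fk; have cG := primitive_continuous ab li Gl.
pose h (z : R * R) := (k \_ `[a, b]) z.1 * (l \_ `[a, b]) z.2 * (z.2 <= z.1)%R%:R.
have mk : measurable_fun setT (k \_ `[a, b]).
  by apply/(measurable_restrictT _ _).1 => //; exact: rintegrable_measurable ki.
have ml : measurable_fun setT (l \_ `[a, b]).
  by apply/(measurable_restrictT _ _).1 => //; exact: rintegrable_measurable li.
have mh : measurable_fun setT h.
  apply: measurable_funM.
    by apply: measurable_funM; [exact: measurable_fun_fst|exact: measurable_fun_snd].
  have -> : (fun z : R * R => (z.2 <= z.1)%R%:R : R) =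
      \1_[set z : R * R | z.2 <= z.1].
    apply/funext => z; rewrite indicE; have [zz|zz] := boolP (z.2 <= z.1)%R.
      by rewrite mem_set.
    by rewrite memNset//; exact/negP.
  apply: measurable_indic; rewrite -[X in measurable X]setTI.
  have : measurable_fun setT (fun z : R * R => z.1 - z.2).
    by apply: measurable_funB; [exact: measurable_fst|exact: measurable_snd].
  move=> /(_ measurableT `[0, +oo[%classic (measurable_itv _)).
  congr measurable; apply/seteqP; split=> z /=; rewrite !in_itv /= ?andbT subr_ge0.
    by [].
  by [].
have kki : rintegrable mu setT (k \_ `[a, b]).
  by rewrite /rintegrable -restrict_EFin; apply/integrable_restrict => //; rewrite setTI.
have lli : rintegrable mu setT (l \_ `[a, b]).
  by rewrite /rintegrable -restrict_EFin; apply/integrable_restrict => //; rewrite setTI.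
have hi : (mu \x mu)%E.-integrable setT (EFin \o h).
  apply: (@le_integrable _ _ _ (mu \x mu)%E setT measurableT _
    (fun z => ((k \_ `[a, b]) z.1 * (l \_ `[a, b]) z.2)%:E)).
  - exact/measurable_EFinP.
  - move=> z _; rewrite /= lee_fin /h [leLHS]normrM -[leRHS]mulr1 ler_wpM2l//.
    by have [?|?] := boolP (z.2 <= z.1); rewrite ?normr1 ?normr0.
  - apply/integrable12ltyP.
      apply/measurable_EFinP; apply: measurable_funM;
        [exact: measurable_fun_fst|exact: measurable_fun_snd].
    have E x : (\int[mu]_y `|((k \_ `[a, b]) x * (l \_ `[a, b]) y)%:E| =
        (`|(k \_ `[a, b]) x| * \int[mu]_y `|(l \_ `[a, b]) y|)%:E)%E.
      apply: (@integral_indicator _ setT (fun y => `|(l \_ `[a, b]) y|)) => //.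
      - exact: rintegrable_norm.
      - by move=> y; rewrite in_setT normrM.
    under eq_integral do rewrite E mulrC.
    have := rintegrableZ measurableT (\int[mu]_y `|(l \_ `[a, b]) y|)
      (rintegrable_norm kki).
    by move=> /(rintegrable_fineK measurableT) ->; rewrite ltry.
have F1 x : (\int[mu]_y (h (x, y))%:E =
    (((fun x => k x * (G x - G a)) \_ `[a, b]) x)%:E)%E.
  have [xab|xab] := boolP (x \in `[a, b]%classic); last first.
    rewrite patchE (negbTE xab) integral0_eq// => y _.
    by rewrite /h patchE (negbTE xab) !mul0r.
  move: (xab); rewrite inE /= in_itv /= => xab'; case/andP: (xab') => ax xb.
  rewrite patchE xab (Gl x xab') [G a + _]addrC addrK.
  apply: integral_indicator => //.
    by apply: integrableS li => //; apply: subset_itvl; rewrite bnd_simp.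
  move=> y; rewrite /h /= patchE xab patchE !mem_setE !in_itv /=.
  case: (leP y x) => yx; last by rewrite mulr0 andbF.
  by rewrite (le_trans yx xb) !andbT mulr1; case: ifP => // _; rewrite mulr0.
have F2 y : (\int[mu]_x (h (x, y))%:E =
    (((fun y => l y * (F b - F y)) \_ `[a, b]) y)%:E)%E.
  have [yab|yab] := boolP (y \in `[a, b]%classic); last first.
    rewrite patchE (negbTE yab) integral0_eq// => x _.
    by rewrite /h /= [(l \_ _) y]patchE (negbTE yab) mulr0 mul0r.
  move: (yab); rewrite inE /= in_itv /= => yab'; case/andP: (yab') => ay yb.
  have kyb : rintegrable mu `[y, b] k.
    by apply: integrableS ki => //; apply: subset_itvr; rewrite bnd_simp.
  rewrite patchE yab; have -> : F b - F y = \int[mu]_(x in `[y, b]) k x.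
    rewrite (Fk y yab') (Fk b) ?ab ?lexx// opprD addrACA subrr add0r.
    rewrite (Rintegral_itvB ki) ?bnd_simp// Rintegral_itv_obnd_cbnd//.
    by apply: integrableS kyb => //; apply: subset_itvr; rewrite bnd_simp.
  apply: integral_indicator => // x; rewrite /h /= [(l \_ _) y]patchE yab patchE !mem_setE !in_itv /=.
  case: (leP y x) => yx; last by rewrite mulr0.
  by rewrite (le_trans ay yx) /= mulr1 mulrC; case: ifP => // _; rewrite mulr0.
have := Fubini hi.
under eq_integral do rewrite /= F1; under [RHS]eq_integral do rewrite /= F2.
have cst_c c : {within `[a, b]%classic, continuous (cst c : R -> R)}.
  by move=> x; exact: cst_continuous.
have cGa : {within `[a, b]%classic, continuous (fun x => G x - G a)}.
  by move=> x; apply: (@continuousB _ _ _ (G : subspace _ -> R) (cst (G a)));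
    [exact: cG|exact: cst_c].
have cFb : {within `[a, b]%classic, continuous (fun x => F b - F x)}.
  by move=> x; apply: (@continuousB _ _ _ (cst (F b) : subspace _ -> R) F);
    [exact: cst_c|exact: cF].
have I1 := rintegrableM_continuous ab ki cGa.
have I2 := rintegrableM_continuous ab li cFb.
have R1 g : (\int[mu]_x ((g \_ `[a, b]) x)%:E =
    \int[mu]_(x in `[a, b]) (g x)%:E)%E.
  by rewrite [RHS]integral_mkcond restrict_EFin.
rewrite !R1.
rewrite !rintegrable_fineK// => -[I12].
have [||_ ->] := @Rintegral_lincomb _ _ _ mu `[a, b] (measurable_itv _)
    [:: (1, fun x => k x * (G x - G a)); (G a, k); (F b, l);
        (-1, fun x => l x * (F b - F x))] (fun x => k x * G x + F x * l x).
- by do !split.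
- by move=> z _ /=; ring.
rewrite /= I12; have := Fk b; rewrite ab lexx => /(_ isT) Fb.
have := Gl b; rewrite ab lexx => /(_ isT) Gb.
have -> : \int[mu]_(x in `[a, b]) k x = F b - F a by rewrite Fb addrC addKr.
have -> : \int[mu]_(x in `[a, b]) l x = G b - G a by rewrite Gb addrC addKr.
by ring.
Qed.

End absolutely_continuous.

(** * Integration on phase space *)

Section phase_space.

Lemma measurable_torus : measurable (@torus R).
Proof. exact: measurable_itv. Qed.

Lemma measurable_phase : measurable (@phase R).
Proof. by apply: measurableX => //; exact: measurable_torus. Qed.

(** Fixing the measure once and for all spares unification the search for the
    measurable structure of the product. *)
Definition phase_lincomb := @Rintegral_lincomb _ _ _ mu2 _ measurable_phase.
Definition torus_lincomb := @Rintegral_lincomb _ _ _ mu _ measurable_torus.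
Definition phase_le_rintegrable := @le_rintegrable _ _ _ mu2 _ measurable_phase.
Definition torus_le_rintegrable := @le_rintegrable _ _ _ mu _ measurable_torus.
Definition phase_rintegrableZ := @rintegrableZ _ _ _ mu2 _ measurable_phase.
Definition torus_rintegrableZ := @rintegrableZ _ _ _ mu _ measurable_torus.
Definition phase_le_Rintegral_norm := @le_Rintegral_norm _ _ _ mu2 _ measurable_phase.
Definition torus_le_Rintegral_norm := @le_Rintegral_norm _ _ _ mu _ measurable_torus.
Definition phase_rintegrable_fineK := @rintegrable_fineK _ _ _ mu2 _ measurable_phase.
Definition torus_rintegrable_fineK := @rintegrable_fineK _ _ _ mu _ measurable_torus.
Definition phase_rintegrableB := @rintegrableB _ _ _ mu2 _ measurable_phase.
Definition torus_rintegrableB := @rintegrableB _ _ _ mu _ measurable_torus.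
Definition phase_eq_rintegrable := @eq_rintegrable _ _ _ mu2 _ measurable_phase.
Definition torus_eq_rintegrable := @eq_rintegrable _ _ _ mu _ measurable_torus.
Definition phase_dominated := @Rintegral_dominated _ _ _ mu2 _ measurable_phase.
Definition phase_rintegrableD := @rintegrableD _ _ _ mu2 _ measurable_phase.
Definition phase_ge0_rintegrableP := @ge0_rintegrableP _ _ _ mu2 _ measurable_phase.

Lemma lebesgue_measure_shift (c : R) (A : set R) : measurable A ->
  pushforward mu ((fun v => v + c) : _ -> measurableTypeR R) A = mu A.
Proof.
move=> mA; apply/esym/lebesgue_measure_unique => //=; first exact: measurable_funD.
move=> _ _ [[a b]] _ <-.
rewrite /pushforward /= [X in _ = _ X](_ : _ = `]a - c, b - c]%classic).
  rewrite !lebesgue_measure_itv/= !lte_fin ltrD2r.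
  by case: ifP => // _; rewrite -!EFinB; congr (_%:E); ring.
by apply/seteqP; split=> v /=; rewrite !in_itv /= ltrBlDr lerBrDr.
Qed.

Lemma integral_shift (c : R) (h : R -> \bar R) : measurable_fun setT h ->
  (forall v, 0 <= h v)%E -> (\int[mu]_v h (v + c)%R = \int[mu]_v h v)%E.
Proof.
move=> mh h0.
have ms : measurable_fun setT ((fun v => v + c) : R -> measurableTypeR R).
  by apply: measurable_funD.
rewrite -[X in integral _ X _](@preimage_setT _ _
  ((fun v => v + c) : measurableTypeR R -> measurableTypeR R)).
rewrite -(@ge0_integral_pushforward _ _ (measurableTypeR R) (measurableTypeR R) R _ ms)//=.
by apply: eq_measure_integral => //= A mA AS; exact: lebesgue_measure_shift.
Qed.

Lemma phase_tonelli (g : R * R -> \bar R) : measurable_fun setT g ->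
  (forall z, 0 <= g z)%E ->
  (\int[mu2]_(z in @phase R) g z = \int[mu]_(x in @torus R) \int[mu]_v g (x, v))%E.
Proof.
move=> mg g0; rewrite integral_mkcond fubini_tonelli1/=; last 2 first.
- apply/(measurable_restrictT _ _).1; first exact: measurable_phase.
  exact: measurable_funS mg.
- by move=> z; rewrite patchE; case: ifP.
rewrite [RHS]integral_mkcond; apply: eq_integral => x _.
rewrite /fubini_F patchE; case: ifPn => xT.
  apply: eq_integral => v _; rewrite patchE mem_set//; split => //=.
  by move: xT; rewrite inE.
by rewrite integral0_eq// => v _; rewrite patchE memNset// => -[/= xT' _];
  move: xT; rewrite mem_set.
Qed.

(** By Tonelli's theorem, the translation invariance of dv suffices. *)
Lemma phase_shear (g : R * R -> \bar R) (a : R -> R) : measurable_fun setT g ->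
  (forall z, 0 <= g z)%E -> measurable_fun setT a ->
  (\int[mu2]_(z in @phase R) g (z.1, z.2 + a z.1)%R =
   \int[mu2]_(z in @phase R) g z)%E.
Proof.
move=> mg g0 ma.
have ms : measurable_fun setT (fun z : R * R => (z.1, z.2 + a z.1)).
  apply: measurable_fun_pair; first exact: measurable_fst.
  by apply: measurable_funD; [exact: measurable_snd|exact: measurable_fun_fst].
rewrite (phase_tonelli mg g0).
rewrite (phase_tonelli (measurableT_comp mg ms) (fun z => g0 (z.1, z.2 + a z.1))).
apply: eq_integral => x _.
rewrite (@integral_shift (a x) (fun v => g (x, v)))//.
by apply: (measurableT_comp mg).
Qed.

Lemma phase_fubini (g : R * R -> R) : rintegrable mu2 (@phase R) g ->
  [/\ rintegrable mu (@torus R) (fun x => \int[mu]_v g (x, v)),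
      \int[mu2]_(z in @phase R) g z =
        \int[mu]_(x in @torus R) (\int[mu]_v g (x, v)) &
      {ae mu, forall x, @torus R x -> rintegrable mu setT (fun v => g (x, v))}].
Proof.
move=> gi.
pose g' : R * R -> \bar R := (EFin \o g) \_ (@phase R).
have g'i : mu2.-integrable setT g'.
  by apply/integrable_restrict; [exact: measurable_phase|
    by []|rewrite setTI].
have g'in x : @torus R x -> (fun v => g' (x, v)) = EFin \o (fun v => g (x, v)).
  by move=> xT; apply/funext => v; rewrite /g' patchE mem_set.
have g'out x : ~ @torus R x -> (fun v => g' (x, v)) = cst 0%E.
  by move=> xT; apply/funext => v; rewrite /g' patchE memNset// => -[].
have FE : fubini_F mu g' = (fun x => \int[mu]_v (g (x, v))%:E)%E \_ (@torus R).
  apply/funext => x; rewrite /fubini_F patchE; case: ifPn => xT.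
    by apply: eq_integral => v _; move: xT; rewrite inE => /g'in /(congr1 (@^~ v)).
  rewrite integral0_eq// => v _; have /g'out /(congr1 (@^~ v)) // : ~ @torus R x.
  by move=> xT'; move: xT; rewrite mem_set.
have Fi : mu.-integrable (@torus R) (fun x => \int[mu]_v (g (x, v))%:E)%E.
  have : mu.-integrable setT (fubini_F mu g') := integrable_fubini_F g'i.
  rewrite FE.
  move=> H; rewrite -[X in mu.-integrable X](setTI (@torus R)).
  by apply/integrable_restrict => //; exact: measurable_torus.
have Fa : {ae mu, forall x, @torus R x ->
    (\int[mu]_v (g (x, v))%:E)%E \is a fin_num}.
  by apply: (integrable_ae _ Fi); exact: measurable_torus.
have mF : measurable_fun (@torus R) (fun x => \int[mu]_v g (x, v)).
  by apply: measurableT_comp => //; exact: measurable_int Fi.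
have Ri : rintegrable mu (@torus R) (fun x => \int[mu]_v g (x, v)).
  apply: (@le_integrable _ _ _ mu _ measurable_torus _ _ _ _ Fi);
    first exact/measurable_EFinP.
  move=> x _ /=; rewrite /Rintegral.
  by case: (\int[mu]_v _)%E => [r||] //=; rewrite normr0 leey.
split => //.
- rewrite /Rintegral integral_mkcond -/g' -(integral12_prod_meas1 g'i).
  rewrite [X in fine X](_ : _ = \int[mu]_x (fubini_F mu g' x))%E// FE.
  rewrite -integral_mkcond; congr fine.
  apply: ae_eq_integral.
  + exact: measurable_torus.
  + exact: measurable_int Fi.
  + exact/measurable_EFinP.
  + apply: filterS Fa; first exact: (ae_filter_ringOfSetsType mu).
    by move=> x /[apply] Fx; rewrite /= fineK.
- have := ae_integrable1 g'i.
  apply: (@filterS _ _ (ae_filter_ringOfSetsType mu)).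
  by move=> x + xT; rewrite g'in.
Qed.

End phase_space.

(** * Functions on the torus *)

Section torus_functions.
Implicit Types (h p g : R -> R).

Lemma lebesgue_setT_gt0 : (0 < mu [set: R])%E.
Proof.
have : (mu `]0%R, 1%R[ <= mu [set: R])%E by apply: le_measure; rewrite ?inE.
apply: lt_le_trans; rewrite lebesgue_measure_itv /= lte_fin ltr01.
by rewrite -EFinB lte_fin subr0 ltr01.
Qed.

Lemma Linfty_norm_bound h (M : R) : (forall x, `|h x| <= M) ->
  (Linfty_norm h <= M%:E)%E.
Proof.
move=> hM; rewrite /Linfty_norm unlock lebesgue_setT_gt0.
by apply/ess_supP/nearW => x /=; rewrite lee_fin.
Qed.

(** For a continuous function the essential supremum bounds every value, as a
    nonempty open set is not negligible. *)
Lemma le_Linfty_norm h : continuous h -> (Linfty_norm h < +oo)%E ->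
  forall x, `|h x| <= fine (Linfty_norm h).
Proof.
move=> ch hfin x.
have h0 : (0 <= Linfty_norm h)%E by exact: Lnorm_ge0.
have hE : Linfty_norm h = (fine (Linfty_norm h))%:E.
  by rewrite fineK// ge0_fin_numE.
rewrite leNgt; apply/negP => hx.
set M := fine _ in hE hx.
have : (\forall y \ae mu, (abse \o (EFin \o h)) y <= M%:E)%E.
  by apply/ess_supP; rewrite -hE /Linfty_norm unlock lebesgue_setT_gt0.
case=> N [mN N0 sN].
have ch' : {for x, continuous (fun y => `|h y|)}.
  by apply: continuous_comp; [exact: ch|exact: norm_continuous].
have := ch' => /cvgrPdist_lt /(_ (`|h x| - M)); rewrite subr_gt0 => /(_ hx).
move=> /nbhs_ballP[d /= d0 dM].
have sub : `]x - d, x + d[ `<=` N.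
  move=> y /=; rewrite in_itv /= => /andP[y1 y2]; apply: sN => /=; rewrite lee_fin.
  have : ball x d y by rewrite /ball /= ltr_norml; apply/andP; split; lra.
  by move=> /dM; rewrite ltr_norml => /andP[_ ?]; apply/negP; rewrite -ltNge; lra.
have : (mu `](x - d)%R, (x + d)%R[ <= mu N)%E by apply: le_measure; rewrite ?inE.
rewrite N0 lebesgue_measure_itv /= lte_fin.
have -> : x - d < x + d by lra.
by rewrite -EFinB lee_fin leNgt => /negP; apply; lra.
Qed.

Lemma periodic_zero_mod (x : R) h : periodic1 h ->
  exists2 y, 0 <= y <= 1 & h x = h y.
Proof.
move=> hp.
have hn (n : nat) y : h (y + n%:R) = h y.
  elim: n y => [|n IH] y; first by rewrite addr0.
  by rewrite -natr1 addrA hp IH.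
exists (x - (Num.floor x)%:~R).
  have := floor_le_tmp x; have := floorD1_gt x; rewrite intrD => ? ?.
  by apply/andP; split; lra.
case: (Num.floor x) => n.
  by rewrite -[RHS](hn n) -pmulrn subrK.
by rewrite NegzE mulrNz opprK -pmulrn hn.
Qed.

Lemma periodic_continuous_bounded h : periodic1 h -> continuous h ->
  exists2 M, 0 <= M & forall x, `|h x| <= M.
Proof.
move=> hp ch; have [M M0 hM] := within_continuous_bounded (@ler01 R)
  (continuous_subspaceT ch).
by exists M => // x; have [y y01 ->] := periodic_zero_mod x hp; exact: hM.
Qed.

Lemma integral_derivative h p (a b : R) : a <= b ->
  (forall x, a <= x <= b -> is_derive x (1 : R) h (p x)) -> continuous p ->
  \int[mu]_(x in `[a, b]) p x = h b - h a.
Proof.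
rewrite le_eqVlt => /predU1P[-> _ _|ab hd cp].
  by rewrite set_itv1 Rintegral_set1 subrr.
have ch x : a <= x <= b -> {for x, continuous h}.
  move=> /hd xh; apply/differentiable_continuous/derivable1_diffP.
  exact: ex_derive.
rewrite /Rintegral (@continuous_FTC2 _ p h a b)//.
- exact: continuous_subspaceT.
- split.
  + move=> x; rewrite in_itv /= => /andP[ax xb].
    by have := hd x; rewrite (ltW ax) (ltW xb) => /(_ isT) ?; exact: ex_derive.
  + by apply: cvg_at_right_filter; apply: ch; rewrite lexx ltW.
  + by apply: cvg_at_left_filter; apply: ch; rewrite lexx ltW.
- move=> x; rewrite in_itv /= => /andP[ax xb].
  by apply: is_deriveE; apply: hd; rewrite !ltW.
Qed.

Lemma torus_int1 : \int[mu]_(x in @torus R) 1 = 1.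
Proof.
have := integral_derivative (@ler01 R) (fun x _ => is_derive_id x 1) (@continuous_cstr 1).
by rewrite subr0.
Qed.

Lemma torus_int_derivative h p : periodic1 h ->
  (forall x, is_derive x (1 : R) h (p x)) -> continuous p ->
  \int[mu]_(x in @torus R) p x = 0.
Proof.
move=> hp hd cp; rewrite (integral_derivative (@ler01 R) (fun x _ => hd x) cp).
by rewrite -[X in h X]add0r hp subrr.
Qed.

Lemma continuous_primitive (m M : R) p : continuous p -> exists h : R -> R,
  forall x, m < x < M -> is_derive x (1 : R) h (p x).
Proof.
move=> cp; exists (fun x => \int[mu]_(t in `[m, x]) p t) => x /andP[mx xM].
have ip : mu.-integrable `[m, M] (EFin \o p).
  exact: within_continuous_rintegrable (continuous_subspaceT cp).
have [dx <-] := continuous_FTC1_closed xM ip mx (cp x).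
by rewrite derive1E; exact: derivableP.
Qed.

(** By periodicity it suffices to consider c in [0, 1]. If h is a primitive of p,
    the integral is h (1 - c) - h (- c), and its derivative in c vanishes. *)
Lemma torus_int_shift p (c : R) : periodic1 p -> continuous p ->
  \int[mu]_(x in @torus R) p (x - c) = \int[mu]_(x in @torus R) p x.
Proof.
move=> pp cp; have [h hd] := continuous_primitive (-2) 2 cp.
pose G (s : R) := h (1 - s) - h (0 - s).
have d (k s : R) : is_derive s (1 : R) (fun s => k - s) (- 1).
  have H := is_derive_subr (is_derive_cst k s 1) (is_derive_id s 1).
  by apply: (is_derive_eq H); rewrite sub0r.
have E (s : R) : 0 <= s <= 1 -> \int[mu]_(x in @torus R) p (x - s) = G s.
  move=> /andP[s0 s1].
  apply: (@integral_derivative (fun x => h (x - s)) _ _ _ (@ler01 R)).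
    move=> x /andP[x0 x1]; rewrite -[X in is_derive _ _ _ X]mulr1.
    apply: is_derive_compr (is_derive_shiftr (- s) x).
    by apply: hd; apply/andP; split; lra.
  by apply: (@continuous_compr (fun x => x - s) p);
    [apply: continuous_subr; [exact: continuous_idr|exact: continuous_cstr]|].
have dG (s : R) : 0 <= s <= 1 -> is_derive s (1 : R) G 0.
  move=> /andP[s0 s1].
  have h1 : is_derive (1 - s) (1 : R) h (p (1 - s)) by apply: hd; apply/andP; split; lra.
  have h0 : is_derive (0 - s) (1 : R) h (p (0 - s)) by apply: hd; apply/andP; split; lra.
  have H := is_derive_subr (@is_derive_compr h (fun s => 1 - s) s _ _ h1 (d 1 s))
    (@is_derive_compr h (fun s => 0 - s) s _ _ h0 (d 0 s)).
  by apply: (is_derive_eq H); rewrite -(pp (0 - s)) [0 - s + 1]addrC add0r subrr.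
have [|y /andP[y0 y1] ->] := @periodic_zero_mod c
  (fun c => \int[mu]_(x in @torus R) p (x - c)).
  by move=> x; apply: eq_Rintegral => z _; rewrite -[LHS]pp; congr p; ring.
have [||s _] := @MVT_segment _ G (cst 0) 0 y y0.
- move=> s; rewrite in_itv /= => /andP[s0 sy]; apply: dG.
  by rewrite ltW//= (le_trans (ltW sy)).
- apply/continuous_in_subspaceT => s; rewrite inE /= in_itv /= => /andP[s0 sy].
  have := dG s; rewrite s0 (le_trans sy)// => /(_ isT) ds.
  by apply/differentiable_continuous/derivable1_diffP; exact: ex_derive.
rewrite mul0r E ?y0// => /eqP; rewrite subr_eq0 => /eqP ->.
have := E 0; rewrite lexx ler01 => /(_ isT) <-.
by apply: eq_Rintegral => x _; rewrite subr0.
Qed.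

End torus_functions.

(** * Smooth approximation of the entropy *)

Section admissible_functions.
Implicit Types (s r : R).

Lemma continuous_max0 (G : R -> R) : {within `[0, +oo[%classic, continuous G} ->
  continuous (fun s : R => G (Num.max s 0)).
Proof.
move=> cG s; have ms : `[0, +oo[%classic (Num.max s 0).
  by rewrite /= in_itv /= andbT le_max lexx orbT.
have /subspace_continuousP /(_ _ ms) GA := cG.
apply: (cvg_comp (fun s : R => Num.max s 0) G _ GA).
move=> A; rewrite /within /= => wA.
have cm : {for s, continuous (fun s : R => Num.max s 0)}.
  by apply: (@continuous_max R R id (cst 0)); [by move=> ?; exact: cvg_id|exact: cst_continuous].
apply: (@filterS R (nbhs s) (nbhs_filter s) _ _ _ (cm _ wA)) => y /=; apply.
by rewrite in_itv /= andbT le_max lexx orbT.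
Qed.

Lemma measurable_continuous_comp d (T : measurableType d) (G : R -> R) (h : T -> R) :
  {within `[0, +oo[%classic, continuous G} -> measurable_fun setT h ->
  (forall z, 0 <= h z) -> measurable_fun setT (fun z => G (h z)).
Proof.
move=> cG mh h0.
have -> : (fun z => G (h z)) = (fun s : R => G (Num.max s 0)) \o h.
  by apply/funext => z; rewrite /= max_l.
by apply: measurableT_comp => //; apply: continuous_measurableT; exact: continuous_max0.
Qed.

Variables (phi Q : R -> R).
Hypothesis hQ : admissible phi Q.
Variable s0 : R.
Hypotheses (s0_gt0 : 0 < s0) (Qs0 : derive1 Q s0 = 0).
Notation q := (derive1 Q).

Lemma admissible_tangent s r : 0 < s -> 0 <= r -> Q s + q s * (r - s) <= Q r.
Proof.
move=> sp r0.
have cQ (a b : R) : 0 <= a -> {within `[a, b]%classic, continuous Q}.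
  move=> a0; apply: continuous_subspaceW (admissible_continuous hQ).
  by apply: subset_itv; rewrite bnd_simp.
have dQ (a b : R) : 0 <= a -> forall x, x \in `]a, b[ -> is_derive x (1 : R) Q (q x).
  move=> a0 x; rewrite in_itv /= => /andP[ax _].
  by rewrite derive1E; apply/derivableP/(admissible_derivable hQ)/(le_lt_trans a0).
have [rs|sr|<-] := ltgtP r s; last by rewrite subrr mulr0 addr0.
- have [x] := MVT rs (dQ r s r0) (cQ r s r0); rewrite in_itv /= => /andP[rx xs] E.
  have /(_ (le_lt_trans r0 rx) (ltW xs)) := @admissible_derive_nondecreasing _ _ _ hQ x s.
  by move=> /(ler_wpM2r (_ : 0 <= s - r)); rewrite -E subr_ge0 (ltW rs) => /(_ isT); lra.
- have [x] := MVT sr (dQ s r (ltW sp)) (cQ s r (ltW sp)).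
  rewrite in_itv /= => /andP[sx xr] E.
  have /(_ sp (ltW sx)) := @admissible_derive_nondecreasing _ _ _ hQ s x.
  by move=> /(ler_wpM2r (_ : 0 <= r - s)); rewrite -E subr_ge0 (ltW sr) => /(_ isT); lra.
Qed.

Definition clamp (a b s : R) : R := Num.max a (Num.min b s).

(** Q is replaced by its tangents at a and b outside [a, b], and normalized to
    vanish at 0: the result is C^1 with a bounded derivative, as the chain rule
    along the flow demands, whereas Q' is unbounded near 0 and possibly at
    infinity. *)
Definition linearized (a b s : R) : R :=
  Q (clamp a b s) + q (clamp a b s) * (s - clamp a b s) - (Q a - a * q a).

Section clamp.
Variables (a b : R).
Hypotheses (a0 : 0 < a) (ab : a <= b).

Lemma clamp_spec s : [/\ s <= a & clamp a b s = a] \/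
  [/\ a <= s, s <= b & clamp a b s = s] \/ [/\ b <= s & clamp a b s = b].
Proof.
rewrite /clamp; have [sa|/ltW sa] := leP s a.
  by left; split => //; rewrite min_r ?(le_trans sa)// max_l.
have [sb|/ltW sb] := leP s b; right; [left|right]; split => //.
  by rewrite max_r.
by rewrite max_r.
Qed.

Lemma clamp_ge s : a <= clamp a b s.
Proof. by rewrite /clamp le_max lexx. Qed.

Lemma clamp_gt0 s : 0 < clamp a b s.
Proof. exact: lt_le_trans (clamp_ge s). Qed.

Lemma clamp_le s : clamp a b s <= b.
Proof. by rewrite /clamp ge_max ab ge_min lexx. Qed.

Lemma clamp_continuous : continuous (clamp a b).
Proof.
move=> s; apply: (@continuous_max R R (cst a) (fun s => Num.min b s)).
  exact: cst_continuous.
by apply: (@continuous_min R R (cst b) id); [exact: cst_continuous|by move=> ?; exact: cvg_id].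
Qed.

Lemma q_le s r : 0 < s -> s <= r -> q s <= q r.
Proof. exact: (admissible_derive_nondecreasing hQ). Qed.

Lemma is_derive_linearized s :
  is_derive s (1 : R) (linearized a b) (q (clamp a b s)).
Proof.
apply: (@is_derive_subgradient (linearized a b) (fun s => q (clamp a b s))); last first.
  move=> x; apply: continuous_comp; first exact: clamp_continuous.
  exact: (admissible_derive_continuous hQ (clamp_gt0 x)).
move=> x y; rewrite /linearized.
have T := admissible_tangent (clamp_gt0 x) (ltW (clamp_gt0 y)).
set c := clamp a b x in T *; set d := clamp a b y in T *.
have cg : 0 < c := clamp_gt0 x.
have dg : 0 < d := clamp_gt0 y.
suff : 0 <= (q d - q c) * (y - d) by move: T; set u := q c; set w := q d; nra.
have [[ya E]|[[_ _ E]|[yb E]]] := clamp_spec y; rewrite /d E.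
- by rewrite mulr_le0// subr_le0// q_le// clamp_ge.
- by rewrite subrr mulr0.
- by rewrite mulr_ge0// subr_ge0// q_le// clamp_le.
Qed.

Lemma linearized0 : linearized a b 0 = 0.
Proof.
have -> : linearized a b 0 = Q a + q a * (0 - a) - (Q a - a * q a).
  have [[_ E]|[[/(lt_le_trans a0) + _ _]|[+ _]]] := clamp_spec 0.
  - by rewrite /linearized E.
  - by rewrite ltxx.
  - by move=> /(le_trans ab) /(lt_le_trans a0); rewrite ltxx.
by ring.
Qed.

Lemma linearized_lip : exists C : R, forall s, `|q (clamp a b s)| <= C.
Proof.
exists (`|q a| + `|q b|) => s.
have h1 := q_le a0 (clamp_ge s); have h2 := q_le (clamp_gt0 s) (clamp_le s).
have := ler_norm (q b); have := ler_norm (- q a); rewrite normrN => n1 n2.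
have := normr_ge0 (q a); have := normr_ge0 (q b) => n3 n4.
by rewrite ler_norml; apply/andP; split; lra.
Qed.

Lemma linearized_between s : a <= s <= b ->
  linearized a b s = Q s - (Q a - a * q a).
Proof.
move=> /andP[sa sb]; rewrite /linearized /clamp min_r// max_r//.
by rewrite subrr mulr0 addr0.
Qed.

Hypotheses (as0 : a <= s0) (s0b : s0 <= b).

Lemma Q_ge_min s : 0 <= s -> Q s0 <= Q s.
Proof. by move=> s_ge0; have := admissible_tangent s0_gt0 s_ge0; rewrite Qs0 mul0r addr0. Qed.

Lemma Qs0_le0 : Q s0 <= 0.
Proof. by rewrite -(admissible0 hQ) Q_ge_min. Qed.

Lemma linearized_constant : 0 <= - (Q a - a * q a) <= - Q a.
Proof.
have := admissible_tangent a0 (lexx 0); rewrite (admissible0 hQ) => T.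
have qa : q a <= 0 by rewrite -Qs0 q_le.
have : a * q a <= 0 by rewrite pmulr_rle0.
by move=> h; apply/andP; split; lra.
Qed.

(** The bound is uniform in a and b. Below s0, where Q is nonpositive and
    nonincreasing, the normalizing constant lies in [0, - Q a] and the left-hand
    side is at most |Q s|; past s0 this constant, at most |Q s0|, is absorbed by
    the linear term, and beyond b the tangent lies between Q b and Q. *)
Lemma linearized_bound s : 0 <= s ->
  `|linearized a b s| <= `|Q s| + (`|Q s0| / s0) * s.
Proof.
move=> s_ge0; have C0 : 0 <= `|Q s0| / s0 by rewrite divr_ge0// ltW.
have Cs : s0 <= s -> `|Q s0| <= `|Q s0| / s0 * s.
  by move=> ss; rewrite -mulrA ler_peMr// ler_pdivlMl// mulr1.
have Cs0 : 0 <= `|Q s0| / s0 * s by rewrite mulr_ge0.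
have /andP[k0 ka] := linearized_constant.
have Qm := Q_ge_min s_ge0; have Q00 := Qs0_le0.
have Qs0E : `|Q s0| = - Q s0 by rewrite ler0_norm.
have Qn := normr_ge0 (Q s); have Qn' := ler_norm (Q s).
have [sa|/ltW sa] := leP s a.
  have lE : linearized a b s = q a * s.
    rewrite /linearized /clamp min_r ?(le_trans sa)// max_l//; ring.
  have qa : q a <= 0 by rewrite -Qs0 q_le.
  have l0 : q a * s <= 0 by rewrite mulr_le0_ge0.
  have [s00|sneq] := eqVneq s 0.
    by rewrite lE s00 !mulr0 normr0 addr0.
  have sp : 0 < s by rewrite lt_def sneq.
  have := admissible_tangent sp (lexx 0); rewrite (admissible0 hQ) => T.
  have := q_le sp sa; rewrite -(ler_pM2r sp) => qs.
  rewrite lE ler0_norm//.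
  have := ler_norm (- Q s); rewrite normrN; lra.
have k_le : s0 <= s -> - (Q a - a * q a) <= `|Q s0| / s0 * s.
  by move=> /Cs; have := Q_ge_min (ltW a0); lra.
have [sb|/ltW sb] := leP s b.
  rewrite linearized_between ?sa//.
  have [ss0|/ltW ss0] := leP s s0; last first.
    have := k_le ss0 => kl; rewrite (le_trans (ler_normB _ _))// lerD2l.
    by rewrite -normrN ger0_norm.
  have sp : 0 < s by exact: lt_le_trans sa.
  have QsQa : Q s <= Q a.
    have := admissible_tangent sp (ltW a0).
    have : 0 <= q s * (a - s) by rewrite mulr_le0// ?subr_le0// -Qs0 q_le.
    lra.
  have := ler_norm (- Q s); rewrite normrN => Qn2.
  by rewrite ler_norml; apply/andP; split; lra.
have ss0 := le_trans s0b sb; have kl := k_le ss0; have c := Cs ss0.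
rewrite /linearized /clamp min_l// max_r//.
have bp : 0 < b := lt_le_trans s0_gt0 s0b.
have T := admissible_tangent bp s_ge0.
have qb : 0 <= q b by rewrite -Qs0 q_le.
have qbs : 0 <= q b * (s - b) by rewrite mulr_ge0// subr_ge0.
have Qb := Q_ge_min (ltW bp).
by rewrite ler_norml; apply/andP; split; lra.
Qed.

End clamp.

(** The normalizing constant lies between 0 and - Q a, and Q a tends to
    Q 0 = 0. *)
Lemma linearized_cvg s : 0 <= s ->
  linearized (s0 / n.+1%:R) (s0 + n%:R) s @[n --> \oo] --> Q s.
Proof.
have an0 n : 0 < s0 / n.+1%:R by rewrite divr_gt0.
have as0 n : s0 / n.+1%:R <= s0.
  by rewrite ler_pdivrMr// ler_peMr ?ler1n// ltW.
have s0b n : s0 <= s0 + n%:R :> R by rewrite lerDl.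
have ab n : s0 / n.+1%:R <= s0 + n%:R := le_trans (as0 n) (s0b n).
have a_cvg : s0 / n.+1%:R @[n --> \oo] --> 0.
  by rewrite -(mulr0 s0); apply: cvgMr; exact: cvg_harmonic.
rewrite le_eqVlt => /predU1P[<-|sp].
  rewrite (admissible0 hQ); under eq_fun do rewrite linearized0//.
  exact: cvg_cst.
have Qa_cvg : Q (s0 / n.+1%:R) @[n --> \oo] --> 0.
  have cQ := continuous_max0 (admissible_continuous hQ).
  have := cvg_comp _ _ a_cvg (cQ 0); rewrite maxxx (admissible0 hQ).
  apply: cvg_trans; apply: near_eq_cvg; apply: nearW => n /=.
  by rewrite max_l// ltW.
have k_cvg : - (Q (s0 / n.+1%:R) - s0 / n.+1%:R * q (s0 / n.+1%:R))
    @[n --> \oo] --> 0.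
  apply: (@squeeze_cvgr _ _ _ _ (cst 0) (fun n => - Q (s0 / n.+1%:R))).
  - by apply: nearW => n; exact: linearized_constant.
  - exact: cvg_cst.
  - by rewrite -oppr0; exact: cvgN.
have : (Q s - (Q (s0 / n.+1%:R) - s0 / n.+1%:R * q (s0 / n.+1%:R)))
    @[n --> \oo] --> Q s.
  by rewrite -[X in _ --> X]addr0; apply: cvgD => //; exact: cvg_cst.
apply: cvg_trans; apply: near_eq_cvg.
near=> n; rewrite linearized_between//.
apply/andP; split.
  rewrite ltW//; near: n; move/cvgrPdist_lt : a_cvg => /(_ _ sp).
  by apply: filterS => n; rewrite sub0r normrN ger0_norm// ltW.
have : s <= n%:R by near: n; exact: nbhs_infty_ger.
have := s0_gt0; lra.
Unshelve. all: by end_near. Qed.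

End admissible_functions.

(** * Densities and the Poisson equation *)

Section density.
Implicit Types (p r h : R -> R) (f : R -> R -> R).

Record density (f : R -> R -> R) : Prop := {
  density_ge0 : forall x v, 0 <= f x v;
  density_measurable : measurable_fun setT (fun z : R * R => f z.1 z.2);
  density_integrable : iph (fun z => f z.1 z.2);
  density_moment2 : iph (fun z => f z.1 z.2 * z.2 ^+ 2) }.

(** Only the values on the fundamental domain enter the integrals. *)
Definition tbounded (p : R -> R) : Prop := measurable_fun (@torus R) p /\
  exists M, forall x, 0 <= x <= 1 -> `|p x| <= M.

Lemma tboundedM p r : tbounded p -> tbounded r -> tbounded (fun x => p x * r x).
Proof.
move=> [mp [M pM]] [mr [N rN]]; split; first exact: measurable_funM.
exists (M * N) => x x01; rewrite normrM ler_pM//; [exact: pM|exact: rN].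
Qed.

Lemma tbounded_within p : {within `[0, 1]%classic, continuous p} -> tbounded p.
Proof.
move=> cp; split; first exact: within_continuous_measurable.
by have [M _ pM] := within_continuous_bounded ler01 cp; exists M.
Qed.

Lemma tbounded_continuous p : continuous p -> tbounded p.
Proof. by move=> cp; apply/tbounded_within/continuous_subspaceT. Qed.

Lemma tbounded_cst (k : R) : tbounded (cst k).
Proof. by apply: tbounded_continuous; exact: continuous_cstr. Qed.

Lemma measurable_phase_fst p : measurable_fun (@torus R) p ->
  measurable_fun (@phase R) (fun z => p z.1).
Proof.
move=> mp; apply: (measurable_comp measurable_torus _ mp).
  by move=> _ [z [z1 _] <-].
by apply: measurable_funS measurable_fst.
Qed.

Lemma phase_weight (g : R * R -> R) p (N : R) : iph g ->
  measurable_fun (@torus R) p -> (forall x, 0 <= x <= 1 -> `|p x| <= N) ->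
  iph (fun z => g z * p z.1) /\
  `|Iph (fun z => g z * p z.1)| <= N * Iph (fun z => `|g z|).
Proof.
move=> gi mp pN; have ni := rintegrable_norm gi.
have mg : measurable_fun (@phase R) (fun z => g z * p z.1).
  by apply: measurable_funM; [exact: rintegrable_measurable gi|exact: measurable_phase_fst].
have le z : @phase R z -> `|g z * p z.1| <= N * `|g z|.
  move=> [z1 _]; rewrite normrM mulrC ler_wpM2r// pN//.
have Ni := @phase_rintegrableZ N _ ni.
split; first exact: (@phase_le_rintegrable _ _ mg Ni le).
apply: le_trans (@phase_le_Rintegral_norm _ _ mg Ni le) _.
by rewrite (@RintegralZl _ _ _ mu2)//; exact: measurable_phase.
Qed.

Lemma tbounded_integrable p : tbounded p -> jt p.
Proof.
move=> [mp [M pM]].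
apply: (@torus_le_rintegrable _ (fun _ => M)) => //.
by apply: within_continuous_rintegrable; apply: continuous_subspaceT => x;
  exact: cst_continuous.
Qed.

Lemma phase_moment_integrable f p (h : R -> R) (C : R) : density f -> tbounded p ->
  measurable_fun setT h -> (forall v, `|h v| <= C * (1 + v ^+ 2)) ->
  iph (fun z => f z.1 z.2 * h z.2 * p z.1).
Proof.
move=> df [mp [M pM]] mh hC.
have mf := density_measurable df.
have [//||Gi _] := @phase_lincomb
  [:: (M * C, (fun z => f z.1 z.2)); (M * C, (fun z => f z.1 z.2 * z.2 ^+ 2))]
  (fun z => M * C * (f z.1 z.2 * (1 + z.2 ^+ 2))).
- by split; [exact: density_integrable|split => //; exact: density_moment2].
- by move=> z _ /=; ring.
apply: (@phase_le_rintegrable _ _ _ Gi).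
  apply: measurable_funM; last exact: measurable_phase_fst.
  apply: measurable_funS measurableT _ _ => //.
  by apply: measurable_funM => //; exact: measurable_fun_snd.
move=> z [z1 _]; rewrite !normrM (ger0_norm (density_ge0 df _ _)).
have pz : `|p z.1| <= M by apply: pM; move: z1; rewrite /torus /= in_itv.
have hp : `|h z.2| * `|p z.1| <= C * (1 + z.2 ^+ 2) * M by rewrite ler_pM.
rewrite -mulrA (le_trans (ler_wpM2l (density_ge0 df _ _) hp))//.
by rewrite le_eqVlt; apply/orP; left; apply/eqP; ring.
Qed.

Lemma phase_moment0 f p : density f -> tbounded p ->
  iph (fun z => f z.1 z.2 * p z.1).
Proof.
move=> df tp; have := @phase_moment_integrable f p (cst 1) 1 df tp.
have -> : (fun z => f z.1 z.2 * cst 1 z.2 * p z.1) = (fun z => f z.1 z.2 * p z.1).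
  by apply/funext => z; rewrite mulr1.
by apply => // v; rewrite normr1 mul1r lerDl sqr_ge0.
Qed.

Lemma phase_moment1 f p (c : R) : density f -> tbounded p ->
  iph (fun z => f z.1 z.2 * (z.2 - c) * p z.1).
Proof.
move=> df tp; apply: (@phase_moment_integrable f p (fun v => v - c) (1 + c ^+ 2)) => //.
  exact: measurable_funB.
move=> v; have := sqr_ge0 (v - 1); have := sqr_ge0 (v + 1).
have := sqr_ge0 (c - 1); have := sqr_ge0 (c + 1); have := sqr_ge0 (v * c).
by move=> *; rewrite ler_norml; apply/andP; split; nra.
Qed.

Lemma phase_moment2 f p (c : R) : density f -> tbounded p ->
  iph (fun z => f z.1 z.2 * (z.2 - c) ^+ 2 * p z.1).
Proof.
move=> df tp.
apply: (@phase_moment_integrable f p (fun v => (v - c) ^+ 2) (2 + 2 * c ^+ 2)) => //.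
  by apply: measurable_funX; exact: measurable_funB.
move=> v; rewrite ger0_norm ?sqr_ge0//.
have := sqr_ge0 (v + c); have := sqr_ge0 (v * c); nra.
Qed.

Definition rho f (x : R) : R := \int[mu]_v f x v.

Lemma Rintegral_scale (g : R -> R) (c : R) : measurable_fun setT g ->
  (forall v, 0 <= g v) -> \int[mu]_v (g v * c) = (\int[mu]_v g v) * c.
Proof.
move=> mg g0.
have pos (d : R) : 0 <= d -> \int[mu]_v (d * g v) = d * (\int[mu]_v g v).
  move=> d0; rewrite /Rintegral; under eq_integral do rewrite EFinM.
  rewrite ge0_integralZl_EFin//.
  - have : (0 <= \int[mu]_v (g v)%:E)%E by apply: integral_ge0 => v _; rewrite lee_fin.
    case: (\int[mu]_v _)%E => [r||] //= _.
    rewrite mulr0; move: d0; rewrite le_eqVlt => /predU1P[<-|d0].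
      by rewrite mul0e.
    by rewrite gt0_muley.
  - by move=> v _; rewrite lee_fin.
  - exact/measurable_EFinP.
under eq_Rintegral do rewrite mulrC.
have [c0|c0] := leP 0 c; first by rewrite pos// mulrC.
have := pos (- c); rewrite oppr_ge0 (ltW c0) => /(_ isT).
have -> : \int[mu]_v (c * g v) = - \int[mu]_v (- c * g v).
  rewrite /Rintegral -fineN -integral_ge0N; last first.
    by move=> v _; rewrite lee_fin mulr_ge0// oppr_ge0 ltW.
  by congr fine; apply: eq_integral => v _; rewrite -EFinN mulNr opprK.
by move=> ->; rewrite mulNr opprK mulrC.
Qed.

Lemma phase_density_int f p : density f -> tbounded p ->
  jt (fun x => rho f x * p x) /\
  Iph (fun z => f z.1 z.2 * p z.1) = Jt (fun x => rho f x * p x).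
Proof.
move=> df tp; have [Hi -> _] := phase_fubini (phase_moment0 df tp).
have E x : \int[mu]_v (f (x, v).1 (x, v).2 * p (x, v).1) = rho f x * p x.
  apply: (@Rintegral_scale (f x) (p x)); last by move=> v; exact: density_ge0.
  exact: (measurableT_comp (density_measurable df) (pair1_measurable x)).
split; last by under eq_Rintegral do rewrite E.
by apply: (@torus_eq_rintegrable _ _ _ Hi) => x _; rewrite E.
Qed.

Lemma derive1_periodic (V : R -> R) : periodic1 V -> periodic1 (derive1 V).
Proof.
move=> pV x; rewrite /derive1.
by under eq_fun do rewrite addrA !pV.
Qed.

Section poisson_equation.
Variables (eps : R) (f : R -> R -> R) (V : R -> R).
Hypotheses (eps_gt0 : 0 < eps) (df : density f) (pV : poisson eps f V).
Notation E := (derive1 V).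
Let k x := - (eps ^+ 2)^-1 * (rho f x - 1).

Lemma rho_integrable : jt (rho f).
Proof.
have [+ _] := phase_density_int df (tbounded_cst 1).
by apply: (@torus_eq_rintegrable) => x _; rewrite mulr1.
Qed.

Let one_integrable : jt (fun=> 1).
Proof. exact: tbounded_integrable (tbounded_cst 1). Qed.

Let k_integrable : jt k.
Proof.
apply: (@torus_rintegrableZ); apply: (@torus_rintegrableB).
  exact: rho_integrable.
exact: one_integrable.
Qed.

Let sub01 (x : R) : x <= 1 -> `[0, x]%classic `<=` @torus R.
Proof. by move=> x1; rewrite /torus; apply: subset_itvl; rewrite bnd_simp. Qed.

Lemma field_primitive : primitive 0 1 k E.
Proof.
move=> x /andP[x0 x1]; have e0 : eps != 0 by rewrite gt_eqF.
rewrite /k (@RintegralZl _ _ _ mu)//; last first.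
  apply: (@rintegrableB _ _ _ mu _ (measurable_itv _)).
    by apply: integrableS rho_integrable => //; [exact: measurable_torus|exact: sub01].
  by apply: integrableS one_integrable => //; [exact: measurable_torus|exact: sub01].
by rewrite /rho -(poisson_eq pV x0); field.
Qed.

Lemma field_continuous : {within `[0, 1]%classic, continuous E}.
Proof. exact: primitive_continuous ler01 k_integrable field_primitive. Qed.

Lemma field_tbounded : tbounded E.
Proof. exact: tbounded_within field_continuous. Qed.

Lemma field_int0 : Jt E = 0.
Proof.
have V01 : V 1 = V 0 by rewrite -[X in V X = _]add0r (poisson_periodic pV).
have cV : continuous V := derivable_continuousT (poisson_derivable pV).
rewrite /Rintegral /torus (@continuous_FTC2 _ E V 0 1)//.
- by rewrite -EFinB V01 subrr.
- exact: field_continuous.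
- split; first by move=> x _; exact: (poisson_derivable pV).
    by apply: cvg_at_right_filter; exact: cV.
  by apply: cvg_at_left_filter; exact: cV.
Qed.

Section against.
Variables (p p' : R -> R).
Hypotheses (pp : periodic1 p) (dp : forall x, is_derive x (1 : R) p (p' x))
  (cp' : continuous p').

Let cp : continuous p := is_derive_continuous dp.

Let p_primitive : primitive 0 1 p' p.
Proof.
move=> x /andP[x0 x1]; rewrite (integral_derivative x0 (fun y _ => dp y) cp').
by rewrite addrC subrK.
Qed.

Let p'_integrable : jt p'.
Proof. exact: tbounded_integrable (tbounded_continuous cp'). Qed.

Let p01 : p 1 = p 0. Proof. by rewrite -[X in p X = _]add0r pp. Qed.
Let E01 : E 1 = E 0.
Proof. by rewrite -[X in E X = _]add0r (derive1_periodic (poisson_periodic pV)). Qed.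

Let e0 : eps != 0. Proof. by rewrite gt_eqF. Qed.

(** Integration by parts against the field E, which is absolutely continuous;
    the boundary terms cancel by periodicity. *)
Lemma poisson_weak :
  Iph (fun z => f z.1 z.2 * p z.1) = Jt p + eps ^+ 2 * Jt (fun x => E x * p' x).
Proof.
have tp := tbounded_continuous cp.
have [rp ->] := phase_density_int df tp.
have := AC_by_parts ler01 k_integrable p'_integrable field_primitive p_primitive.
rewrite E01 p01 subrr.
have Ep : jt (fun x => E x * p' x).
  exact: tbounded_integrable (tboundedM field_tbounded (tbounded_continuous cp')).
have [||_ ->] := @torus_lincomb
  [:: (- (eps ^+ 2)^-1, fun x => rho f x * p x); ((eps ^+ 2)^-1, p);
      (1, fun x => E x * p' x)] (fun x => k x * p x + E x * p' x).
- by do !split => //; exact: tbounded_integrable.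
- by move=> x _; rewrite /k /=; ring.
rewrite /= => H.
have -> : Jt (fun x => E x * p' x) = (eps ^+ 2)^-1 * Jt (fun x => rho f x * p x)
    - (eps ^+ 2)^-1 * Jt p.
  by apply/eqP; rewrite -subr_eq0 -H; apply/eqP; ring.
by field.
Qed.

Let E2_primitive : primitive 0 1 (fun x => 2 * (k x * E x)) (fun x => E x ^+ 2).
Proof.
move=> x /andP[x0 x1].
have k0x : rintegrable mu `[0, x] k.
  by apply: integrableS k_integrable => //; [exact: measurable_torus|exact: sub01].
have Ep : primitive 0 x k E.
  by move=> y /andP[y0 yx]; apply: field_primitive; rewrite y0 (le_trans yx).
have := AC_by_parts x0 k0x k0x Ep Ep; rewrite -!expr2 => H.
apply/eqP; rewrite addrC -subr_eq -H; apply/eqP.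
by apply: eq_Rintegral => y _; ring.
Qed.

(** E' is an affine function of rho, hence the force density rho E is a
    combination of E and of the derivative of E^2. This is what makes the force
    term, quadratic in the unknowns, integrable by parts. *)
Lemma poisson_force :
  Iph (fun z => f z.1 z.2 * (E z.1 * p z.1)) =
  Jt (fun x => E x * p x) + eps ^+ 2 / 2 * Jt (fun x => E x ^+ 2 * p' x).
Proof.
have tp := tbounded_continuous cp.
have tEp := tboundedM field_tbounded tp.
have [rp ->] := phase_density_int df tEp.
have kE : jt (fun x => 2 * (k x * E x)).
  apply: (@torus_rintegrableZ).
  exact: rintegrableM_continuous ler01 k_integrable field_continuous.
have := AC_by_parts ler01 kE p'_integrable E2_primitive p_primitive.
rewrite E01 p01 subrr.
have Ep : jt (fun x => E x ^+ 2 * p' x).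
  by apply: tbounded_integrable; apply: tboundedM (tbounded_continuous cp');
    apply: tboundedM; exact: field_tbounded.
have [||_ ->] := @torus_lincomb
  [:: (- (eps ^+ 2)^-1 * 2, fun x => rho f x * (E x * p x));
      ((eps ^+ 2)^-1 * 2, fun x => E x * p x);
      (1, fun x => E x ^+ 2 * p' x)]
  (fun x => 2 * (k x * E x) * p x + E x ^+ 2 * p' x).
- by do !split => //; exact: tbounded_integrable.
- by move=> x _; rewrite /k /=; ring.
rewrite /= => H.
have -> : Jt (fun x => E x ^+ 2 * p' x) =
    (eps ^+ 2)^-1 * 2 * Jt (fun x => rho f x * (E x * p x))
    - (eps ^+ 2)^-1 * 2 * Jt (fun x => E x * p x).
  by apply/eqP; rewrite -subr_eq0 -H; apply/eqP; ring.
by field.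
Qed.

End against.
End poisson_equation.
End density.

(** * Expansion of the modulated energy *)

Section static_identities.

Variables (eps vb : R) (f : R -> R -> R) (V : R -> R).
Hypotheses (eps_gt0 : 0 < eps) (df : density f) (pV : poisson eps f V).
Hypothesis mass1 : Iph (fun z => f z.1 z.2) = 1.
Notation E := (derive1 V).

Variables (U W W1 W2 : R -> R).
Hypotheses (pU : periodic1 U) (pW : periodic1 W) (pW1 : periodic1 W1)
  (dU : forall x, is_derive x (1 : R) U (W x))
  (dW : forall x, is_derive x (1 : R) W (W1 x))
  (dW1 : forall x, is_derive x (1 : R) W1 (W2 x))
  (cW2 : continuous W2) (U0 : Jt U = 0).

Let cU : continuous U := is_derive_continuous dU.
Let cW : continuous W := is_derive_continuous dW.
Let cW1 : continuous W1 := is_derive_continuous dW1.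

Definition deriv_WW1 (x : R) : R := W1 x * W1 x + W x * W2 x.
Definition deriv_WWW1 (x : R) : R := 2 * W x * (W1 x * W1 x) + W x * W x * W2 x.

Let cZ : continuous deriv_WW1.
Proof. by apply: continuous_addr; exact: continuous_mulr. Qed.

Let cY : continuous deriv_WWW1.
Proof.
apply: continuous_addr; apply: continuous_mulr => //; last exact: continuous_mulr.
  by apply: continuous_mulr => // x; exact: cst_continuous.
exact: continuous_mulr.
Qed.

Let tbE : tbounded E := field_tbounded eps_gt0 df pV.
Let tbU : tbounded U := tbounded_continuous cU.
Let tbW : tbounded W := tbounded_continuous cW.
Let tbW1 : tbounded W1 := tbounded_continuous cW1.
Let tbZ : tbounded deriv_WW1 := tbounded_continuous cZ.
Let tbY : tbounded deriv_WWW1 := tbounded_continuous cY.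

Let dWW1 x : is_derive x (1 : R) (fun x => W x * W1 x) (deriv_WW1 x).
Proof. by have := is_derive_mulr (dW x) (dW1 x) => H; apply: (is_derive_eq H). Qed.

Let dWW x : is_derive x (1 : R) (fun x => W x * W x) (2 * (W x * W1 x)).
Proof. by have := is_derive_mulr (dW x) (dW x) => H; apply: (is_derive_eq H); ring. Qed.

Let dWWW1 x : is_derive x (1 : R) (fun x => W x * W x * W1 x) (deriv_WWW1 x).
Proof.
have := is_derive_mulr (is_derive_mulr (dW x) (dW x)) (dW1 x) => H.
by apply: (is_derive_eq H); rewrite /deriv_WWW1; ring.
Qed.

Let pWW : periodic1 (fun x => W x * W x). Proof. by move=> x; rewrite pW. Qed.
Let pWW1 : periodic1 (fun x => W x * W1 x). Proof. by move=> x; rewrite pW pW1. Qed.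
Let pWWW1 : periodic1 (fun x => W x * W x * W1 x).
Proof. by move=> x; rewrite pW pW1. Qed.

Let jcont (p : R -> R) : continuous p -> jt p.
Proof. by move=> cp; exact: tbounded_integrable (tbounded_continuous cp). Qed.

Let i_fE : Iph (fun z => f z.1 z.2 * (E z.1 * 1)) = 0.
Proof.
have d1 x : is_derive x (1 : R) (cst 1 : R -> R) ((cst 0 : R -> R) x).
  exact: is_derive_cst.
have c0 : continuous (cst 0 : R -> R) by move=> x; exact: cst_continuous.
have := @poisson_force _ _ _ eps_gt0 df pV (cst 1) (cst 0) (fun x => erefl) d1 c0.
rewrite /= => ->; under eq_Rintegral do rewrite mulr1.
rewrite (field_int0 eps_gt0 df pV) add0r.
under eq_Rintegral do rewrite mulr0.
by rewrite Rintegral_cst ?mul0r ?mulr0//; exact: measurable_torus.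
Qed.

Let i_fEW : Iph (fun z => f z.1 z.2 * (E z.1 * W z.1)) =
  Jt (fun x => E x * W x) + eps ^+ 2 / 2 * Jt (fun x => E x ^+ 2 * W1 x).
Proof. exact: (poisson_force eps_gt0 df pV pW dW cW1). Qed.

Let i_fEWW1 : Iph (fun z => f z.1 z.2 * (E z.1 * (W z.1 * W1 z.1))) =
  Jt (fun x => E x * (W x * W1 x)) + eps ^+ 2 / 2 * Jt (fun x => E x ^+ 2 * deriv_WW1 x).
Proof. exact: (poisson_force eps_gt0 df pV pWW1 dWW1 cZ). Qed.

Let i_fU : Iph (fun z => f z.1 z.2 * U z.1) = eps ^+ 2 * Jt (fun x => E x * W x).
Proof. by rewrite (poisson_weak eps_gt0 df pV pU dU cW) U0 add0r. Qed.

Let i_fWW : Iph (fun z => f z.1 z.2 * (W z.1 * W z.1)) =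
  Jt (fun x => W x * W x) + eps ^+ 2 * Jt (fun x => E x * (2 * (W x * W1 x))).
Proof.
apply: (poisson_weak eps_gt0 df pV pWW dWW).
by apply: continuous_mulr; [move=> x; exact: cst_continuous|exact: continuous_mulr].
Qed.

Let j_WWW1 : Jt (fun x => W x * W x * W1 x) = 0.
Proof.
have := @torus_int_derivative (fun x => W x * W x * W x)
  (fun x => 3 * (W x * W x * W1 x)).
rewrite (@RintegralZl _ _ _ mu) ?[3 * _]mulrC; last 2 first.
- exact: measurable_torus.
- by apply: jcont; apply: continuous_mulr => //; exact: continuous_mulr.
move=> H; have {H} : Jt (fun x => W x * W x * W1 x) * 3 = 0.
  apply: H.
  - by move=> x; rewrite pW.
  - move=> x; have := is_derive_mulr (is_derive_mulr (dW x) (dW x)) (dW x) => H.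
    by apply: (is_derive_eq H); ring.
  - apply: continuous_mulr; first by move=> x; exact: cst_continuous.
    by apply: continuous_mulr => //; exact: continuous_mulr.
by move/eqP; rewrite mulf_eq0 pnatr_eq0 orbF => /eqP.
Qed.

Let i_fWWW1 : Iph (fun z => f z.1 z.2 * (W z.1 * W z.1 * W1 z.1)) =
  eps ^+ 2 * Jt (fun x => E x * deriv_WWW1 x).
Proof. by rewrite (poisson_weak eps_gt0 df pV pWWW1 dWWW1 cY) j_WWW1 add0r. Qed.

Variables (s c : R).

(** The derivative of [momentum_weight] below along the flow, that is its image
    by d_t + v d_x - E d_v, when U, W, W1 travel at speed vb and s, c are the
    sine and cosine of t / eps. *)
Definition transported (z : R * R) : R :=
  vb * E z.1 - s * (E z.1 * W z.1) + s * ((z.2 - vb) ^+ 2 * W1 z.1)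
  + 2 * s ^+ 2 * ((z.2 - vb) * (W z.1 * W1 z.1)) + s / eps ^+ 2 * U z.1
  + eps * s * c * (E z.1 * (W z.1 * W1 z.1))
  - eps * s * c * ((z.2 - vb) ^+ 2 * deriv_WW1 z.1).

Lemma j_square (p : R -> R) : continuous p ->
  jt (fun x => (eps * E x - c * W x) ^+ 2 * p x) /\
  Jt (fun x => (eps * E x - c * W x) ^+ 2 * p x) =
  eps ^+ 2 * Jt (fun x => E x ^+ 2 * p x)
  - 2 * eps * c * Jt (fun x => E x * (W x * p x))
  + c ^+ 2 * Jt (fun x => W x * W x * p x).
Proof.
move=> cp; have tp := tbounded_continuous cp.
have [||Hi ->] := @torus_lincomb
  [:: (eps ^+ 2, fun x => E x ^+ 2 * p x);
      (- (2 * eps * c), fun x => E x * (W x * p x));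
      (c ^+ 2, fun x => W x * W x * p x)]
  (fun x => (eps * E x - c * W x) ^+ 2 * p x).
- do !split => /=; apply: tbounded_integrable.
  + by apply: tboundedM => //; exact: tboundedM.
  + by apply: tboundedM => //; exact: tboundedM.
  + by apply: tboundedM => //; exact: tboundedM.
- by move=> x _ /=; ring.
by split => //=; ring.
Qed.

Lemma i_square (p : R -> R) : continuous p ->
  iph (fun z => f z.1 z.2 * (z.2 - vb + s * W z.1) ^+ 2 * p z.1) /\
  Iph (fun z => f z.1 z.2 * (z.2 - vb + s * W z.1) ^+ 2 * p z.1) =
  Iph (fun z => f z.1 z.2 * (z.2 - vb) ^+ 2 * p z.1)
  + 2 * s * Iph (fun z => f z.1 z.2 * (z.2 - vb) * (W z.1 * p z.1))
  + s ^+ 2 * Iph (fun z => f z.1 z.2 * (W z.1 * W z.1 * p z.1)).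
Proof.
move=> cp; have tp := tbounded_continuous cp.
have [||Hi ->] := @phase_lincomb
  [:: (1, fun z => f z.1 z.2 * (z.2 - vb) ^+ 2 * p z.1);
      (2 * s, fun z => f z.1 z.2 * (z.2 - vb) * (W z.1 * p z.1));
      (s ^+ 2, fun z => f z.1 z.2 * (W z.1 * W z.1 * p z.1))]
  (fun z => f z.1 z.2 * (z.2 - vb + s * W z.1) ^+ 2 * p z.1).
- do !split => /=.
  + exact: phase_moment2.
  + by apply: (@phase_moment1 f (fun x => W x * p x)) => //; exact: tboundedM.
  + by apply: (@phase_moment0 f (fun x => W x * W x * p x)) => //;
      apply: tboundedM => //; exact: tboundedM.
- by move=> x _ /=; ring.
by split => //=; ring.
Qed.

(** The Poisson equation turns the terms of order 1 / eps^2 and the force into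
    integrals of the field, after which the squares of the modulated kinetic and
    field energies are complete, with the weight s W1; all the remaining terms
    are of size eps. *)
Lemma transported_int :
  iph (fun z => f z.1 z.2 * transported z) /\
  Iph (fun z => f z.1 z.2 * transported z) =
  s * Iph (fun z => f z.1 z.2 * (z.2 - vb + s * W z.1) ^+ 2 * W1 z.1)
  - s / 2 * Jt (fun x => (eps * E x - c * W x) ^+ 2 * W1 x)
  - s ^+ 3 * eps ^+ 2 * Jt (fun x => E x * deriv_WWW1 x)
  + eps ^+ 3 / 2 * s * c * Jt (fun x => E x ^+ 2 * deriv_WW1 x)
  - eps * s * c * Iph (fun z => f z.1 z.2 * (z.2 - vb) ^+ 2 * deriv_WW1 z.1).
Proof.
have [_ ->] := j_square cW1; have [_ ->] := i_square cW1.
have tWW1 : tbounded (fun x => W x * W1 x) by exact: tboundedM.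
have tb1 := @tbounded_cst 1.
have [||Hi ->] := @phase_lincomb
  [:: (vb, fun z => f z.1 z.2 * (E z.1 * 1));
      (- s, fun z => f z.1 z.2 * (E z.1 * W z.1));
      (s, fun z => f z.1 z.2 * (z.2 - vb) ^+ 2 * W1 z.1);
      (2 * s ^+ 2, fun z => f z.1 z.2 * (z.2 - vb) * (W z.1 * W1 z.1));
      (s / eps ^+ 2, fun z => f z.1 z.2 * U z.1);
      (eps * s * c, fun z => f z.1 z.2 * (E z.1 * (W z.1 * W1 z.1)));
      (- (eps * s * c), fun z => f z.1 z.2 * (z.2 - vb) ^+ 2 * deriv_WW1 z.1)]
  (fun z => f z.1 z.2 * transported z).
- do !split => /=.
  + by apply: (@phase_moment0 f (fun x => E x * 1)) => //; exact: (tboundedM tbE tb1).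
  + by apply: (@phase_moment0 f (fun x => E x * W x)) => //; exact: tboundedM.
  + exact: phase_moment2.
  + exact: (@phase_moment1 f (fun x => W x * W1 x)).
  + exact: phase_moment0.
  + by apply: (@phase_moment0 f (fun x => E x * (W x * W1 x))) => //; exact: tboundedM.
  + exact: phase_moment2.
- by move=> x _ /=; rewrite /transported; ring.
split => //=.
rewrite i_fE i_fEW i_fU i_fEWW1 i_fWWW1 j_WWW1.
have e0 : eps != 0 by rewrite gt_eqF.
by field.
Qed.

(** Up to terms of size eps, the nonconstant part of the modulated energy is the
    integral of f against this weight; the term in U is the cross term of the
    field energy, rewritten with the Poisson equation. The last term is a
    corrector: the derivative (c^2 - s^2) / eps of s c, and the force acting on
    v - vb, produce the cross terms that complete the two squares of
    [transported_int]. *)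
Definition momentum_weight (z : R * R) : R :=
  - vb * z.2 + s * ((z.2 - vb) * W z.1) - c / eps * U z.1
  + W z.1 * W z.1 / 2 - eps * s * c * ((z.2 - vb) * (W z.1 * W1 z.1)).

(** The squares expand into the energy, which is conserved, an integral linear
    in f, and terms of size eps. *)
Lemma modulated_energy_split : c ^+ 2 + s ^+ 2 = 1 ->
  iph (fun z => f z.1 z.2 * momentum_weight z) /\
  2^-1 * Iph (fun z => f z.1 z.2 * (z.2 - vb + s * W z.1) ^+ 2)
  + 2^-1 * Jt (fun x => (eps * E x - c * W x) ^+ 2) =
  2^-1 * Iph (fun z => f z.1 z.2 * z.2 ^+ 2) + eps ^+ 2 / 2 * Jt (fun x => E x ^+ 2)
  + vb ^+ 2 / 2 + Iph (fun z => f z.1 z.2 * momentum_weight z)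
  + eps ^+ 2 * (s ^+ 2 - 1) * Jt (fun x => E x * (W x * W1 x))
  + eps * s * c * Iph (fun z => f z.1 z.2 * (z.2 - vb) * (W z.1 * W1 z.1)).
Proof.
move=> cs1.
have c1 : continuous (cst 1 : R -> R) by move=> x; exact: cst_continuous.
have tb1 := @tbounded_cst 1.
have tWW1 : tbounded (fun x => W x * W1 x) by exact: tboundedM.
have tWW : tbounded (fun x => W x * W x) by exact: tboundedM.
have [_] := j_square c1; rewrite /=; under eq_Rintegral do rewrite mulr1.
under [X in _ = _ * X - _ + _]eq_Rintegral do rewrite mulr1.
under [X in _ = _ - _ * X + _]eq_Rintegral do rewrite mulr1.
under [X in _ = _ + _ * X]eq_Rintegral do rewrite mulr1.
move=> ->.
have [_] := i_square c1; rewrite /=; under eq_Rintegral do rewrite mulr1.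
under [X in _ = _ + _ * X + _]eq_Rintegral do rewrite mulr1.
under [X in _ = _ + _ * X]eq_Rintegral do rewrite mulr1.
move=> ->.
have i_fv : iph (fun z => f z.1 z.2 * (z.2 - 0) * 1) by exact: (@phase_moment1 f (cst 1)).
have i_f := density_integrable df; have i_fv2 := density_moment2 df.
have [||_ ->] := @phase_lincomb
  [:: (1, fun z => f z.1 z.2 * z.2 ^+ 2);
      (- (2 * vb), fun z => f z.1 z.2 * (z.2 - 0) * 1);
      (vb ^+ 2, fun z => f z.1 z.2)]
  (fun z => f z.1 z.2 * (z.2 - vb) ^+ 2 * 1).
- by do !split.
- by move=> x _ /=; ring.
have [||Hi ->] := @phase_lincomb
  [:: (- vb, fun z => f z.1 z.2 * (z.2 - 0) * 1);
      (s, fun z => f z.1 z.2 * (z.2 - vb) * W z.1);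
      (- (c / eps), fun z => f z.1 z.2 * U z.1);
      (2^-1, fun z => f z.1 z.2 * (W z.1 * W z.1));
      (- (eps * s * c), fun z => f z.1 z.2 * (z.2 - vb) * (W z.1 * W1 z.1))]
  (fun z => f z.1 z.2 * momentum_weight z).
- do !split => //=.
  + exact: phase_moment1.
  + exact: phase_moment0.
  + exact: (@phase_moment0 f (fun x => W x * W x)).
  + exact: (@phase_moment1 f (fun x => W x * W1 x)).
- by move=> x _ /=; rewrite /momentum_weight; ring.
split => //=.
rewrite i_fU i_fWW mass1.
have -> : Jt (fun x => E x * (2 * (W x * W1 x))) = 2 * Jt (fun x => E x * (W x * W1 x)).
  rewrite -(@RintegralZl _ _ _ mu)//; first by apply: eq_Rintegral => x _; ring.
    exact: measurable_torus.
  exact: tbounded_integrable (tboundedM tbE tWW1).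
have e0 : eps != 0 by rewrite gt_eqF.
have -> : c ^+ 2 = 1 - s ^+ 2 by rewrite -cs1 addrK.
by field.
Qed.

End static_identities.

(** * The Casimir functional of a sheared density *)

Section casimir_functional.

Lemma Rintegral_shift (k : R -> R) (c : R) : rintegrable mu setT k ->
  rintegrable mu setT (fun v : R => k (v + c)) /\
  \int[mu]_v k (v + c) = \int[mu]_v k v.
Proof.
move=> ki; have mk := rintegrable_measurable ki.
have mkc : measurable_fun setT (fun v : R => k (v + c)).
  by apply: (measurableT_comp mk); exact: measurable_funD.
split.
  apply/integrableP; split; first exact/measurable_EFinP.
  rewrite (@integral_shift c (fun v => `|(k v)%:E|%E))//.
  - by move/integrableP : ki => [].
  - by apply: measurableT_comp => //; exact/measurable_EFinP.
rewrite /Rintegral integralE [in RHS]integralE; congr (fine (_ - _)).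
- rewrite -(@integral_shift c (EFin \o k)^\+%E)//.
  + by apply: eq_integral => v _; rewrite !funeposE.
  + by apply: measurable_funepos; exact/measurable_EFinP.
- rewrite -(@integral_shift c (EFin \o k)^\-%E)//.
  + by apply: eq_integral => v _; rewrite !funenegE.
  + by apply: measurable_funeneg; exact/measurable_EFinP.
Qed.

Lemma phase_shift_int (k a p : R -> R) : rintegrable mu setT k ->
  measurable_fun setT a -> tbounded p ->
  iph (fun z => k (z.2 + a z.1) * p z.1) /\
  Iph (fun z => k (z.2 + a z.1) * p z.1) = (\int[mu]_v k v) * Jt p.
Proof.
move=> ki ma tp; have mk := rintegrable_measurable ki.
have mka : measurable_fun setT (fun z : R * R => k (z.2 + a z.1)).
  apply: (measurableT_comp mk); apply: measurable_funD.
    exact: measurable_snd.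
  exact: measurable_fun_fst.
have kai : iph (fun z => k (z.2 + a z.1)).
  apply/integrableP; split; first by apply/measurable_EFinP; exact: measurable_funTS.
  rewrite (@phase_shear (fun z => `|(k z.2)%:E|%E) a)//; last first.
    apply: measurableT_comp => //; apply/measurable_EFinP.
    exact: measurable_fun_snd.
  rewrite phase_tonelli//; last first.
    apply: measurableT_comp => //; apply/measurable_EFinP.
    exact: measurable_fun_snd.
  have nE : (\int[mu]_v `|(k v)%:E| = (\int[mu]_v `|k v|)%:E)%E.
    by rewrite -(rintegrable_fineK measurableT (rintegrable_norm ki)).
  rewrite /= nE (@torus_rintegrable_fineK
    (fun=> \int[mu]_v `|k v|)) ?ltry//.
  exact: tbounded_integrable (tbounded_cst _).
have [mp [M pM]] := tp.
have [kpi _] := phase_weight kai mp pM.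
split => //; have [_ -> _] := phase_fubini kpi.
rewrite -(@RintegralZl _ _ _ mu); last 2 first.
- exact: measurable_torus.
- exact: tbounded_integrable.
apply: eq_Rintegral => x _ /=; have [kxi <-] := Rintegral_shift (a x) ki.
by rewrite (@RintegralZr _ _ _ mu).
Qed.

Variables (mup phi Q : R -> R) (vb : R).
Hypotheses (hmu : S_stable mup vb) (hphi : profile_function mup vb phi)
  (hQ : admissible phi Q).
Notation q := (derive1 Q).

Lemma phi_gt0 u : u <= 0 -> 0 < phi u.
Proof.
move=> u0; apply: (@le_lt_trans _ _ (phi (u - 1))).
  by apply: (profile_ge0 hphi); lra.
by apply: (profile_increasing hphi) => //; lra.
Qed.

Lemma sq_le0 (v : R) : - (`|v - vb| ^+ 2 / 2) <= 0.
Proof. by rewrite oppr_le0 divr_ge0// sqr_ge0. Qed.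

Lemma profile_gt0 v : 0 < mup v.
Proof. by rewrite (profile_eq hphi) phi_gt0// sq_le0. Qed.

Lemma derive_profile v : q (mup v) = - ((v - vb) ^+ 2 / 2).
Proof.
rewrite (profile_eq hphi) (admissible_derive_inverse hQ) ?sq_le0//.
by rewrite real_normK ?num_real.
Qed.

Lemma derive_phi0 : q (phi 0) = 0.
Proof. by rewrite (admissible_derive_inverse hQ). Qed.

Lemma casimir_integrand_ge0 v (r : R) : 0 <= r ->
  0 <= Q r - Q (mup v) - q (mup v) * (r - mup v).
Proof.
by move=> r0; have := admissible_tangent hQ (profile_gt0 v) r0; lra.
Qed.

Lemma casimir_ge0 f : (forall x v, 0 <= f x v) -> (0 <= casimir mup Q f)%E.
Proof.
move=> f0; apply: integral_ge0 => z _; rewrite lee_fin.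
exact: casimir_integrand_ge0.
Qed.

(** The part of the Casimir integrand that depends on mu alone. *)
Definition profile_density (v : R) : R := Q (mup v) + (v - vb) ^+ 2 / 2 * mup v.

(** The Casimir integrand of the modulated density in the variables of f, made
    explicit by Q' (mu v) = - (v - vb)^2 / 2. *)
Definition sheared_integrand (f : R -> R -> R) (a : R -> R) (z : R * R) : R :=
  Q (f z.1 z.2) + (z.2 - vb + a z.1) ^+ 2 / 2 * f z.1 z.2
  - profile_density (z.2 + a z.1).

Lemma sheared_integrandE f a (z : R * R) : sheared_integrand f a z =
  Q (f z.1 z.2) - Q (mup (z.2 + a z.1))
  - q (mup (z.2 + a z.1)) * (f z.1 z.2 - mup (z.2 + a z.1)).
Proof. by rewrite /sheared_integrand /profile_density derive_profile; field. Qed.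

Lemma measurable_mup : measurable_fun setT mup.
Proof. exact: continuous_measurableT (S_stable_continuous hmu). Qed.

Lemma measurable_sheared f (a : R -> R) : density f -> measurable_fun setT a ->
  measurable_fun setT (sheared_integrand f a).
Proof.
move=> df ma; have mf := density_measurable df.
have mQ : measurable_fun setT (fun z : R * R => Q (f z.1 z.2)).
  by apply: (measurable_continuous_comp (admissible_continuous hQ) mf) => z; exact: density_ge0.
have ma1 : measurable_fun setT (fun z : R * R => a z.1) by exact: measurable_fun_fst.
have m2 : measurable_fun setT (fun z : R * R => z.2) by exact: measurable_snd.
apply: measurable_funB; first apply: measurable_funD => //.
  apply: measurable_funM => //; apply: measurable_funM => //.
  apply: measurable_funX; apply: measurable_funD => //.
  exact: measurable_funB.
have mpd : measurable_fun setT profile_density.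
  apply: measurable_funD.
    apply: (measurable_continuous_comp (admissible_continuous hQ) measurable_mup) => v.
    by rewrite ltW// profile_gt0.
  apply: measurable_funM; last exact: measurable_mup.
  by apply: measurable_funM => //; apply: measurable_funX; exact: measurable_funB.
by apply: (measurableT_comp mpd); exact: measurable_funD.
Qed.

Lemma sheared_integrand_ge0 f a z : density f -> 0 <= sheared_integrand f a z.
Proof.
by move=> df; rewrite sheared_integrandE; apply: casimir_integrand_ge0; exact: density_ge0.
Qed.

Lemma casimir_shear f (a : R -> R) : density f -> measurable_fun setT a ->
  casimir mup Q (fun x v => f x (v - a x)) =
  (\int[mu2]_(z in @phase R) (sheared_integrand f a z)%:E)%E.
Proof.
move=> df ma.
rewrite -(@phase_shear (fun z => (sheared_integrand f a z)%:E) (fun x => - a x)).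
- apply: eq_integral => z _; congr (_%:E).
  by rewrite sheared_integrandE /= subrK.
- by apply/measurable_EFinP; exact: measurable_sheared.
- by move=> z; rewrite lee_fin; exact: sheared_integrand_ge0.
- exact: measurableT_comp.
Qed.

Hypothesis pd_int : rintegrable mu setT profile_density.

Lemma sheared_moment f (a p : R -> R) : density f -> iph (fun z => Q (f z.1 z.2)) ->
  continuous a -> tbounded p ->
  iph (fun z => sheared_integrand f a z * p z.1) /\
  Iph (fun z => sheared_integrand f a z * p z.1) =
  Iph (fun z => Q (f z.1 z.2) * p z.1) +
  2^-1 * Iph (fun z => f z.1 z.2 * (z.2 - vb + a z.1) ^+ 2 * p z.1) -
  (\int[mu]_v profile_density v) * Jt p.
Proof.
move=> df Qi ca tp.
have ma : measurable_fun setT a by exact: continuous_measurableT.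
have [si <-] := phase_shift_int pd_int ma tp.
have [mp [M pM]] := tp; have [Qpi _] := phase_weight Qi mp pM.
have ta := tbounded_continuous ca.
have [||fi _] := @phase_lincomb
  [:: (1, fun z => f z.1 z.2 * (z.2 - vb) ^+ 2 * p z.1);
      (2, fun z => f z.1 z.2 * (z.2 - vb) * (a z.1 * p z.1));
      (1, fun z => f z.1 z.2 * (a z.1 * a z.1 * p z.1))]
  (fun z => f z.1 z.2 * (z.2 - vb + a z.1) ^+ 2 * p z.1).
- do !split => /=.
  + exact: phase_moment2.
  + by apply: (@phase_moment1 f (fun x => a x * p x)) => //; exact: tboundedM.
  + by apply: (@phase_moment0 f (fun x => a x * a x * p x)) => //;
      apply: tboundedM => //; exact: tboundedM.
- by move=> x _ /=; ring.
have [||Hi ->] := @phase_lincomb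
  [:: (1, fun z => Q (f z.1 z.2) * p z.1);
      (2^-1, fun z => f z.1 z.2 * (z.2 - vb + a z.1) ^+ 2 * p z.1);
      (-1, fun z => profile_density (z.2 + a z.1) * p z.1)]
  (fun z => sheared_integrand f a z * p z.1).
- by do !split.
- by move=> z _ /=; rewrite /sheared_integrand; ring.
by split => //=; ring.
Qed.

Lemma sheared_integrable f (a : R -> R) : density f ->
  iph (fun z => Q (f z.1 z.2)) -> continuous a -> iph (sheared_integrand f a).
Proof.
move=> df Qi ca; have [Hi _] := sheared_moment df Qi ca (tbounded_cst 1).
by apply: (@phase_eq_rintegrable _ _ _ Hi) => z _; rewrite mulr1.
Qed.

Lemma casimir_value f (a : R -> R) : density f -> iph (fun z => Q (f z.1 z.2)) ->
  continuous a ->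
  casimir mup Q (fun x v => f x (v - a x)) =
  (Iph (fun z => Q (f z.1 z.2)) +
   2^-1 * Iph (fun z => f z.1 z.2 * (z.2 - vb + a z.1) ^+ 2) -
   \int[mu]_v profile_density v)%:E.
Proof.
move=> df Qi ca; rewrite casimir_shear//; last exact: continuous_measurableT.
have [_] := sheared_moment df Qi ca (tbounded_cst 1).
rewrite torus_int1 mulr1.
under eq_Rintegral do rewrite mulr1.
under [X in _ = X + _ - _]eq_Rintegral do rewrite mulr1.
under [X in _ = _ + _ * X - _]eq_Rintegral do rewrite mulr1.
move=> <-.
by rewrite (@phase_rintegrable_fineK _ (sheared_integrable df Qi ca)).
Qed.

(** The Casimir integrand is nonnegative, so that weighting it costs the supremum
    of p; the part that depends on mu alone integrates to 0 against the
    mean-zero weight, and only the two terms on the left survive. *)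
Lemma casimir_weighted f (a p : R -> R) (lam : R) : density f ->
  iph (fun z => Q (f z.1 z.2)) -> continuous a -> continuous p ->
  Jt p = 0 -> (forall x, `|p x| <= lam) ->
  `|2 * Iph (fun z => Q (f z.1 z.2) * p z.1) +
    Iph (fun z => f z.1 z.2 * (z.2 - vb + a z.1) ^+ 2 * p z.1)| <=
  2 * lam * fine (casimir mup Q (fun x v => f x (v - a x))).
Proof.
move=> df Qi ca cp Jp pl.
have [Hi E] := sheared_moment df Qi ca (tbounded_continuous cp).
have -> : 2 * Iph (fun z => Q (f z.1 z.2) * p z.1) +
    Iph (fun z => f z.1 z.2 * (z.2 - vb + a z.1) ^+ 2 * p z.1) =
    2 * Iph (fun z => sheared_integrand f a z * p z.1).
  by rewrite E Jp; field.
rewrite normrM ger0_norm// -mulrA ler_pM2l//.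
rewrite casimir_shear//; last exact: continuous_measurableT.
have si := sheared_integrable df Qi ca.
rewrite (@phase_rintegrable_fineK _ si) /=.
rewrite -(@RintegralZl _ _ _ mu2)//; last exact: measurable_phase.
apply: (@phase_le_Rintegral_norm).
- exact: rintegrable_measurable Hi.
- exact: (@phase_rintegrableZ).
- move=> z _; rewrite normrM [X in X * _]ger0_norm ?sheared_integrand_ge0// mulrC.
  by rewrite ler_wpM2r// sheared_integrand_ge0.
Qed.

End casimir_functional.

(** * Test functions affine in the velocity *)

Section coefficients.
Implicit Types (p pt px r rt rx : R -> R -> R).

Definition continuous2 (p : R -> R -> R) := continuous (fun z : R * R => p z.1 z.2).

(** The coefficients a and b of test functions a + v b; the uniform bounds
    allow the removal of a cutoff in v by dominated convergence. *)
Record coefficient p pt px : Prop := {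
  coef_periodic : forall t, periodic1 (p t);
  coef_dt : forall t x, is_derive t (1 : R) (fun s => p s x) (pt t x);
  coef_dx : forall t x, is_derive x (1 : R) (p t) (px t x);
  coef_cont : continuous2 p;
  coef_cont_t : continuous2 pt;
  coef_cont_x : continuous2 px;
  coef_bound : exists M, forall t x,
    [/\ `|p t x| <= M, `|pt t x| <= M & `|px t x| <= M] }.

Lemma continuous2D p r : continuous2 p -> continuous2 r ->
  continuous2 (fun t x => p t x + r t x).
Proof. by move=> cp cr z; apply: continuousD; [exact: cp|exact: cr]. Qed.

Lemma continuous2M p r : continuous2 p -> continuous2 r ->
  continuous2 (fun t x => p t x * r t x).
Proof. by move=> cp cr z; apply: continuousM; [exact: cp|exact: cr]. Qed.

Lemma coefficientD p pt px r rt rx : coefficient p pt px -> coefficient r rt rx ->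
  coefficient (fun t x => p t x + r t x) (fun t x => pt t x + rt t x)
    (fun t x => px t x + rx t x).
Proof.
move=> hp hr; split.
- by move=> t x; rewrite (coef_periodic hp) (coef_periodic hr).
- by move=> t x; exact: is_derive_addr (coef_dt hp t x) (coef_dt hr t x).
- by move=> t x; exact: is_derive_addr (coef_dx hp t x) (coef_dx hr t x).
- exact: continuous2D (coef_cont hp) (coef_cont hr).
- exact: continuous2D (coef_cont_t hp) (coef_cont_t hr).
- exact: continuous2D (coef_cont_x hp) (coef_cont_x hr).
- have [M hM] := coef_bound hp; have [N hN] := coef_bound hr.
  exists (M + N) => t x; have [? ? ?] := hM t x; have [? ? ?] := hN t x.
  by split; apply: le_trans (ler_normD _ _) _; exact: lerD.
Qed.

Lemma coefficientM p pt px r rt rx : coefficient p pt px -> coefficient r rt rx ->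
  coefficient (fun t x => p t x * r t x)
    (fun t x => pt t x * r t x + p t x * rt t x)
    (fun t x => px t x * r t x + p t x * rx t x).
Proof.
move=> hp hr.
have [[cp cpt] cpx] := (coef_cont hp, coef_cont_t hp, coef_cont_x hp).
have [[cr crt] crx] := (coef_cont hr, coef_cont_t hr, coef_cont_x hr).
split.
- by move=> t x; rewrite (coef_periodic hp) (coef_periodic hr).
- by move=> t x; exact: is_derive_mulr (coef_dt hp t x) (coef_dt hr t x).
- by move=> t x; exact: is_derive_mulr (coef_dx hp t x) (coef_dx hr t x).
- exact: continuous2M.
- by apply: continuous2D; exact: continuous2M.
- by apply: continuous2D; exact: continuous2M.
- have [M hM] := coef_bound hp; have [N hN] := coef_bound hr.
  exists (M * N + M * N) => t x; have [h1 h2 h3] := hM t x; have [k1 k2 k3] := hN t x.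
  have M0 : 0 <= M by apply: le_trans h1.
  have N0 : 0 <= N by apply: le_trans k1.
  split.
  + by rewrite normrM (le_trans (ler_pM _ _ h1 k1))// lerDl mulr_ge0.
  + by apply: le_trans (ler_normD _ _) _; rewrite !normrM lerD// ler_pM.
  + by apply: le_trans (ler_normD _ _) _; rewrite !normrM lerD// ler_pM.
Qed.

Lemma coefficient_time (h h' : R -> R) : (forall t, is_derive t (1 : R) h (h' t)) ->
  continuous h' -> (exists M, forall t, `|h t| <= M /\ `|h' t| <= M) ->
  coefficient (fun t _ => h t) (fun t _ => h' t) (fun _ _ => 0).
Proof.
move=> dh ch' [M hM].
have ch : continuous h.
  exact: is_derive_continuous dh.
split => //.
- by move=> t x; exact: is_derive_cst.
- by move=> z; apply: (@continuous_comp _ _ _ (fun z : R * R => z.1) h z);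
    [exact: cvg_fst|exact: ch].
- by move=> z; apply: (@continuous_comp _ _ _ (fun z : R * R => z.1) h' z);
    [exact: cvg_fst|exact: ch'].
- by move=> z; exact: cst_continuous.
- exists M => t x; have [h1 h2] := hM t; split => //.
  by rewrite normr0 (le_trans _ h1).
Qed.

Lemma coefficient_wave (c : R) (h h' : R -> R) : periodic1 h ->
  (forall x, is_derive x (1 : R) h (h' x)) -> continuous h' ->
  periodic1 h' ->
  coefficient (fun t x => h (x - c * t)) (fun t x => - c * h' (x - c * t))
    (fun t x => h' (x - c * t)).
Proof.
move=> ph dh ch' ph'.
have ch : continuous h.
  exact: is_derive_continuous dh.
have cw (g : R -> R) : continuous g -> continuous2 (fun t x => g (x - c * t)).
  move=> cg z; apply: (@continuous_comp _ _ _ (fun z : R * R => z.2 - c * z.1) g);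
    last exact: cg.
  apply: continuousB; first exact: cvg_snd.
  by apply: continuousM; [exact: cst_continuous|exact: cvg_fst].
split.
- by move=> t x; rewrite -(ph (x - c * t)) addrAC.
- move=> t x.
  have d : is_derive t (1 : R) (fun t => x - c * t) (- c).
    have := is_derive_subr (is_derive_cst x t 1) (is_derive_scale c t) => H.
    by apply: (is_derive_eq H); rewrite sub0r.
  have := @is_derive_compr h (fun t => x - c * t) t _ _ (dh (x - c * t)) d.
  by rewrite mulrC.
- move=> t x.
  have := @is_derive_compr h (fun x => x - c * t) x _ _ (dh (x - c * t))
    (is_derive_shiftr _ _).
  by rewrite mulr1.
- exact: cw.
- by apply: continuous2M; [move=> z; exact: cst_continuous|exact: cw].
- exact: cw.
- have [M M0 hM] := periodic_continuous_bounded ph ch.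
  have [N N0 hN] := periodic_continuous_bounded ph' ch'.
  exists (M + N + `|c| * N) => t x; split.
  + by apply: le_trans (hM _) _; rewrite -addrA lerDl addr_ge0// mulr_ge0.
  + by rewrite normrM normrN (@le_trans _ _ (`|c| * N)) ?ler_wpM2l// lerDr addr_ge0.
  + by apply: le_trans (hN _) _; rewrite addrAC lerDr addr_ge0// mulr_ge0.
Qed.

Lemma coefficient_cst (k : R) : coefficient (fun _ _ => k) (fun _ _ => 0) (fun _ _ => 0).
Proof.
apply: (@coefficient_time (cst k) (cst 0)).
- by move=> t; exact: cst_continuous.
- by exists `|k| => t /=; rewrite normr0.
Qed.

Lemma coefficientZ (k : R) p pt px : coefficient p pt px ->
  coefficient (fun t x => k * p t x) (fun t x => k * pt t x) (fun t x => k * px t x).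
Proof.
move=> hp; have := coefficientM (coefficient_cst k) hp.
by congr (coefficient _ _ _); apply/funext => t; apply/funext => x; rewrite mul0r add0r.
Qed.

Section cutoff.

Definition pos_sq (u : R) : R := (Num.max 0 u) ^+ 2.

Lemma is_derive_pos_sq u : is_derive u (1 : R) pos_sq (2 * Num.max 0 u).
Proof.
apply: (@is_derive_subgradient pos_sq (fun u => 2 * Num.max 0 u)).
  move=> x y; rewrite /pos_sq.
  have y0 : 0 <= Num.max 0 y by rewrite le_max lexx.
  have yy : y <= Num.max 0 y by rewrite le_max lexx orbT.
  have [x0|] := boolP (x <= 0); last rewrite -ltNge => /ltW x0.
    by rewrite (max_l x0) expr0n mulr0 mul0r addr0 sqr_ge0.
  rewrite (max_r x0); have := sqr_ge0 (Num.max 0 y - x).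
  by move: (Num.max 0 y) y0 yy => m m0 ym; nra.
apply: continuous_mulr; first exact: continuous_cstr.
by apply: continuous_maxr; [exact: continuous_cstr|exact: continuous_idr].
Qed.

(** The positive part of 1 - y^2, squared to be C^1. *)
Definition bump (y : R) : R := pos_sq (1 - y * y).
Definition bump' (y : R) : R := - (4 * y * Num.max 0 (1 - y * y)).

Lemma is_derive_bump y : is_derive y (1 : R) bump (bump' y).
Proof.
have d : is_derive y (1 : R) (fun y => 1 - y * y) (- (2 * y)).
  have := is_derive_subr (is_derive_cst (1 : R) y (1 : R))
    (is_derive_mulr (is_derive_id y 1) (is_derive_id y 1)) => H.
  by apply: (is_derive_eq H); rewrite /=; ring.
have := @is_derive_compr pos_sq _ y _ _ (is_derive_pos_sq (1 - y * y)) d => H.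
by apply: (is_derive_eq H); rewrite /bump'; ring.
Qed.

Lemma bump_bounds y : [/\ 0 <= bump y, bump y <= 1, `|bump' y| <= 4 & `|y * bump' y| <= 4].
Proof.
rewrite /bump /bump' /pos_sq; have y2 : 0 <= y * y by rewrite -expr2 sqr_ge0.
have [h|] := boolP (1 - y * y <= 0); last rewrite -ltNge => /ltW h.
  by rewrite (max_l h) expr0n !mulr0 oppr0 mulr0 normr0; split.
rewrite (max_r h); have m1 : 0 <= (1 - y * y) * (y * y) by rewrite mulr_ge0.
have y1 : -1 <= y <= 1 by apply/andP; split; nra.
case/andP: y1 => y1 y1'.
split; first exact: sqr_ge0; first by nra.
- rewrite normrN ler_norml; have := mulr_ge0 h y2.
  have : 0 <= (1 - y) * (1 - y * y) by rewrite mulr_ge0// subr_ge0.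
  have : 0 <= (1 + y) * (1 - y * y) by rewrite mulr_ge0//; lra.
  by move=> *; apply/andP; split; nra.
- by rewrite ler_norml; apply/andP; split; nra.
Qed.

Lemma bump_support y : 1 <= `|y| -> bump y = 0.
Proof.
move=> y1; rewrite /bump /pos_sq max_l ?expr0n//.
by rewrite subr_le0 -expr2 -real_normK ?num_real// exprn_ege1.
Qed.

Lemma bump_continuous : continuous bump.
Proof.
exact: is_derive_continuous is_derive_bump.
Qed.

Lemma bump'_continuous : continuous bump'.
Proof.
apply: continuous_oppr; apply: continuous_mulr.
  by apply: continuous_mulr; [exact: continuous_cstr|exact: continuous_idr].
apply: continuous_maxr; first exact: continuous_cstr.
apply: continuous_subr; first exact: continuous_cstr.
by apply: continuous_mulr; exact: continuous_idr.
Qed.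

Definition cutoff (n : nat) (v : R) : R := bump (n.+1%:R^-1 * v).
Definition cutoff' (n : nat) (v : R) : R := n.+1%:R^-1 * bump' (n.+1%:R^-1 * v).

Lemma is_derive_cutoff n v : is_derive v (1 : R) (cutoff n) (cutoff' n v).
Proof.
have := @is_derive_compr bump _ v _ _ (is_derive_bump (n.+1%:R^-1 * v))
  (is_derive_scale n.+1%:R^-1 v) => H.
by apply: (is_derive_eq H); rewrite mulrC.
Qed.

Lemma cutoff_bounds n v :
  [/\ `|cutoff n v| <= 1, `|cutoff' n v| <= 4 & `|v * cutoff' n v| <= 4].
Proof.
have [b0 b1 b2 b3] := bump_bounds (n.+1%:R^-1 * v); split.
- by rewrite /cutoff ger0_norm.
- rewrite /cutoff' normrM (le_trans _ b2)// ler_piMl// ger0_norm ?invr_ge0//.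
  by rewrite invf_le1 ?ltr0n// ler1n.
- by rewrite /cutoff' mulrA [v * _]mulrC.
Qed.

Lemma cutoff_continuous n : continuous (cutoff n).
Proof.
apply: (@continuous_compr (fun v => n.+1%:R^-1 * v) bump); last exact: bump_continuous.
exact: mulrl_continuous.
Qed.

Lemma cutoff'_continuous n : continuous (cutoff' n).
Proof.
apply: continuous_mulr; first exact: continuous_cstr.
apply: (@continuous_compr (fun v => n.+1%:R^-1 * v) bump'); last exact: bump'_continuous.
exact: mulrl_continuous.
Qed.

Let scaled_cvg0 (v : R) : n.+1%:R^-1 * v @[n --> \oo] --> (0 : R).
Proof. by rewrite -[X in _ --> X](mul0r v); apply: cvgMl; exact: cvg_harmonic. Qed.

Lemma cutoff_cvg v : cutoff n v @[n --> \oo] --> (1 : R).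
Proof.
have -> : (1 : R) = bump 0 by rewrite /bump mulr0 subr0 /pos_sq max_r ?expr1n.
exact: (cvg_comp _ _ (scaled_cvg0 v) (@bump_continuous 0)).
Qed.

Lemma cutoff'_cvg v : cutoff' n v @[n --> \oo] --> (0 : R).
Proof.
rewrite -[X in _ --> X](mul0r (bump' 0)); apply: cvgM; first exact: cvg_harmonic.
exact: (cvg_comp _ _ (scaled_cvg0 v) (@bump'_continuous 0)).
Qed.

Lemma cutoff_support n v : n.+1%:R <= `|v| -> cutoff n v = 0.
Proof.
move=> nv; apply: bump_support; rewrite normrM ger0_norm ?invr_ge0//.
by rewrite ler_pdivlMl ?ltr0n// mulr1.
Qed.

Lemma cutoff'_support n v : n.+1%:R <= `|v| -> cutoff' n v = 0.
Proof.
move=> nv; rewrite /cutoff' /bump' max_l ?mulr0 ?oppr0 ?mulr0//.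
rewrite subr_le0 -expr2 -real_normK ?num_real// exprn_ege1//.
by rewrite normrM ger0_norm ?invr_ge0// ler_pdivlMl ?ltr0n// mulr1.
Qed.

End cutoff.

Section test_functions.
Variables (a at_ ax b bt bx : R -> R -> R).
Hypotheses (ha : coefficient a at_ ax) (hb : coefficient b bt bx).
Variable n : nat.

Definition cut_affine (t x v : R) : R := (a t x + v * b t x) * cutoff n v.

Lemma cut_affine_dt t x v :
  is_derive t (1 : R) (fun s => cut_affine s x v) ((at_ t x + v * bt t x) * cutoff n v).
Proof.
have := is_derive_mulr (is_derive_addr (coef_dt ha t x)
  (is_derive_mulr (is_derive_cst v t 1) (coef_dt hb t x)))
  (is_derive_cst (cutoff n v) t 1) => H.
by apply: (is_derive_eq H); rewrite /=; ring.
Qed.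

Lemma cut_affine_dx t x v :
  is_derive x (1 : R) (fun y => cut_affine t y v) ((ax t x + v * bx t x) * cutoff n v).
Proof.
have := is_derive_mulr (is_derive_addr (coef_dx ha t x)
  (is_derive_mulr (is_derive_cst v x 1) (coef_dx hb t x)))
  (is_derive_cst (cutoff n v) x 1) => H.
by apply: (is_derive_eq H); rewrite /=; ring.
Qed.

Lemma cut_affine_dv t x v : is_derive v (1 : R) (cut_affine t x)
  (b t x * cutoff n v + (a t x + v * b t x) * cutoff' n v).
Proof.
have := is_derive_mulr (is_derive_addr (is_derive_cst (a t x) v 1)
  (is_derive_mulr (is_derive_id v 1) (is_derive_cst (b t x) v 1)))
  (is_derive_cutoff n v) => H.
by apply: (is_derive_eq H); rewrite /=; ring.
Qed.

Let c3_coef p : continuous2 p -> continuous3 (fun t x _ => p t x).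
Proof.
move=> cp z; apply: (@continuous_comp _ _ _ fst (fun z : R * R => p z.1 z.2)).
  exact: cvg_fst.
exact: cp.
Qed.

Let c3_v (h : R -> R) : continuous h -> continuous3 (fun _ _ v => h v).
Proof.
by move=> ch z; apply: (@continuous_comp _ _ _ snd h); [exact: cvg_snd|exact: ch].
Qed.

Let c3M (p r : R -> R -> R -> R) : continuous3 p -> continuous3 r ->
  continuous3 (fun t x v => p t x v * r t x v).
Proof. by move=> cp cr z; apply: continuousM; [exact: cp|exact: cr]. Qed.

Let c3D (p r : R -> R -> R -> R) : continuous3 p -> continuous3 r ->
  continuous3 (fun t x v => p t x v + r t x v).
Proof. by move=> cp cr z; apply: continuousD; [exact: cp|exact: cr]. Qed.

Let c3_affine (p r : R -> R -> R) (h : R -> R) : continuous2 p -> continuous2 r ->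
  continuous h -> continuous3 (fun t x v => (p t x + v * r t x) * h v).
Proof.
move=> cp cr ch; apply: c3M; last exact: c3_v.
apply: c3D; first exact: c3_coef.
by apply: c3M; [apply: (@c3_v id) => ?; exact: cvg_id|exact: c3_coef].
Qed.

Lemma cut_affine_test : test_function cut_affine.
Proof.
have Et : d_t cut_affine = fun t x v => (at_ t x + v * bt t x) * cutoff n v.
  apply/funext => t; apply/funext => x; apply/funext => v.
  exact: is_deriveE (cut_affine_dt t x v).
have Ex : d_x cut_affine = fun t x v => (ax t x + v * bx t x) * cutoff n v.
  apply/funext => t; apply/funext => x; apply/funext => v.
  exact: is_deriveE (cut_affine_dx t x v).
have Ev : d_v cut_affine = fun t x v =>
    b t x * cutoff n v + (a t x + v * b t x) * cutoff' n v.
  apply/funext => t; apply/funext => x; apply/funext => v.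
  exact: is_deriveE (cut_affine_dv t x v).
split.
- move=> t x; apply/funext => v.
  by rewrite /cut_affine (coef_periodic ha) (coef_periodic hb).
- by exists n.+1%:R => t x v nv; rewrite /cut_affine (cutoff_support nv) mulr0.
- by move=> t x v; have := cut_affine_dt t x v => ?; exact: ex_derive.
- by move=> t x v; have := cut_affine_dx t x v => ?; exact: ex_derive.
- by move=> t x v; have := cut_affine_dv t x v => ?; exact: ex_derive.
- by apply: c3_affine; [exact: coef_cont ha|exact: coef_cont hb|exact: cutoff_continuous].
- by rewrite Et; apply: c3_affine;
    [exact: coef_cont_t ha|exact: coef_cont_t hb|exact: cutoff_continuous].
- by rewrite Ex; apply: c3_affine;
    [exact: coef_cont_x ha|exact: coef_cont_x hb|exact: cutoff_continuous].
- rewrite Ev; apply: c3D.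
    by apply: c3M; [exact: c3_coef (coef_cont hb)|exact: c3_v (@cutoff_continuous n)].
  by apply: c3_affine; [exact: coef_cont ha|exact: coef_cont hb|exact: cutoff'_continuous].
Qed.

End test_functions.

End coefficients.

(** * Estimates on the field *)

Section field_estimates.

Variable eps : R.
Hypothesis eps_gt0 : 0 < eps.

Let ind (a b x : R) : R := \1_(`[a, b]%classic : set R) x.

Let ind_le1 (a b x : R) : `|ind a b x| <= 1.
Proof. by rewrite /ind indicE; case: (_ \in _); rewrite ?normr1 ?normr0. Qed.

Let ind_tbounded a b : tbounded (ind a b).
Proof.
split; last by exists 1.
by apply: measurable_funTS; apply: measurable_indic; exact: measurable_itv.
Qed.

Lemma field_variation (f : R -> R -> R) (V : R -> R) (a b : R) : density f ->
  poisson eps f V -> 0 <= a -> a <= b -> b <= 1 ->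
  - eps ^+ 2 * (derive1 V b - derive1 V a) =
  Iph (fun z => f z.1 z.2 * ind a b z.1) - \int[mu]_(x in `[a, b]) 1.
Proof.
move=> df pV a0 ab b1.
have sub : `[a, b]%classic `<=` @torus R.
  by rewrite /torus; apply: subset_itv; rewrite bnd_simp.
have ri : rintegrable mu `[a, b] (rho f).
  by apply: integrableS (rho_integrable df) => //; exact: measurable_torus.
have oi : rintegrable mu `[a, b] (fun=> 1).
  by apply: within_continuous_rintegrable; apply: continuous_subspaceT; exact: continuous_cstr.
rewrite (poisson_eq pV ab) (@RintegralB _ _ _ mu)//; congr (_ - _).
have [_ ->] := phase_density_int df (ind_tbounded a b).
have -> : \int[mu]_(x in `[a, b]) \int[mu]_v f x v =
    \int[mu]_(x in @torus R `&` `[a, b]) rho f x by rewrite setIidr.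
rewrite Rintegral_mkcondr; apply: eq_Rintegral => x _.
by rewrite /ind indicE patchE; case: ifP; rewrite ?mulr1 ?mulr0.
Qed.

Let itv1_bound (a b : R) : 0 <= a -> a <= b -> b <= 1 ->
  `|\int[mu]_(x in `[a, b]) (1 : R)| <= 1.
Proof.
move=> a0 ab b1.
have -> : \int[mu]_(x in `[a, b]) (1 : R) = b - a.
  exact: (integral_derivative ab (fun x _ => is_derive_id x 1) (@continuous_cstr 1)).
by rewrite ger0_norm; lra.
Qed.

Lemma periodic_critical_point (V : R -> R) : periodic1 V -> (forall x, derivable V x 1) ->
  exists2 c : R, 0 <= c <= 1 & derive1 V c = 0.
Proof.
move=> pV dV.
have cV : {within `[0, 1]%classic, continuous V} by exact: derivable_within.
have V01 : V 0 = V 1 by rewrite -[in RHS](add0r 1) pV.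
have [c] := Rolle ltr01 (fun x _ => dV x) cV V01.
rewrite in_itv /= => /andP[c0 c1] dc.
by exists c; [rewrite !ltW|exact: is_deriveE].
Qed.

(** V - W has a critical point c, and the variation of V' - W' between c and x
    measures the difference of the masses carried by that interval. *)
Lemma field_difference (f g : R -> R -> R) (V W : R -> R) (x : R) :
  density f -> density g -> poisson eps f V -> poisson eps g W -> 0 <= x <= 1 ->
  `|derive1 V x - derive1 W x| <=
    (eps ^+ 2)^-1 * Iph (fun z => `|f z.1 z.2 - g z.1 z.2|).
Proof.
move=> df dg pV pW /andP[x0 x1].
have [c /andP[c0 c1] Dc] : exists2 c : R, 0 <= c <= 1 & derive1 V c = derive1 W c.
  have pVW : periodic1 (fun x => V x - W x).
    by move=> y; rewrite (poisson_periodic pV) (poisson_periodic pW).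
  have [|c c01 Dc] := periodic_critical_point pVW.
    move=> y; have /derivableP dV := @poisson_derivable _ _ _ _ pV y.
    have /derivableP dW := @poisson_derivable _ _ _ _ pW y.
    by have := is_derive_subr dV dW => ?; exact: ex_derive.
  exists c => //.
  have /derivableP dV := @poisson_derivable _ _ _ _ pV c.
  have /derivableP dW := @poisson_derivable _ _ _ _ pW c.
  have /is_deriveE := is_derive_subr dV dW; rewrite Dc -!derive1E => /esym/eqP.
  by rewrite subr_eq0 => /eqP.
have di : iph (fun z => f z.1 z.2 - g z.1 z.2).
  by apply: (@phase_rintegrableB); exact: density_integrable.
have key (a b : R) : 0 <= a -> a <= b -> b <= 1 ->
    eps ^+ 2 * `|(derive1 V b - derive1 V a) - (derive1 W b - derive1 W a)| <=
    Iph (fun z => `|f z.1 z.2 - g z.1 z.2|).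
  move=> a0 ab b1.
  have [_ /=] := phase_weight di (ind_tbounded a b).1 (fun x _ => ind_le1 a b x); rewrite mul1r.
  have [||_ ->] := @phase_lincomb
    [:: (1, fun z => f z.1 z.2 * ind a b z.1); (-1, fun z => g z.1 z.2 * ind a b z.1)]
    (fun z => (f z.1 z.2 - g z.1 z.2) * ind a b z.1).
  - by do !split => //=; exact: phase_moment0.
  - by move=> z _ /=; ring.
  have := field_variation df pV a0 ab b1; have := field_variation dg pW a0 ab b1.
  move=> /= Hg Hf.
  set I1 := \int[mu2]_(z in @phase R) (f z.1 z.2 * ind a b z.1) in Hf *.
  set I2 := \int[mu2]_(z in @phase R) (g z.1 z.2 * ind a b z.1) in Hg *.
  apply: le_trans.
  rewrite -[X in X * `|_|](ger0_norm (sqr_ge0 eps)) -normrM -normrN.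
  rewrite le_eqVlt; apply/orP; left; apply/eqP; congr (`|_|).
  have -> : I1 = - eps ^+ 2 * (derive1 V b - derive1 V a) + \int[mu]_(x in `[a, b]) 1.
    by rewrite Hf subrK.
  have -> : I2 = - eps ^+ 2 * (derive1 W b - derive1 W a) + \int[mu]_(x in `[a, b]) 1.
    by rewrite Hg subrK.
  by ring.
rewrite ler_pdivlMl ?exprn_gt0//.
have [xc|/ltW cx] := leP x c.
- have := key x c x0 xc c1; rewrite Dc -normrN.
  by congr (_ * `|_| <= _); ring.
- have := key c x c0 cx x1; rewrite Dc.
  by congr (_ * `|_| <= _); ring.
Qed.

(** The field vanishes somewhere and, the mass being 1, its variation is
    bounded. *)
Lemma field_bound (f : R -> R -> R) (V : R -> R) (x : R) :
  density f -> Iph (fun z => f z.1 z.2) = 1 -> poisson eps f V -> 0 <= x <= 1 ->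
  `|derive1 V x| <= 2 / eps ^+ 2.
Proof.
move=> df m1 pV /andP[x0 x1].
have [c /andP[c0 c1] Dc] := periodic_critical_point (poisson_periodic pV) (@poisson_derivable _ _ _ _ pV).
have key (a b : R) : 0 <= a -> a <= b -> b <= 1 ->
    eps ^+ 2 * `|derive1 V b - derive1 V a| <= 2.
  move=> a0 ab b1.
  have [_ /=] := phase_weight (density_integrable df) (ind_tbounded a b).1
    (fun x _ => ind_le1 a b x); rewrite mul1r.
  have -> : Iph (fun z => `|f z.1 z.2|) = 1.
    by rewrite -m1; apply: eq_Rintegral => z _; rewrite ger0_norm// density_ge0.
  have := itv1_bound a0 ab b1; have := field_variation df pV a0 ab b1.
  move=> Hf h1 h2.
  rewrite -[X in X * `|_|](ger0_norm (sqr_ge0 eps)) -normrM -normrN -mulNr Hf.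
  by rewrite (le_trans (ler_normB _ _))//; lra.
rewrite ler_pdivlMr ?exprn_gt0// mulrC.
have [xc|/ltW cx] := leP x c.
- by have := key x c x0 xc c1; rewrite Dc sub0r normrN.
- by have := key c x c0 cx x1; rewrite Dc subr0.
Qed.

End field_estimates.

(** * Removal of the cutoff in the transport equation *)

Section transport.

(** The sequential form is the one that dominated convergence uses. *)
Definition L1_continuous (g : R -> R -> R -> R) : Prop :=
  forall (u : R^nat) (s : R), (forall n, 0 <= u n) -> 0 <= s -> u @ \oo --> s ->
  Iph (fun z => `|g (u n) z.1 z.2 - g s z.1 z.2|) @[n --> \oo] --> (0 : R).

Variables (eps K2 : R) (f : R -> R -> R -> R) (V : R -> R -> R).
Hypothesis eps_gt0 : 0 < eps.
Hypothesis f_density : forall t : R, 0 <= t -> density (f t).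
Hypothesis f_mass : forall t : R, 0 <= t -> Iph (fun z => f t z.1 z.2) = 1.
Hypothesis f_moment : forall t : R, 0 <= t -> Iph (fun z => f t z.1 z.2 * z.2 ^+ 2) <= K2.
Hypothesis f_poisson : forall t : R, 0 <= t -> poisson eps (f t) (V t).
Hypothesis f_L1 : L1_continuous f.

Variables (C : R) (g : R -> R -> R -> R).
Hypothesis g_measurable : forall t : R, 0 <= t ->
  measurable_fun setT (fun z : R * R => g t z.1 z.2).
Hypothesis g_le : forall t x v : R, 0 <= t -> `|g t x v| <= C * f t x v.
Hypothesis g_L1 : L1_continuous g.
Hypothesis g_vlasov : vlasov V g.

Variables (a at_ ax b bt bx : R -> R -> R).
Hypotheses (ha : coefficient a at_ ax) (hb : coefficient b bt bx).

Let C_ge0 : 0 <= C.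
Proof.
have [h|] := leP 0 C => // C0.
have f0 x v : f 0 x v = 0.
  have := g_le x v (lexx 0); have := density_ge0 (f_density (lexx 0)) x v => f0 gC.
  have := le_trans (normr_ge0 _) gC; rewrite nmulr_rge0// => f0'.
  by apply/eqP; rewrite eq_le f0 f0'.
have := f_mass (lexx 0); under eq_Rintegral do rewrite f0.
rewrite Rintegral_cst ?mul0r; last exact: measurable_phase.
by move/eqP; rewrite eq_sym oner_eq0.
Qed.

Definition transport_op (s : R) (z : R * R) : R :=
  at_ s z.1 + z.2 * bt s z.1 + z.2 * (ax s z.1 + z.2 * bx s z.1)
  - derive1 (V s) z.1 * b s z.1.

(** The transport operator applied to [cut_affine]. *)
Let op_ (n : nat) (s : R) (z : R * R) : R :=
  (at_ s z.1 + z.2 * bt s z.1) * cutoff n z.2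
  + z.2 * ((ax s z.1 + z.2 * bx s z.1) * cutoff n z.2)
  - derive1 (V s) z.1 *
    (b s z.1 * cutoff n z.2 + (a s z.1 + z.2 * b s z.1) * cutoff' n z.2).

Let F_ n s := Iph (fun z => g s z.1 z.2 * op_ n s z).
Let F s := Iph (fun z => g s z.1 z.2 * transport_op s z).

Let continuous2_snd (p : R -> R -> R) t : continuous2 p -> continuous (p t).
Proof.
by move=> cp x; exact: (cvg_comp2 (cvg_cst t) cvg_id (cp (t, x))).
Qed.

Let continuous2_fst (p : R -> R -> R) x : continuous2 p -> continuous (p ^~ x).
Proof.
by move=> cp t; exact: (cvg_comp2 cvg_id (cvg_cst x) (cp (t, x))).
Qed.

Let mc (p : R -> R -> R) t : continuous2 p ->
  measurable_fun (@phase R) (fun z => p t z.1).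
Proof.
move=> cp; apply: measurable_phase_fst; apply: measurable_funTS.
by apply: continuous_measurableT; exact: continuous2_snd.
Qed.

Let mv (h : R -> R) : continuous h -> measurable_fun (@phase R) (fun z => h z.2).
Proof.
by move=> ch; apply: measurable_funTS; apply: measurable_fun_snd;
  exact: continuous_measurableT.
Qed.

Let mE s : 0 <= s -> measurable_fun (@phase R) (fun z => derive1 (V s) z.1).
Proof.
move=> s0; apply: measurable_phase_fst.
exact: (field_tbounded eps_gt0 (f_density s0) (f_poisson s0)).1.
Qed.

Let mg s : 0 <= s -> measurable_fun (@phase R) (fun z => g s z.1 z.2).
Proof. by move=> s0; apply: measurable_funTS; exact: g_measurable. Qed.

Let mop_ n s : 0 <= s -> measurable_fun (@phase R) (op_ n s).
Proof.
move=> s0; have m2 : measurable_fun (@phase R) (fun z : R * R => z.2).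
  exact: (mv (@continuous_idr)).
have mcn := mv (@cutoff_continuous n); have mcn' := mv (@cutoff'_continuous n).
have [ca [cat cax]] := (coef_cont ha, (coef_cont_t ha, coef_cont_x ha)).
have [cb [cbt cbx]] := (coef_cont hb, (coef_cont_t hb, coef_cont_x hb)).
have mEs := mE s0.
apply: measurable_funB; first apply: measurable_funD.
- by do ![exact: mc|exact: m2|exact: mcn|apply: measurable_funM|apply: measurable_funD].
- by do ![exact: mc|exact: m2|exact: mcn|apply: measurable_funM|apply: measurable_funD].
- by do ![exact: mc|exact: m2|exact: mcn|exact: mcn'|exact: mEs
         |apply: measurable_funM|apply: measurable_funD].
Qed.

Let op_bound : exists2 B : R, 0 <= B & forall n s z, 0 <= s -> @phase R z ->
  `|op_ n s z| <= B * (1 + z.2 ^+ 2).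
Proof.
have [M hM] := coef_bound ha; have [N hN] := coef_bound hb.
have M0 : 0 <= M by have [+ _ _] := hM 0 0; apply: le_trans.
have N0 : 0 <= N by have [+ _ _] := hN 0 0; apply: le_trans.
pose L := M + N.
have [e [e0 eE]] : exists e, 0 <= e /\ 2 / eps ^+ 2 = e.
  by exists (2 / eps ^+ 2); rewrite divr_ge0// sqr_ge0.
have L0 : 0 <= L by rewrite addr_ge0.
exists (2 * L + 9 * e * L) => [|n s [x v] s0 [/= x01 _]].
  by rewrite addr_ge0// !mulr_ge0.
have [a1 a2 a3] := hM s x; have [b1 b2 b3] := hN s x.
have ML : M <= L by rewrite /L lerDl.
have NL : N <= L by rewrite /L lerDr.
have [c1 c2 c3] := cutoff_bounds n v.
have E1 : `|derive1 (V s) x| <= e.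
  rewrite -eE; apply: (field_bound eps_gt0 (f_density s0) (f_mass s0) (f_poisson s0)).
  by move: x01; rewrite /torus /= in_itv.
rewrite /op_ /=.
have T1 : `|(at_ s x + v * bt s x) * cutoff n v| <= L * (1 + `|v|).
  rewrite normrM -[leRHS]mulr1 ler_pM// (le_trans (ler_normD _ _))//.
  rewrite mulrDr mulr1 lerD ?(le_trans a2)// normrM mulrC ler_wpM2r//.
  exact: (le_trans b2 NL).
have T2 : `|v * ((ax s x + v * bx s x) * cutoff n v)| <= `|v| * (L * (1 + `|v|)).
  rewrite normrM ler_wpM2l// normrM -[leRHS]mulr1 ler_pM//.
  rewrite (le_trans (ler_normD _ _))//.
  rewrite mulrDr mulr1 lerD ?(le_trans a3)// normrM mulrC ler_wpM2r//.
  exact: (le_trans b3 NL).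
have T3 : `|b s x * cutoff n v + (a s x + v * b s x) * cutoff' n v| <= 9 * L.
  have -> : b s x * cutoff n v + (a s x + v * b s x) * cutoff' n v =
    b s x * cutoff n v + a s x * cutoff' n v + b s x * (v * cutoff' n v) by ring.
  rewrite (le_trans (ler_normD _ _))//.
  have n1 : `|b s x * cutoff n v| <= L * 1.
    by rewrite normrM ler_pM// (le_trans b1).
  have n2 : `|a s x * cutoff' n v| <= L * 4.
    by rewrite normrM ler_pM// (le_trans a1).
  have n3 : `|b s x * (v * cutoff' n v)| <= L * 4.
    by rewrite normrM ler_pM// (le_trans b1).
  by have := ler_normD (b s x * cutoff n v) (a s x * cutoff' n v); lra.
have T4 : `|derive1 (V s) x *
    (b s x * cutoff n v + (a s x + v * b s x) * cutoff' n v)| <= e * (9 * L).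
  by rewrite normrM ler_pM.
apply: le_trans (ler_normB _ _) _.
have T5 := ler_normD ((at_ s x + v * bt s x) * cutoff n v)
  (v * ((ax s x + v * bx s x) * cutoff n v)).
have vv : `|v| ^+ 2 = v ^+ 2 by rewrite real_normK ?num_real.
have v1 : 2 * `|v| <= 1 + v ^+ 2.
  by rewrite -vv; have := sqr_ge0 (`|v| - 1); lra.
have T6 : L * (1 + `|v|) + `|v| * (L * (1 + `|v|)) <= 2 * L * (1 + v ^+ 2).
  have -> : L * (1 + `|v|) + `|v| * (L * (1 + `|v|)) = L * (1 + 2 * `|v| + `|v| ^+ 2) by ring.
  have h : 1 + 2 * `|v| + `|v| ^+ 2 <= 2 * (1 + v ^+ 2) by rewrite vv; lra.
  by rewrite [2 * L]mulrC -mulrA ler_wpM2l.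
have T7 : e * (9 * L) <= 9 * e * L * (1 + v ^+ 2).
  have -> : e * (9 * L) = 9 * e * L by ring.
  by rewrite ler_peMr ?lerDl ?sqr_ge0// !mulr_ge0.
by rewrite [leRHS]mulrDl; lra.
Qed.

Let weight_integrable s : 0 <= s ->
  iph (fun z => f s z.1 z.2 * (1 + z.2 ^+ 2)) /\
  Iph (fun z => f s z.1 z.2 * (1 + z.2 ^+ 2)) <= 1 + K2.
Proof.
move=> s0; have ds := f_density s0.
have [||Hi ->] := @phase_lincomb
  [:: (1, fun z => f s z.1 z.2); (1, fun z => f s z.1 z.2 * z.2 ^+ 2)]
  (fun z => f s z.1 z.2 * (1 + z.2 ^+ 2)).
- by split; [exact: density_integrable|split => //; exact: density_moment2].
- by move=> z _ /=; ring.
by split => //=; rewrite f_mass// !mul1r addr0 lerD2l; exact: f_moment.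
Qed.

Let dominating (B s : R) (z : R * R) : R := C * B * (f s z.1 z.2 * (1 + z.2 ^+ 2)).

Let dominating_integrable B s : 0 <= s -> iph (dominating B s).
Proof.
by move=> s0; apply: (@phase_rintegrableZ);
  exact: (weight_integrable s0).1.
Qed.

Let le_dominating B s (h : R * R -> R) z : 0 <= s ->
  `|h z| <= B * (1 + z.2 ^+ 2) -> `|g s z.1 z.2 * h z| <= dominating B s z.
Proof.
move=> s0 hB; rewrite normrM (le_trans (ler_pM _ _ (g_le _ _ s0) hB))//.
by rewrite le_eqVlt /dominating; apply/orP; left; apply/eqP; ring.
Qed.

Let dominated s (h : R * R -> R) (B : R) : 0 <= s -> 0 <= B ->
  measurable_fun (@phase R) h ->
  (forall z, @phase R z -> `|h z| <= B * (1 + z.2 ^+ 2)) ->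
  iph (fun z => g s z.1 z.2 * h z) /\
  `|Iph (fun z => g s z.1 z.2 * h z)| <= C * B * (1 + K2).
Proof.
move=> s0 B0 mh hB.
have mgh : measurable_fun (@phase R) (fun z => g s z.1 z.2 * h z).
  by apply: measurable_funM => //; exact: mg.
have gh z : @phase R z -> `|g s z.1 z.2 * h z| <= dominating B s z.
  by move=> zp; apply: le_dominating => //; exact: hB.
split.
  exact: (@phase_le_rintegrable _ _ mgh
    (dominating_integrable B s0) gh).
apply: le_trans (@phase_le_Rintegral_norm _ _ mgh
  (dominating_integrable B s0) gh) _.
have [wi wK] := weight_integrable s0.
by rewrite (@RintegralZl _ _ _ mu2)//; [rewrite ler_wpM2l// mulr_ge0|exact: measurable_phase].
Qed.

Let op_cvg s z : op_ n s z @[n --> \oo] --> transport_op s z.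
Proof.
have -> : transport_op s z = (at_ s z.1 + z.2 * bt s z.1) * 1
  + z.2 * ((ax s z.1 + z.2 * bx s z.1) * 1)
  - derive1 (V s) z.1 * (b s z.1 * 1 + (a s z.1 + z.2 * b s z.1) * 0).
  by rewrite /transport_op; ring.
have c1 := @cutoff_cvg z.2; have c0 := @cutoff'_cvg z.2.
by apply: cvgB; [apply: cvgD|]; do ?[apply: cvgMr => //]; apply: cvgD; exact: cvgMr.
Qed.

Let F_cvg s : 0 <= s -> iph (fun z => g s z.1 z.2 * transport_op s z) /\
  F_ n s @[n --> \oo] --> F s.
Proof.
move=> s0; have [B B0 hB] := op_bound.
apply: (@phase_dominated
  (fun n z => g s z.1 z.2 * op_ n s z) _ (dominating B s)).
- by move=> n; apply: measurable_funM; [exact: mg|exact: mop_].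
- by move=> z _; apply: cvgMr; exact: op_cvg.
- exact: dominating_integrable.
- by move=> n z zp; apply: le_dominating => //; exact: hB.
Qed.

(** For a fixed cutoff, the right-hand side of the Vlasov equation is continuous
    in time: the coefficients are bounded, g is continuous in L^1 and the field
    depends continuously on f in L^1. *)
Let F_seq n (u : R^nat) (s : R) : (forall k, 0 <= u k) -> 0 <= s -> u @ \oo --> s ->
  F_ n (u k) @[k --> \oo] --> F_ n s.
Proof.
move=> u0 s0 us; have [B B0 hB] := op_bound.
pose m : R := n.+1%:R.
have op_le (r : R) z : 0 <= r -> @phase R z -> `|op_ n r z| <= B * (1 + m ^+ 2).
  move=> r0 zp; have [zm|zm] := leP m `|z.2|.
    have [c0 c1] : cutoff n z.2 = 0 /\ cutoff' n z.2 = 0.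
      split; first exact: cutoff_support.
      exact: cutoff'_support.
    rewrite /op_ c0 c1 !mulr0 !addr0 mulr0 subr0 normr0.
    by rewrite mulr_ge0// addr_ge0// sqr_ge0.
  apply: le_trans (hB n r z r0 zp) _.
  rewrite ler_wpM2l// lerD2l -[z.2 ^+ 2]real_normK ?num_real//.
  by rewrite ler_sqr ?nnegrE// ltW.
have E_cvg (x : R) : 0 <= x <= 1 -> derive1 (V (u k)) x @[k --> \oo] --> derive1 (V s) x.
  move=> x01; apply/cvgrPdist_le => e e0.
  have /cvgrPdist_le := f_L1 u0 s0 us.
  move=> /(_ (eps ^+ 2 * e)); rewrite mulr_gt0 ?exprn_gt0// => /(_ isT).
  apply: filterS => k; rewrite sub0r normrN => hk.
  rewrite distrC; apply: le_trans (field_difference eps_gt0 (f_density (u0 k))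
    (f_density s0) (f_poisson (u0 k)) (f_poisson s0) x01) _.
  by rewrite ler_pdivrMl ?exprn_gt0//; apply: le_trans hk; exact: ler_norm.
have p_cvg (p : R -> R -> R) x : continuous2 p -> p (u k) x @[k --> \oo] --> p s x.
  by move=> cp; apply: (cvg_comp u (p ^~ x) us); exact: continuous2_fst.
have op_cvg' z : @phase R z -> op_ n (u k) z @[k --> \oo] --> op_ n s z.
  case=> z1 _; have x01 : 0 <= z.1 <= 1 by move: z1; rewrite /torus /= in_itv.
  have := E_cvg _ x01 => Ez.
  have pat := p_cvg _ z.1 (coef_cont_t ha); have pax := p_cvg _ z.1 (coef_cont_x ha).
  have pbt := p_cvg _ z.1 (coef_cont_t hb); have pbx := p_cvg _ z.1 (coef_cont_x hb).
  have pa := p_cvg _ z.1 (coef_cont ha); have pb := p_cvg _ z.1 (coef_cont hb).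
  have cc (r : R) : (fun _ : nat => r) @ \oo --> r by exact: cvg_cst.
  apply: cvgB; first apply: cvgD.
  - exact: (cvgM (cvgD pat (cvgM (cc _) pbt)) (cc _)).
  - exact: (cvgM (cc _) (cvgM (cvgD pax (cvgM (cc _) pbx)) (cc _))).
  - exact: (cvgM Ez (cvgD (cvgM pb (cc _)) (cvgM (cvgD pa (cvgM (cc _) pb)) (cc _)))).
have iu (r : R) k : 0 <= r -> iph (fun z => g r z.1 z.2 * op_ n (u k) z).
  move=> r0; apply: (dominated r0 B0 (mop_ n (u0 k)) _).1.
  by move=> z zp; exact: hB.
have [_ lim1] : iph (fun z => g s z.1 z.2 * op_ n s z) /\
    Iph (fun z => g s z.1 z.2 * op_ n (u k) z) @[k --> \oo] --> F_ n s.
  apply: (@phase_dominated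
    (fun k z => g s z.1 z.2 * op_ n (u k) z) _ (dominating B s)).
  - by move=> k; apply: measurable_funM; [exact: mg|exact: mop_].
  - by move=> z zp; apply: cvgMr; exact: op_cvg'.
  - exact: dominating_integrable.
  - by move=> k z zp; apply: le_dominating => //; exact: hB.
have lim2 : F_ n (u k) - Iph (fun z => g s z.1 z.2 * op_ n (u k) z)
    @[k --> \oo] --> (0 : R).
  apply/norm_cvg0P.
  apply: (@squeeze_cvgr _ _ _ _ (cst 0) (fun k =>
    B * (1 + m ^+ 2) * Iph (fun z => `|g (u k) z.1 z.2 - g s z.1 z.2|))).
  - apply: nearW => k; rewrite normr_ge0 /=.
    rewrite /F_ -(@RintegralB _ _ _ mu2 (@phase R)); last 3 first.
    + exact: measurable_phase.
    + exact: iu.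
    + exact: iu.
    have gi : iph (fun z => `|g (u k) z.1 z.2 - g s z.1 z.2|).
      apply: (@phase_le_rintegrable _
        (fun z => C * f (u k) z.1 z.2 + C * f s z.1 z.2)).
      + by apply: measurableT_comp => //; apply: measurable_funB; exact: mg.
      + by apply: (@phase_rintegrableD);
          apply: (@phase_rintegrableZ);
          apply: density_integrable; exact: f_density.
      + move=> z _; rewrite normr_id (le_trans (ler_normB _ _))//.
        by rewrite lerD ?g_le.
    rewrite -(@RintegralZl _ _ _ mu2)//; last exact: measurable_phase.
    apply: (@phase_le_Rintegral_norm).
    + by apply: measurable_funB; apply: measurable_funM; do ?[exact: mg|exact: mop_].
    + exact: (@phase_rintegrableZ).
    + move=> z zp; rewrite -mulrBl normrM mulrC ler_wpM2r//.
      exact: op_le.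
  - exact: cvg_cst.
  - by rewrite -[X in _ --> X](mulr0 (B * (1 + m ^+ 2))); apply: cvgMr; exact: g_L1.
have lim3 := cvgD lim2 lim1; rewrite add0r in lim3.
have -> : (fun k => F_ n (u k)) = (fun k => F_ n (u k)
    - Iph (fun z => g s z.1 z.2 * op_ n (u k) z)
    + Iph (fun z => g s z.1 z.2 * op_ n (u k) z)).
  by apply/funext => k; rewrite subrK.
exact: lim3.
Qed.

Let F_measurable n (t : R) : measurable_fun `[0, t] (F_ n).
Proof.
have cF : continuous (fun s : R => F_ n (Num.max s 0)).
  move=> s; apply/(@cvg_nbhsP R R^o) => u us.
  apply: F_seq.
  - by move=> k; rewrite le_max lexx orbT.
  - by rewrite le_max lexx orbT.
  - have := @continuous_maxr id (cst 0) (@continuous_idr) (@continuous_cstr 0) s.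
    exact: (cvg_comp _ _ us).
apply: (eq_measurable_fun (fun s : R => F_ n (Num.max s 0))).
  by move=> s; rewrite inE /= in_itv /= => /andP[s0 _]; rewrite max_l.
by apply: measurable_funTS; exact: continuous_measurableT.
Qed.

(** The cutoff is removed by dominated convergence: the energy controls the
    second moment of g in v uniformly in time, and the transport operator maps
    a + v b to a quadratic polynomial in v. *)
Lemma vlasov_affine (t : R) : 0 <= t ->
  rintegrable mu `[0, t] F /\
  Iph (fun z => g t z.1 z.2 * (a t z.1 + z.2 * b t z.1)) -
  Iph (fun z => g 0 z.1 z.2 * (a 0 z.1 + z.2 * b 0 z.1)) =
  \int[mu]_(s in `[0, t]) F s.
Proof.
move=> t0; have [B B0 hB] := op_bound.
have [Fi Flim] : rintegrable mu `[0, t] F /\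
    \int[mu]_(s in `[0, t]) F_ n s @[n --> \oo] --> \int[mu]_(s in `[0, t]) F s.
  apply: (@Rintegral_dominated _ _ _ mu _ (measurable_itv _) (fun n s => F_ n s) _
    (fun=> C * B * (1 + K2))).
  - by move=> n; exact: F_measurable.
  - by move=> s; rewrite /= in_itv /= => /andP[s0 _]; exact: (F_cvg s0).2.
  - by apply: within_continuous_rintegrable; apply: continuous_subspaceT;
      exact: continuous_cstr.
  - move=> n s; rewrite /= in_itv /= => /andP[s0 _].
    apply: (dominated s0 B0 (mop_ n s0) _).2.
    by move=> z zp; exact: hB.
split => //; apply/esym.
have weak n : Iph (fun z => g t z.1 z.2 * cut_affine a b n t z.1 z.2) -
    Iph (fun z => g 0 z.1 z.2 * cut_affine a b n 0 z.1 z.2) =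
    \int[mu]_(s in `[0, t]) F_ n s.
  have := g_vlasov (cut_affine_test ha hb n) t0.
  rewrite /phase_int -!/(Rintegral _ _ _) => ->.
  apply: eq_Rintegral => s _; rewrite /F_; apply: eq_Rintegral => z _.
  rewrite /d_t /d_x /d_v (is_deriveE (cut_affine_dt ha hb n s z.1 z.2)).
  rewrite (is_deriveE (cut_affine_dx ha hb n s z.1 z.2)).
  by rewrite (is_deriveE (cut_affine_dv a b n s z.1 z.2)).
have [M hM] := coef_bound ha; have [N hN] := coef_bound hb.
have M0 : 0 <= M by have [+ _ _] := hM 0 0; apply: le_trans.
have N0 : 0 <= N by have [+ _ _] := hN 0 0; apply: le_trans.
have bd (s : R) : 0 <= s -> Iph (fun z => g s z.1 z.2 * cut_affine a b n s z.1 z.2)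
    @[n --> \oo] --> Iph (fun z => g s z.1 z.2 * (a s z.1 + z.2 * b s z.1)).
  move=> s0.
  apply: (@phase_dominated
    (fun n z => g s z.1 z.2 * cut_affine a b n s z.1 z.2) _
    (dominating (M + N) s) _ _ _ _).2.
  - move=> n; apply: measurable_funM; first exact: mg.
    have m2 : measurable_fun (@phase R) (fun z : R * R => z.2).
      exact: (mv (@continuous_idr)).
    have mcn := mv (@cutoff_continuous n).
    have ca := coef_cont ha; have cb := coef_cont hb.
    by do ![exact: mc|exact: m2|exact: mcn|apply: measurable_funM|apply: measurable_funD].
  - move=> z _; apply: cvgMr; rewrite -[X in _ --> X]mulr1; apply: cvgMr.
    exact: cutoff_cvg.
  - exact: dominating_integrable.
  - move=> n z _; apply: (@le_dominating _ _ (fun z => cut_affine a b n s z.1 z.2)) => //.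
    have [c1 _ _] := cutoff_bounds n z.2; have [a1 _ _] := hM s z.1.
    have [b1 _ _] := hN s z.1.
    rewrite /cut_affine normrM -[leRHS]mulr1 ler_pM// (le_trans (ler_normD _ _))//.
    rewrite normrM mulrDl lerD//.
      by rewrite (le_trans a1)// ler_peMr// lerDl sqr_ge0.
    rewrite mulrC ler_pM//.
    have vv : `|z.2| ^+ 2 = z.2 ^+ 2 by rewrite real_normK ?num_real.
    by rewrite -vv; have := sqr_ge0 (`|z.2| - 1); have := sqr_ge0 `|z.2|; lra.
have lim := cvgB (bd t t0) (bd 0 (lexx 0)).
apply: (cvg_unique _ Flim) => //.
have -> : (fun n => \int[mu]_(s in `[0, t]) F_ n s) = (fun n =>
    Iph (fun z => g t z.1 z.2 * cut_affine a b n t z.1 z.2) -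
    Iph (fun z => g 0 z.1 z.2 * cut_affine a b n 0 z.1 z.2)).
  by apply/funext => n; rewrite weak.
exact: lim.
Qed.

End transport.

(** * Conserved quantities *)

Section solutions.

Lemma phase_int_ge0_fin (h : R * R -> R) : measurable_fun setT h ->
  (forall z, 0 <= h z) -> (\int[mu2]_(z in @phase R) (h z)%:E < +oo)%E ->
  iph h /\ (\int[mu2]_(z in @phase R) (h z)%:E = (Iph h)%:E)%E.
Proof.
move=> mh h0 hy.
apply: (@phase_ge0_rintegrableP) => //.
exact: measurable_funTS.
Qed.

Lemma within_continuous_norm (G : R -> R) : {within `[0, +oo[%classic, continuous G} ->
  {within `[0, +oo[%classic, continuous (fun s => `|G s|)}.
Proof.
move=> cG x; apply: (@continuous_comp _ _ _ (G : subspace _ -> R) (fun r : R => `|r|)).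
  exact: cG.
exact: norm_continuous.
Qed.

Variables (eps : R) (f0 : R -> R -> R) (f : R -> R -> R -> R) (V : R -> R -> R).
Hypotheses (eps_gt0 : 0 < eps) (hini : initial_datum eps f0 (V 0))
  (hsol : strong_solution eps f0 f V).

Let measurable_f (t : R) : 0 <= t -> measurable_fun setT (fun z : R * R => f t z.1 z.2).
Proof. by move=> t0; exact: (strong_measurable hsol). Qed.

Let f_ge0 (t : R) z : 0 <= t -> 0 <= f t z.1 z.2.
Proof. by move=> t0; exact: (strong_ge0 hsol). Qed.

(** Conservation for the function |G| gives integrability at time t. *)
Lemma solution_casimir (G : R -> R) (t : R) : 0 <= t ->
  {within `[0, +oo[%classic, continuous G} -> iph (fun z => G (f0 z.1 z.2)) ->
  iph (fun z => G (f t z.1 z.2)) /\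
  Iph (fun z => G (f t z.1 z.2)) = Iph (fun z => G (f0 z.1 z.2)).
Proof.
move=> t0 cG Gi; have f00 := strong_initial hsol.
split; last first.
  by have := strong_casimir hsol cG t0; rewrite f00 /phase_int /Rintegral => ->.
have mG : measurable_fun setT (fun z => G (f t z.1 z.2)).
  apply: (measurable_continuous_comp cG (measurable_f t0)).
  by move=> z; exact: f_ge0.
apply/integrableP; split; first by apply/measurable_EFinP; exact: measurable_funTS.
have := strong_casimir hsol (within_continuous_norm cG) t0; rewrite f00 /phase_int => /= ->.
by case/integrableP : Gi.
Qed.

Lemma solution_mass (t : R) : 0 <= t ->
  iph (fun z => f t z.1 z.2) /\ Iph (fun z => f t z.1 z.2) = 1.
Proof.
move=> t0; have f00 := strong_initial hsol.
have m0 : (\int[mu2]_(z in @phase R) (f 0 z.1 z.2)%:E = 1)%E.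
  by rewrite f00; exact: (initial_mass hini).
have [||Hi HE] := @phase_int_ge0_fin (fun z => f 0 z.1 z.2) (measurable_f (lexx 0)).
- by move=> z; exact: f_ge0.
- by rewrite m0 ltry.
have c_id : {within `[0, +oo[%classic, continuous (id : R -> R)}.
  by apply: continuous_subspaceT; exact: continuous_idr.
have [|Ht ->] := @solution_casimir id t t0 c_id; first by rewrite -f00.
by split => //; rewrite -f00; move: HE; rewrite m0 => -[].
Qed.

Lemma solution_density (t : R) : 0 <= t -> density (f t).
Proof.
move=> t0; split.
- by move=> x v; exact: (strong_ge0 hsol).
- exact: measurable_f.
- exact: (solution_mass t0).1.
have mv : measurable_fun setT (fun z : R * R => f t z.1 z.2 * z.2 ^+ 2).
  apply: measurable_funM; first exact: measurable_f.
  by apply: measurable_funX; exact: measurable_snd.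
apply: (phase_int_ge0_fin mv _ _).1.
  by move=> z; rewrite mulr_ge0 ?sqr_ge0// f_ge0.
have := initial_energy hini; rewrite -(strong_initial hsol) -(strong_energy hsol t0).
rewrite /energy /phase_int; set I := integral _ _ _; set J := torus_int _.
have -> : (\int[mu2]_(z in @phase R) (f t z.1 z.2 * z.2 ^+ 2)%:E)%E = I.
  by apply: eq_integral => z _; rewrite real_normK ?num_real.
have I0 : (0 <= I)%E.
  by apply: integral_ge0 => z _; rewrite lee_fin mulr_ge0 ?sqr_ge0// f_ge0.
have J0 : (0 <= J)%E by apply: integral_ge0 => z _; rewrite lee_fin sqr_ge0.
have J1 : (0 <= (eps ^+ 2 / 2)%:E * J)%E.
  by rewrite mule_ge0// lee_fin divr_ge0// sqr_ge0.
move=> H; rewrite ltNge leye_eq; apply/negP => /eqP Iy; move: H.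
rewrite Iy gt0_muley ?lte_fin ?invr_gt0// addye ?ltxx//.
by rewrite gt_eqF// (lt_le_trans _ J1).
Qed.

Lemma solution_poisson (t : R) : 0 <= t -> poisson eps (f t) (V t).
Proof. exact: (strong_poisson hsol). Qed.

Lemma energyE (t : R) : 0 <= t -> energy eps (f t) (V t) =
  (2^-1 * Iph (fun z => f t z.1 z.2 * z.2 ^+ 2)
   + eps ^+ 2 / 2 * Jt (fun x => derive1 (V t) x ^+ 2))%:E.
Proof.
move=> t0; rewrite /energy EFinD !EFinM; congr (_ * _ + _ * _)%E.
- rewrite -(@phase_rintegrable_fineK); last first.
    exact: density_moment2 (solution_density t0).
  by apply: eq_integral => z _; rewrite real_normK ?num_real.
- rewrite -(@torus_rintegrable_fineK); last first.
    have tE := field_tbounded eps_gt0 (solution_density t0) (solution_poisson t0).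
    exact: tbounded_integrable (tboundedM tE tE).
  by apply: eq_integral => z _; rewrite real_normK ?num_real.
Qed.

Lemma solution_energy (t : R) : 0 <= t ->
  2^-1 * Iph (fun z => f t z.1 z.2 * z.2 ^+ 2)
  + eps ^+ 2 / 2 * Jt (fun x => derive1 (V t) x ^+ 2) = fine (energy eps f0 (V 0)).
Proof.
by move=> t0; rewrite -(strong_initial hsol) -(strong_energy hsol t0) energyE.
Qed.

Lemma energy_fin : energy eps f0 (V 0) = (fine (energy eps f0 (V 0)))%:E.
Proof. by rewrite -(strong_initial hsol) energyE. Qed.

Lemma solution_L1 : L1_continuous f.
Proof.
move=> u s u0 s0 us.
have := strong_continuous hsol s0 => H.
have uw : u @ \oo --> within [set s | 0 <= s] (nbhs s).
  move=> A; rewrite /within /= => wA.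
  by apply: (@filterS _ _ (eventually_filter) _ _ _ (us _ wA)) => n /=; apply.
have := cvg_comp _ _ uw H => /fine_cvg; apply.
Qed.

Lemma L1_continuous_comp (b : R -> R) (C : R) :
  (forall r s, `|b r - b s| <= C * `|r - s|) -> measurable_fun setT b ->
  L1_continuous (fun t x v => b (f t x v)).
Proof.
move=> bC mb u s u0 s0 us.
have df (t : R) : 0 <= t -> iph (fun z => `|f t z.1 z.2 - f s z.1 z.2|).
  move=> t0; apply: rintegrable_norm.
  by apply: (@phase_rintegrableB);
    apply: density_integrable; exact: solution_density.
apply: (@squeeze_cvgr _ _ _ _ (cst 0) (fun n =>
  C * Iph (fun z => `|f (u n) z.1 z.2 - f s z.1 z.2|))).
- apply: nearW => n; rewrite Rintegral_ge0//=.
  rewrite -(@RintegralZl _ _ _ mu2)//; [|exact: measurable_phase|exact: df].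
  have bi : iph (fun z => `|b (f (u n) z.1 z.2) - b (f s z.1 z.2)|).
    apply: (@phase_le_rintegrable _
      (fun z => C * `|f (u n) z.1 z.2 - f s z.1 z.2|)).
    + apply: measurable_funTS; apply: measurableT_comp => //.
      by apply: measurable_funB; apply: (measurableT_comp mb); exact: measurable_f.
    + by apply: (@phase_rintegrableZ); exact: df.
    + by move=> z _; rewrite normr_id.
  apply: (@le_Rintegral _ _ _ mu2) => //.
  + exact: measurable_phase.
  + by apply: (@phase_rintegrableZ); exact: df.
- exact: cvg_cst.
- by rewrite -[X in _ --> X](mulr0 C); apply: cvgMr; exact: solution_L1.
Qed.

End solutions.

(** * Integrability of the entropy densities *)

Section profile_integrability.

Variables (mup phi Q : R -> R) (vb : R).
Hypotheses (hmu : S_stable mup vb) (hphi : profile_function mup vb phi)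
  (hQ : admissible phi Q).

(** The reference density is a combination of Q f, of a moment of f and of the
    Casimir integrand, all integrable on phase space, and it does not depend
    on x. *)
Lemma profile_density_integrable (f : R -> R -> R) : density f ->
  iph (fun z => Q (f z.1 z.2)) -> (casimir mup Q f < +oo)%E ->
  rintegrable mu setT (profile_density mup Q vb).
Proof.
move=> df Qi cy.
have m0 : measurable_fun setT (cst 0 : R -> R) by [].
have E : casimir mup Q f = casimir mup Q (fun x v => f x (v - cst 0 x)).
  by congr (casimir _ _ _); apply/funext => x; apply/funext => v; rewrite subr0.
move: cy; rewrite E (casimir_shear hmu hphi hQ df m0) => cy.
have [|||Hi _] := @phase_int_ge0_fin (sheared_integrand mup Q vb f (cst 0)).
- exact: (measurable_sheared hmu hphi hQ df m0).
- by move=> z; exact: (sheared_integrand_ge0 hphi hQ _ _ df).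
- exact: cy.
have t1 := @tbounded_cst 1.
have [||Pi _] := @phase_lincomb
  [:: (1, fun z => Q (f z.1 z.2)); (2^-1, fun z => f z.1 z.2 * (z.2 - vb) ^+ 2 * 1);
      (-1, sheared_integrand mup Q vb f (cst 0))]
  (fun z => profile_density mup Q vb z.2).
- by do !split => //; exact: (@phase_moment2 f (cst 1)).
- by move=> z _ /=; rewrite /sheared_integrand /= !addr0; ring.
have [_ _ [N [mN N0 sN]]] := phase_fubini Pi.
apply: contrapT => ni.
have sub : @torus R `<=` N by move=> x xT; apply: sN => /= /(_ xT).
have : (mu (@torus R) <= mu N)%E.
  by apply: le_measure => //; rewrite inE //; exact: measurable_torus.
rewrite N0 /torus lebesgue_measure_itv /= lte_fin ltr01 -EFinB subr0 lee_fin.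
by rewrite leNgt ltr01.
Qed.

End profile_integrability.

Section solution_densities.

Variables (phi Q : R -> R).
Hypothesis hQ : admissible phi Q.
Variables (eps : R) (f0 : R -> R -> R) (f : R -> R -> R -> R) (V : R -> R -> R).
Hypotheses (eps_gt0 : 0 < eps) (hini : initial_datum eps f0 (V 0))
  (hsol : strong_solution eps f0 f V).

Let Q2_trunc (k : nat) (s : R) : R := Q s ^+ 2 / Num.max s k.+1%:R^-1.

Let Q2_trunc_continuous k : {within `[0, +oo[%classic, continuous (Q2_trunc k)}.
Proof.
have cQ := admissible_continuous hQ.
have c1 : {within `[0, +oo[%classic, continuous (fun s => Q s * Q s)}.
  by move=> x; apply: (@continuousM _ _ (Q : subspace _ -> R) Q); exact: cQ.
have c2 : {within `[0, +oo[%classic, continuous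
    (fun s : R => (Num.max s k.+1%:R^-1)^-1)}.
  apply: continuous_subspaceT => s; apply: (@continuousV _ _ (fun s : R => Num.max s k.+1%:R^-1)).
    by rewrite gt_eqF// lt_max invr_gt0 ltr0n orbT.
  exact: (@continuous_maxr id (cst _) (@continuous_idr) (@continuous_cstr _)).
by move=> x; apply: (@continuousM _ _ ((fun s => Q s * Q s) : subspace _ -> R));
  [exact: c1|exact: c2].
Qed.

Let Q2_trunc_le k s : 0 <= s -> 0 <= Q2_trunc k s <= Q s ^+ 2 / s.
Proof.
rewrite /Q2_trunc le_eqVlt => /predU1P[<-|s0].
  by rewrite (admissible0 hQ) expr0n mul0r invr0 mulr0 lexx.
have m0 : 0 < Num.max s k.+1%:R^-1 by rewrite lt_max s0.
rewrite divr_ge0 ?sqr_ge0 ?(ltW m0)//= ler_wpM2l ?sqr_ge0//.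
by rewrite lef_pV2 ?posrE// le_max lexx.
Qed.

Let Q2_trunc_cvg s : 0 <= s -> Q2_trunc k s @[k --> \oo] --> Q s ^+ 2 / s.
Proof.
rewrite /Q2_trunc le_eqVlt => /predU1P[<-|s0].
  rewrite (admissible0 hQ) expr0n mul0r; under eq_fun do rewrite mul0r.
  exact: cvg_cst.
apply: cvg_near_cst; near=> k; congr (_ / _); apply: max_l.
rewrite ltW//; near: k; have := @cvg_harmonic R => /cvgrPdist_lt /(_ _ s0).
by apply: filterS => k; rewrite sub0r normrN ger0_norm ?harmonic_ge0.
Unshelve. all: by end_near. Qed.

Lemma measurable_square_ratio (h : R * R -> R) : measurable_fun setT h ->
  (forall z, 0 <= h z) -> measurable_fun setT (fun z => Q (h z) ^+ 2 / h z).
Proof.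
move=> mh h0.
apply: (@measurable_fun_cvg _ _ _ _ (fun k z => Q2_trunc k (h z))) => //.
  by move=> k; exact: (measurable_continuous_comp (@Q2_trunc_continuous k) mh).
by move=> z _; exact: Q2_trunc_cvg.
Qed.

(** The quotient Q^2 / s need not be continuous at 0, so that only its
    truncations are conserved; Fatou's lemma keeps one inequality. *)
Lemma solution_Q2 (t : R) : 0 <= t ->
  iph (fun z => Q (f0 z.1 z.2) ^+ 2 / f0 z.1 z.2) ->
  iph (fun z => Q (f t z.1 z.2) ^+ 2 / f t z.1 z.2) /\
  Iph (fun z => Q (f t z.1 z.2) ^+ 2 / f t z.1 z.2) <=
  Iph (fun z => Q (f0 z.1 z.2) ^+ 2 / f0 z.1 z.2).
Proof.
move=> t0 Q2i; have dt := solution_density hini hsol t0.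
have f00 z : 0 <= f0 z.1 z.2 by exact: (initial_ge0 hini).
have ft0 z : 0 <= f t z.1 z.2 by exact: (density_ge0 dt).
have mtr k : measurable_fun setT (fun z => Q2_trunc k (f t z.1 z.2)).
  exact: (measurable_continuous_comp (@Q2_trunc_continuous k) (density_measurable dt)).
have m0r k : measurable_fun setT (fun z => Q2_trunc k (f0 z.1 z.2)).
  exact: (measurable_continuous_comp (@Q2_trunc_continuous k) (initial_measurable hini)).
have tr0 k : iph (fun z => Q2_trunc k (f0 z.1 z.2)).
  apply: (@phase_le_rintegrable _ _ _ Q2i).
    exact: measurable_funTS (m0r k).
  by move=> z _; have /andP[? ?] := Q2_trunc_le k (f00 z); rewrite ger0_norm.
have le0 k : (\int[mu2]_(z in @phase R) (Q2_trunc k (f t z.1 z.2))%:E <=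
    (Iph (fun z => Q (f0 z.1 z.2) ^+ 2 / f0 z.1 z.2))%:E)%E.
  have [ti tE] := solution_casimir hsol t0 (@Q2_trunc_continuous k) (tr0 k).
  rewrite (@phase_rintegrable_fineK _ ti) tE lee_fin.
  apply: (@le_Rintegral _ _ _ mu2);
    [exact: measurable_phase|exact: tr0|exact: Q2i|move=> z _].
  by have /andP[] := Q2_trunc_le k (f00 z).
have mlim : measurable_fun setT (fun z => Q (f t z.1 z.2) ^+ 2 / f t z.1 z.2).
  exact: measurable_square_ratio (density_measurable dt) ft0.
have le1 : (\int[mu2]_(z in @phase R) (Q (f t z.1 z.2) ^+ 2 / f t z.1 z.2)%:E <=
    (Iph (fun z => Q (f0 z.1 z.2) ^+ 2 / f0 z.1 z.2))%:E)%E.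
  have := @fatou _ _ _ mu2 (@phase R) measurable_phase
    (fun k z => (Q2_trunc k (f t z.1 z.2))%:E).
  have -> : (fun z => limn_einf (fun k => (Q2_trunc k (f t z.1 z.2))%:E)) =
      (fun z => (Q (f t z.1 z.2) ^+ 2 / f t z.1 z.2)%:E).
    apply/funext => z.
    have Hz : (Q2_trunc k (f t z.1 z.2))%:E @[k --> \oo] -->
        (Q (f t z.1 z.2) ^+ 2 / f t z.1 z.2)%:E.
      by apply: cvg_EFin; [exact: nearW|exact: Q2_trunc_cvg].
    rewrite is_cvg_limn_einfE; first exact: cvg_lim Hz.
    by apply/cvg_ex; exists (Q (f t z.1 z.2) ^+ 2 / f t z.1 z.2)%:E.
  move=> H; apply: (le_trans (H _ _)).
  - by move=> k; apply/measurable_EFinP; exact: measurable_funTS (mtr k).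
  - by move=> k z _; rewrite lee_fin; have /andP[] := Q2_trunc_le k (ft0 z).
  - rewrite limn_einf_lim; apply: lime_le; first exact: is_cvg_einfs.
    apply: nearW => n; apply: le_trans (le0 n).
    by apply: ereal_inf_lbound; exists n => /=.
have [||Hi HE] := @phase_int_ge0_fin _ mlim.
- by move=> z; rewrite divr_ge0 ?sqr_ge0.
- by rewrite (le_lt_trans le1) ?ltry.
by split => //; rewrite -lee_fin -HE.
Qed.

End solution_densities.

(** * Bounds by the energy and the entropy *)

Section energy_bounds.

Variables (eps vb En : R) (f : R -> R -> R) (V : R -> R).
Hypotheses (eps_gt0 : 0 < eps) (df : density f) (pV : poisson eps f V).
Hypothesis mass1 : Iph (fun z => f z.1 z.2) = 1.
Notation E := (derive1 V).
Hypothesis energy1 : 2^-1 * Iph (fun z => f z.1 z.2 * z.2 ^+ 2)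
  + eps ^+ 2 / 2 * Jt (fun x => E x ^+ 2) = En.

Let tbE : tbounded E := field_tbounded eps_gt0 df pV.

Let moment_ge0 : 0 <= Iph (fun z => f z.1 z.2 * z.2 ^+ 2).
Proof. by apply: Rintegral_ge0 => z _; rewrite mulr_ge0 ?sqr_ge0// (density_ge0 df). Qed.

Let field_ge0 : 0 <= eps ^+ 2 * Jt (fun x => E x ^+ 2).
Proof.
by rewrite mulr_ge0 ?sqr_ge0//; apply: Rintegral_ge0 => x _; exact: sqr_ge0.
Qed.

Lemma moment_le : Iph (fun z => f z.1 z.2 * z.2 ^+ 2) <= 2 * En.
Proof. by move: field_ge0; rewrite -energy1; lra. Qed.

Lemma field_le : eps ^+ 2 * Jt (fun x => E x ^+ 2) <= 2 * En.
Proof. by move: moment_ge0; rewrite -energy1; lra. Qed.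

Lemma energy_ge0 : 0 <= En.
Proof. by move: moment_ge0 moment_le; lra. Qed.

Section weights.
Variables (p : R -> R) (N : R).
Hypotheses (cp : continuous p) (pN : forall x, `|p x| <= N).

Let N_ge0 : 0 <= N. Proof. exact: le_trans (normr_ge0 _) (pN 0). Qed.

Let mp : measurable_fun (@phase R) (fun z => p z.1).
Proof. by apply: measurable_phase_fst; apply: measurable_funTS; exact: continuous_measurableT. Qed.

Let f0 (z : R * R) : 0 <= f z.1 z.2. Proof. exact: (density_ge0 df). Qed.

Let affine_weight (A B : R) : iph (fun z => f z.1 z.2 * (A + B * z.2 ^+ 2)) /\
  Iph (fun z => f z.1 z.2 * (A + B * z.2 ^+ 2)) =
  A + B * Iph (fun z => f z.1 z.2 * z.2 ^+ 2).
Proof.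
have [||Hi ->] := @phase_lincomb
  [:: (A, fun z => f z.1 z.2); (B, fun z => f z.1 z.2 * z.2 ^+ 2)]
  (fun z => f z.1 z.2 * (A + B * z.2 ^+ 2)).
- by split; [exact: density_integrable|split => //; exact: density_moment2].
- by move=> z _ /=; ring.
by rewrite /= mass1 mulr1 addr0.
Qed.

Let tp : tbounded p := tbounded_continuous cp.

Lemma moment2_bound : `|Iph (fun z => f z.1 z.2 * (z.2 - vb) ^+ 2 * p z.1)| <=
  N * (4 * En + 2 * vb ^+ 2).
Proof.
have mi := phase_moment2 vb df tp.
have [ai aE] := affine_weight (N * (2 * vb ^+ 2)) (N * 2).
apply: le_trans (@phase_le_Rintegral_norm _ _
  (rintegrable_measurable mi) ai _) _.
  move=> z _; rewrite -mulrA normrM (ger0_norm (f0 z)) ler_wpM2l//.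
  rewrite normrM ger0_norm ?sqr_ge0// mulrC.
  have h : (z.2 - vb) ^+ 2 <= 2 * vb ^+ 2 + 2 * z.2 ^+ 2.
    by have := sqr_ge0 (z.2 + vb); nra.
  rewrite -mulrA -mulrDr ler_pM// ?sqr_ge0//.
rewrite aE; have := ler_wpM2l N_ge0 moment_le; lra.
Qed.

Lemma moment1_bound : `|Iph (fun z => f z.1 z.2 * (z.2 - vb) * p z.1)| <=
  N * (1 / 2 + 2 * En + vb ^+ 2).
Proof.
have mi := phase_moment1 vb df tp.
have [ai aE] := affine_weight (N * (1 / 2 + vb ^+ 2)) N.
apply: le_trans (@phase_le_Rintegral_norm _ _
  (rintegrable_measurable mi) ai _) _.
  move=> z _; rewrite -mulrA normrM (ger0_norm (f0 z)) ler_wpM2l//.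
  rewrite normrM mulrC.
  have h : `|z.2 - vb| <= 1 / 2 + vb ^+ 2 + z.2 ^+ 2.
    have vv : `|z.2 - vb| ^+ 2 = (z.2 - vb) ^+ 2 by rewrite real_normK ?num_real.
    have := sqr_ge0 (`|z.2 - vb| - 1); have := sqr_ge0 (z.2 + vb).
    by move: vv; set u := `|_|; nra.
  by rewrite -mulrDr ler_pM.
rewrite aE; have := ler_wpM2l N_ge0 moment_le; lra.
Qed.

Lemma field1_bound : eps * `|Jt (fun x => E x * p x)| <= N * (1 / 2 + En).
Proof.
have Ei : rintegrable mu (@torus R) (fun x => eps * (E x * p x)).
  apply: (@torus_rintegrableZ).
  exact: tbounded_integrable (tboundedM tbE tp).
have E2i : rintegrable mu (@torus R) (fun x => E x ^+ 2).
  exact: tbounded_integrable (tboundedM tbE tbE).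
have oi : rintegrable mu (@torus R) (fun=> 1).
  exact: tbounded_integrable (tbounded_cst 1).
have [||Hi HE] := @torus_lincomb
  [:: (N / 2, fun=> 1); (N / 2 * eps ^+ 2, fun x => E x ^+ 2)]
  (fun x => N / 2 * (1 + eps ^+ 2 * E x ^+ 2)).
- by do !split.
- by move=> z _ /=; ring.
have -> : eps * `|Jt (fun x => E x * p x)| = `|Jt (fun x => eps * (E x * p x))|.
  rewrite (@RintegralZl _ _ _ mu) ?normrM ?(gtr0_norm eps_gt0)//.
    exact: measurable_torus.
  exact: tbounded_integrable (tboundedM tbE tp).
apply: le_trans (@torus_le_Rintegral_norm _ _
  (rintegrable_measurable Ei) Hi _) _.
  move=> x _; rewrite mulrA normrM mulrC [leRHS]mulrAC -mulrA ler_pM//.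
  have vv : `|eps * E x| ^+ 2 = eps ^+ 2 * E x ^+ 2.
    by rewrite real_normK ?num_real// exprMn.
  have := sqr_ge0 (`|eps * E x| - 1).
  by rewrite -vv; set u := `|_|; nra.
rewrite HE /= torus_int1; have := ler_wpM2l N_ge0 field_le; lra.
Qed.

Lemma field2_bound : eps ^+ 2 * `|Jt (fun x => E x ^+ 2 * p x)| <= N * (2 * En).
Proof.
have E2 := tboundedM tbE tbE.
have E2i : rintegrable mu (@torus R) (fun x => E x ^+ 2) by exact: tbounded_integrable E2.
have mi : rintegrable mu (@torus R) (fun x => E x ^+ 2 * p x).
  exact: tbounded_integrable (tboundedM E2 tp).
have Hi := @torus_rintegrableZ N _ E2i.
have := @torus_le_Rintegral_norm _ _
  (rintegrable_measurable mi) Hi.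
move=> /(_ _)/Wrap[].
  by move=> x _; rewrite normrM ger0_norm ?sqr_ge0// mulrC ler_wpM2r ?sqr_ge0.
rewrite (@RintegralZl _ _ _ mu)//; last exact: measurable_torus.
move=> /(ler_wpM2l (sqr_ge0 eps)) h; apply: (le_trans h).
by rewrite mulrCA ler_wpM2l// field_le.
Qed.

Variables (Q : R -> R) (C : R) (b : R * R -> R).
Hypotheses (C_ge0 : 0 <= C) (mb : measurable_fun setT b)
  (bQ : forall z, `|b z| <= `|Q (f z.1 z.2)| + C * f z.1 z.2)
  (Q0 : Q 0 = 0) (Qi : iph (fun z => Q (f z.1 z.2)))
  (Q2i : iph (fun z => Q (f z.1 z.2) ^+ 2 / f z.1 z.2)).

Lemma entropy_bound : iph b /\ `|Iph (fun z => b z * p z.1)| <=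
  N * (Iph (fun z => `|Q (f z.1 z.2)|) + C).
Proof.
have Qn := rintegrable_norm Qi.
have [||Hi HE] := @phase_lincomb
  [:: (1, fun z => `|Q (f z.1 z.2)|); (C, fun z => f z.1 z.2)]
  (fun z => `|Q (f z.1 z.2)| + C * f z.1 z.2).
- by do !split => //; exact: density_integrable.
- by move=> z _ /=; ring.
split.
  by apply: (@phase_le_rintegrable _ _ _ Hi) => //;
    exact: measurable_funTS.
apply: le_trans (@phase_le_Rintegral_norm _
  (fun z => N * (`|Q (f z.1 z.2)| + C * f z.1 z.2)) _ _ _) _.
- by apply: measurable_funM => //; exact: measurable_funTS.
- exact: (@phase_rintegrableZ).
- by move=> z _; rewrite normrM mulrC ler_pM.
rewrite (@RintegralZl _ _ _ mu2)//; last exact: measurable_phase.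
by rewrite HE /= mass1; lra.
Qed.

(** |w Q(f)| <= (w^2 f + Q(f)^2 / f) / 2. *)
Lemma entropy_moment_bound : iph (fun z => b z * (z.2 - vb) * p z.1) /\
  `|Iph (fun z => b z * (z.2 - vb) * p z.1)| <=
  N * (2 * En + vb ^+ 2 + Iph (fun z => Q (f z.1 z.2) ^+ 2 / f z.1 z.2) / 2
       + C * (1 / 2 + 2 * En + vb ^+ 2)).
Proof.
pose X := Iph (fun z => Q (f z.1 z.2) ^+ 2 / f z.1 z.2).
have [ai aE] := affine_weight (N * (vb ^+ 2 + C * (1 / 2 + vb ^+ 2))) (N * (1 + C)).
have [||Hi HE] := @phase_lincomb
  [:: (1, fun z => f z.1 z.2 * (N * (vb ^+ 2 + C * (1 / 2 + vb ^+ 2)) + N * (1 + C) * z.2 ^+ 2));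
      (N / 2, fun z => Q (f z.1 z.2) ^+ 2 / f z.1 z.2)]
  (fun z => N * (f z.1 z.2 * (vb ^+ 2 + z.2 ^+ 2)
     + Q (f z.1 z.2) ^+ 2 / f z.1 z.2 / 2
     + C * (f z.1 z.2 * (1 / 2 + vb ^+ 2 + z.2 ^+ 2)))).
- by do !split.
- by move=> z _ /=; set Y := _ / f z.1 z.2; field.
have mbw : measurable_fun (@phase R) (fun z => b z * (z.2 - vb) * p z.1).
  apply: measurable_funM => //; apply: measurable_funTS; apply: measurable_funM => //.
  by apply: measurable_funB => //; exact: measurable_snd.
have le z : @phase R z -> `|b z * (z.2 - vb) * p z.1| <=
    N * (f z.1 z.2 * (vb ^+ 2 + z.2 ^+ 2)
     + Q (f z.1 z.2) ^+ 2 / f z.1 z.2 / 2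
     + C * (f z.1 z.2 * (1 / 2 + vb ^+ 2 + z.2 ^+ 2))).
  move=> _; rewrite normrM mulrC ler_pM// normrM.
  have fz := f0 z; have bz := bQ z.
  set F := f z.1 z.2 in fz bz *; set w := `|z.2 - vb|.
  have w0 : 0 <= w by exact: normr_ge0.
  have ww : w ^+ 2 = (z.2 - vb) ^+ 2 by rewrite real_normK ?num_real.
  have w2 : w ^+ 2 <= 2 * (vb ^+ 2 + z.2 ^+ 2).
    by rewrite ww; have := sqr_ge0 (z.2 + vb); nra.
  have w1 : w <= 1 / 2 + vb ^+ 2 + z.2 ^+ 2.
    by have := sqr_ge0 (w - 1); nra.
  have T1 : `|Q F| * w <= F * (vb ^+ 2 + z.2 ^+ 2) + Q F ^+ 2 / F / 2.
    have [F0|F0] := eqVneq F 0.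
      by rewrite F0 Q0 normr0 !mul0r expr0n /= mul0r mul0r addr0.
    have Fp : 0 < F by rewrite lt_def F0.
    have QQ : Q F ^+ 2 = `|Q F| ^+ 2 by rewrite real_normK ?num_real.
    rewrite QQ; set r := `|Q F|.
    have : 0 <= (r - F * w) ^+ 2 / F by rewrite divr_ge0 ?sqr_ge0.
    have -> : (r - F * w) ^+ 2 / F = r ^+ 2 / F - 2 * (r * w) + F * w ^+ 2 by field.
    have := ler_wpM2l fz w2; lra.
  have T2 := ler_wpM2l fz w1; have T3 := ler_wpM2l C_ge0 T2.
  have := ler_wpM2r w0 bz; rewrite mulrDl -[C * F * w]mulrA; lra.
split.
  exact: (@phase_le_rintegrable _ _ mbw Hi le).
apply: le_trans (@phase_le_Rintegral_norm _ _ mbw Hi le) _.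
rewrite HE /= aE -/X mul1r addr0.
have NC : 0 <= N * (1 + C) by rewrite mulr_ge0// addr_ge0.
have := ler_wpM2l NC moment_le; lra.
Qed.

End weights.
End energy_bounds.

(** * Growth of the modulated free energy *)

Section rate_arithmetic.

Lemma rate_budget (En X1 X2 C v NY NZ La t3 t4 t5 t7 : R) :
  0 <= En -> 0 <= X1 -> 0 <= X2 -> 0 <= C -> 0 <= v -> 0 <= NY -> 0 <= NZ -> 0 <= La ->
  t3 <= NY * (1 / 2 + En) -> t4 <= NZ * (2 * En) -> t5 <= NZ * (4 * En + 2 * v) ->
  t7 <= La * (2 * En + v + X2 / 2 + C * (1 / 2 + 2 * En + v)) ->
  t3 + t4 / 2 + t5 + 2 * t7 <=
  (NY + NZ * (5 + 2 * v) + 2 * La * ((2 + v) * (1 + C))) * (1 + En + (X1 + X2)).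
Proof.
move=> En0 X10 X20 C0 v0 NY0 NZ0 La0 T3 T4 T5 T7.
have S0 : 0 <= En + (X1 + X2) by rewrite !addr_ge0.
have G1 : 1 / 2 + En <= 1 + En + (X1 + X2) by clear -X10 X20; lra.
have G2 : 5 * En + 2 * v <= (5 + 2 * v) * (1 + En + (X1 + X2)).
  by have := mulr_ge0 v0 S0; clear -X10 X20; lra.
have G3 : 2 * En + v + X2 / 2 + C * (1 / 2 + 2 * En + v) <=
    (2 + v) * (1 + C) * (1 + En + (X1 + X2)).
  have := mulr_ge0 v0 S0; have := mulr_ge0 C0 (mulr_ge0 v0 S0).
  have := mulr_ge0 C0 X10; have := mulr_ge0 C0 X20.
  by clear -En0 X10 X20 C0; lra.
have := ler_wpM2l NY0 G1; have := ler_wpM2l NZ0 G2; have := ler_wpM2l La0 G3.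
by clear -T3 T4 T5 T7; lra.
Qed.

Lemma rate_collect (eps s c lam cas fld delta Mm F2 JY JZ IZ IQ Id Iw B : R) :
  0 <= eps -> 0 <= lam * fld ->
  s * (2 * IQ + Mm) <= 2 * lam * cas -> - s * F2 <= 2 * lam * fld ->
  - s * Id <= lam * delta ->
  - s ^+ 3 * (eps * JY) + s * c * (eps ^+ 2 * JZ) / 2 + - (s * c) * IZ
    + 2 * (- c * Iw) <= B ->
  s * Mm - s / 2 * F2 - s ^+ 3 * eps ^+ 2 * JY + eps ^+ 3 / 2 * s * c * JZ
    - eps * s * c * IZ + (s * (2 * IQ) - 2 * s * Id - 2 * eps * c * Iw)
  <= 2 * lam * (cas + fld + delta) + eps * B.
Proof. by move=> e0 lf T1 T2 T6 /(ler_wpM2l e0); clear -lf T1 T2 T6; lra. Qed.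

End rate_arithmetic.

Section main_estimate.

Variables (mup phi Q : R -> R) (vb : R).
Hypotheses (hmu : S_stable mup vb) (hphi : profile_function mup vb phi)
  (hQ : admissible phi Q).
Variables (eps : R) (f0 : R -> R -> R) (f : R -> R -> R -> R) (V : R -> R -> R).
Hypotheses (eps_gt0 : 0 < eps) (hini : initial_datum eps f0 (V 0))
  (hsol : strong_solution eps f0 f V).
Hypotheses (Qi0 : iph (fun z => Q (f0 z.1 z.2)))
  (Q2i0 : iph (fun z => Q (f0 z.1 z.2) ^+ 2 / f0 z.1 z.2))
  (pd_int : rintegrable mu setT (profile_density mup Q vb)).

Variables (u W W1 W2 : R -> R) (lam La : R).
Hypotheses (pu : periodic1 u) (pW : periodic1 W) (pW1 : periodic1 W1) (pW2 : periodic1 W2)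
  (du : forall x, is_derive x (1 : R) u (W x))
  (dW : forall x, is_derive x (1 : R) W (W1 x))
  (dW1 : forall x, is_derive x (1 : R) W1 (W2 x))
  (cW2 : continuous W2) (u0 : Jt u = 0).
Hypotheses (W_le : forall x, `|W x| <= lam) (W1_le : forall x, `|W1 x| <= lam)
  (W2_le : forall x, `|W2 x| <= La).

Let cu : continuous u := is_derive_continuous du.
Let cW : continuous W := is_derive_continuous dW.
Let cW1 : continuous W1 := is_derive_continuous dW1.

Let wave (h : R -> R) (t x : R) : R := h (x - vb * t).
Let sn (t : R) : R := sin (t / eps).
Let cs (t : R) : R := cos (t / eps).

Let wave_continuous h t : continuous h -> continuous (wave h t).
Proof.
move=> ch; apply: (@continuous_compr (fun x => x - vb * t) h _ ch).
by apply: continuous_subr; [exact: continuous_idr|exact: continuous_cstr].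
Qed.

Let wave_measurable h t : continuous h -> measurable_fun (@torus R) (wave h t).
Proof. by move=> ch; exact: (tbounded_continuous (@wave_continuous h t ch)).1. Qed.

Let wave_derive h h' t : (forall x, is_derive x (1 : R) h (h' x)) ->
  forall x, is_derive x (1 : R) (wave h t) (wave h' t x).
Proof.
move=> dh x; have := @is_derive_compr h (fun x => x - vb * t) x _ _
  (dh (x - vb * t)) (is_derive_shiftr _ _).
by rewrite mulr1.
Qed.

Let wave_periodic h t : periodic1 h -> periodic1 (wave h t).
Proof. by move=> ph x; rewrite /wave addrAC ph. Qed.

Let wave_int t : Jt (wave u t) = 0.
Proof. by rewrite /wave torus_int_shift. Qed.

Let df (t : R) (t0 : 0 <= t) : density (f t) := solution_density hini hsol t0.
Let mass (t : R) (t0 : 0 <= t) : Iph (fun z => f t z.1 z.2) = 1 :=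
  (solution_mass hini hsol t0).2.
Let pV (t : R) (t0 : 0 <= t) : poisson eps (f t) (V t) := solution_poisson hsol t0.
Let En : R := fine (energy eps f0 (V 0)).
Let energyt (t : R) (t0 : 0 <= t) := solution_energy eps_gt0 hini hsol t0.

Let m : R := \int[mu]_v profile_density mup Q vb v.

Let cas (t : R) : R := Iph (fun z => Q (f t z.1 z.2)) +
  2^-1 * Iph (fun z => f t z.1 z.2 * (z.2 - vb + sn t * wave W t z.1) ^+ 2) - m.
Let fld (t : R) : R :=
  2^-1 * Jt (fun x => (eps * derive1 (V t) x - cs t * wave W t x) ^+ 2).

Definition free_energy (t : R) : R := cas t + fld t.

Let Qi (t : R) (t0 : 0 <= t) : iph (fun z => Q (f t z.1 z.2)) :=
  (solution_casimir hsol t0 (admissible_continuous hQ) Qi0).1.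

Let casE (t : R) : 0 <= t ->
  casimir mup Q (fun x v => f t x (v - sn t * wave W t x)) = (cas t)%:E.
Proof.
move=> t0; apply: (@casimir_value _ _ _ _ hmu hphi hQ pd_int _ (fun x => sn t * wave W t x)).
- exact: df.
- exact: Qi.
- by apply: continuous_mulr; [exact: continuous_cstr|exact: wave_continuous].
Qed.

Lemma modulated_free_energyE (V0 : R -> R) (t : R) : 0 <= t -> derive1 V0 = W ->
  modulated_free_energy mup Q vb V0 eps f V t = (free_energy t)%:E.
Proof.
move=> t0 VW; rewrite /modulated_free_energy VW EFinD; congr (_ + _)%E.
  rewrite -casE//; congr (casimir _ _ _); apply/funext => x; apply/funext => v.
  by rewrite mulrC.
rewrite /fld EFinM; congr (_ * _)%E; rewrite /torus_int.
have c1 := @continuous_cstr 1.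
have [Hi _] := j_square eps_gt0 (df t0) (pV t0) (wave_derive t dW) (cs t) c1.
rewrite -(@torus_rintegrable_fineK).
  by apply: eq_integral => x _; congr (_ ^+ 2)%:E; rewrite mulrC [_ * cos _]mulrC.
by apply: (@torus_eq_rintegrable _ _ _ Hi) => x _; rewrite mulr1.
Qed.

Let entropy_gap (bet : R -> R) : R :=
  Iph (fun z => `|Q (f0 z.1 z.2) - bet (f0 z.1 z.2)|).
Let X1 : R := Iph (fun z => `|Q (f0 z.1 z.2)|).
Let X2 : R := Iph (fun z => Q (f0 z.1 z.2) ^+ 2 / f0 z.1 z.2).
Let A : R := 1 + En + (X1 + X2).

(** Composing a weak solution with Q is not possible, its derivative being
    unbounded near 0; bet stands for a C^1 approximant. *)
Section entropy_approximant.
Variables (bet bet' : R -> R) (C : R).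
Hypotheses (C_ge0 : 0 <= C) (bet0 : bet 0 = 0)
  (dbet : forall s, is_derive s (1 : R) bet (bet' s)) (cbet' : continuous bet')
  (bbet' : exists D : R, forall s, `|bet' s| <= D)
  (bet_le : forall s, 0 <= s -> `|bet s| <= `|Q s| + C * s).

Let delta : R := entropy_gap bet.

Let cbet : continuous bet := is_derive_continuous dbet.

Let f_ge0 (t : R) x v : 0 <= t -> 0 <= f t x v.
Proof. by move=> t0; exact: (density_ge0 (df t0)). Qed.

Let mbet (t : R) : 0 <= t -> measurable_fun setT (fun z : R * R => bet (f t z.1 z.2)).
Proof.
move=> t0; apply: (measurableT_comp (continuous_measurableT cbet)).
exact: density_measurable (df t0).
Qed.

Let X1t (t : R) : 0 <= t -> Iph (fun z => `|Q (f t z.1 z.2)|) = X1.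
Proof.
move=> t0; apply: (solution_casimir hsol t0 (within_continuous_norm (admissible_continuous hQ)) _).2.
exact: rintegrable_norm.
Qed.

Let deltat (t : R) : 0 <= t ->
  iph (fun z => `|Q (f t z.1 z.2) - bet (f t z.1 z.2)|) /\
  Iph (fun z => `|Q (f t z.1 z.2) - bet (f t z.1 z.2)|) = delta.
Proof.
move=> t0.
have cG : {within `[0, +oo[%classic, continuous (fun s => `|Q s - bet s|)}.
  apply: within_continuous_norm => x.
  apply: (@continuousB _ _ _ (Q : subspace _ -> R) bet).
    exact: (admissible_continuous hQ).
  by apply: continuous_subspaceT; exact: cbet.
apply: (solution_casimir hsol t0 cG); apply: rintegrable_norm.
apply: (@phase_rintegrableB) => //.
rewrite -(strong_initial hsol).
have c0 := @continuous_cstr 0.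
have p0 (x : R) : `|0 : R| <= 1 by rewrite normr0.
have b_le z : `|bet (f 0 z.1 z.2)| <= `|Q (f 0 z.1 z.2)| + C * f 0 z.1 z.2.
  by apply: bet_le; exact: f_ge0.
exact: (entropy_bound (df (lexx 0)) (mass (lexx 0)) c0 p0 (mbet (lexx 0))
  b_le (Qi (lexx 0))).1.
Qed.

Let Cst : R := Iph (fun z => Q (f0 z.1 z.2)) - m + En + vb ^+ 2 / 2.

Let weight1 t := momentum_weight eps vb (wave u t) (wave W t) (wave W1 t) (sn t) (cs t).
(** The production of free energy contains the integral of Q(f) against
    2 sn W1, of order 1 but oscillating; this weight of size eps is a primitive
    of it in time along straight lines of speed vb. The price is the last term
    of [rate2], with W2 and the first moment of Q(f) in v. *)
Let weight2 (t : R) (z : R * R) : R := - 2 * eps * (cs t * wave W1 t z.1).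

(** The modulated free energy up to terms of size eps, as a constant plus
    functionals that are linear in f and in bet f. *)
Definition corrected_energy (t : R) : R := Cst + Iph (fun z => f t z.1 z.2 * weight1 t z)
  + Iph (fun z => bet (f t z.1 z.2) * weight2 t z).

Let rate1 t := transported eps vb (V t) (wave u t) (wave W t) (wave W1 t) (wave W2 t)
  (sn t) (cs t).
Let rate2 (t : R) (z : R * R) : R :=
  2 * sn t * wave W1 t z.1 - 2 * eps * cs t * ((z.2 - vb) * wave W2 t z.1).

Definition energy_rate (t : R) : R := Iph (fun z => f t z.1 z.2 * rate1 t z)
  + Iph (fun z => bet (f t z.1 z.2) * rate2 t z).

Let lam_ge0 : 0 <= lam. Proof. exact: le_trans (normr_ge0 _) (W_le 0). Qed.
Let La_ge0 : 0 <= La. Proof. exact: le_trans (normr_ge0 _) (W2_le 0). Qed.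

Let cs_sn t : cs t ^+ 2 + sn t ^+ 2 = 1.
Proof. exact: cos2Dsin2. Qed.

Let d_scale t : is_derive t (1 : R) (fun t => t / eps) (eps^-1).
Proof.
have -> : (fun t : R => t / eps) = (fun t => eps^-1 * t).
  by apply/funext => r; rewrite mulrC.
exact: is_derive_scale.
Qed.

Let coef_osc (h h' : R -> R) : (forall s, is_derive s (1 : R) h (h' s)) ->
  continuous h' -> (forall s, `|h s| <= 1) -> (forall s, `|h' s| <= 1) ->
  coefficient (fun t _ => h (t / eps)) (fun t _ => h' (t / eps) * eps^-1)
    (fun _ _ => 0).
Proof.
move=> dh ch' h1 h1'.
apply: (@coefficient_time (fun t => h (t / eps)) (fun t => h' (t / eps) * eps^-1)).
- by move=> t; exact: (@is_derive_compr h (fun t => t / eps) t _ _ (dh _) (d_scale t)).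
- apply: continuous_mulr; last exact: continuous_cstr.
  apply: (@continuous_compr (fun t => t / eps) h' _ ch').
  by apply: continuous_mulr; [exact: continuous_idr|exact: continuous_cstr].
- exists (1 + `|eps^-1|) => t; split.
    by rewrite (le_trans (h1 _))// lerDl.
  by rewrite normrM (le_trans (_ : _ <= 1 * `|eps^-1|)) ?ler_wpM2r// mul1r lerDr ?ler01.
Qed.

Let sin_le (s : R) : `|sin s| <= 1. Proof. by rewrite ler_norml sin_geN1 sin_le1. Qed.
Let cos_le (s : R) : `|cos s| <= 1. Proof. by rewrite ler_norml cos_geN1 cos_le1. Qed.

Let coef_sn := coef_osc (@is_derive_sin R) (@continuous_cos R) sin_le cos_le.
Let coef_cs := coef_osc (@is_derive_cos R) (continuous_oppr (@continuous_sin R)) cos_le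
  (fun s => eq_ind_r (fun y => y <= 1) (sin_le s) (normrN (sin s))).

Let coef_u := coefficient_wave vb pu du cW pW.
Let coef_W := coefficient_wave vb pW dW cW1 pW1.
Let coef_W1 := coefficient_wave vb pW1 dW1 cW2 pW2.

Let coef_b := coefficientD (coefficient_cst (- vb))
  (coefficientD (coefficientM coef_sn coef_W)
     (coefficientZ (- eps) (coefficientM (coefficientM coef_sn coef_cs)
        (coefficientM coef_W coef_W1)))).

Let coef_a := coefficientD (coefficientZ (- vb) (coefficientM coef_sn coef_W))
  (coefficientD (coefficientZ (- eps^-1) (coefficientM coef_cs coef_u))
     (coefficientD (coefficientZ 2^-1 (coefficientM coef_W coef_W))
        (coefficientZ (vb * eps) (coefficientM (coefficientM coef_sn coef_cs)
           (coefficientM coef_W coef_W1))))).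

Let coef_r := coefficientZ (- 2 * eps) (coefficientM coef_cs coef_W1).

Let e0 : eps != 0. Proof. by rewrite gt_eqF. Qed.

Let moment_bound (t : R) : 0 <= t -> Iph (fun z => f t z.1 z.2 * z.2 ^+ 2) <= 2 * En.
Proof. by move=> t0; exact: (moment_le (energyt t0)). Qed.

(** The two functionals are differentiated by the transport equations of f and
    of bet f, with test functions affine in v. *)
Lemma corrected_energy_integral (t : R) : 0 <= t ->
  rintegrable mu `[0, t] energy_rate /\
  corrected_energy t = corrected_energy 0 + \int[mu]_(s in `[0, t]) energy_rate s.
Proof.
move=> t0.
have f_le (s x v : R) : 0 <= s -> `|f s x v| <= 1 * f s x v.
  by move=> s0; rewrite mul1r ger0_norm// f_ge0.
have L1f := solution_L1 hsol.
have [i1 E1] := vlasov_affine eps_gt0 df mass moment_bound pV L1f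
  (fun s s0 => density_measurable (df s0)) f_le L1f (strong_vlasov hsol)
  coef_a coef_b t0.
have [D hD] := bbet'.
have lipb (r s : R) : `|bet r - bet s| <= D * `|r - s|.
  exact: is_derive_lipschitz dbet hD s r.
have b_le (s x v : R) : 0 <= s -> `|bet (f s x v)| <= D * f s x v.
  move=> s0; have := lipb (f s x v) 0.
  by rewrite bet0 !subr0 (ger0_norm (f_ge0 x v s0)).
have L1b := L1_continuous_comp hini hsol lipb (continuous_measurableT cbet).
have chain : vlasov V (fun t x v => bet (f t x v)).
  apply: (strong_chain_rule hsol) => //.
  - have -> : derive1 bet = bet' by apply/funext => s; exact: is_deriveE.
    exact: cbet'.
  - by exists D => s; rewrite (is_deriveE (dbet s)).
have [i2 E2] := vlasov_affine eps_gt0 df mass moment_bound pV L1f mbet b_le L1b chain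
  coef_r (coefficient_cst 0) t0.
move: i1 E1 i2 E2; set T1 := transport_op _ _ _ _ _ _; set T2 := transport_op _ _ _ _ _ _.
have T1E s z : T1 s z = rate1 s z.
  have h : 2 * sn s ^+ 2 = 1 - cs s ^+ 2 + sn s ^+ 2 by have := cs_sn s; lra.
  rewrite /T1 /rate1 /transported h /transport_op /deriv_WW1 /wave /=.
  by rewrite -/(sn s) -/(cs s); field.
have T2E s z : T2 s z = rate2 s z.
  by rewrite /T2 /rate2 /transport_op /wave /= -/(sn s) -/(cs s); field.
have R1 : (fun s => Iph (fun z => f s z.1 z.2 * T1 s z)) =
    (fun s => Iph (fun z => f s z.1 z.2 * rate1 s z)).
  by apply/funext => s; apply: eq_Rintegral => z _; rewrite T1E.
have R2 : (fun s => Iph (fun z => bet (f s z.1 z.2) * T2 s z)) =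
    (fun s => Iph (fun z => bet (f s z.1 z.2) * rate2 s z)).
  by apply/funext => s; apply: eq_Rintegral => z _; rewrite T2E.
rewrite R1 R2 => i1 E1 i2 E2; split.
  by apply: (@rintegrableD _ _ _ mu _ (measurable_itv `[0, t]) _ _ i1 i2).
have -> : \int[mu]_(s in `[0, t]) energy_rate s =
    \int[mu]_(s in `[0, t]) Iph (fun z => f s z.1 z.2 * rate1 s z) +
    \int[mu]_(s in `[0, t]) Iph (fun z => bet (f s z.1 z.2) * rate2 s z).
  by apply: RintegralD => //; exact: measurable_itv.
have {E1} <- : Iph (fun z => f t z.1 z.2 * weight1 t z)
    - Iph (fun z => f 0 z.1 z.2 * weight1 0 z) =
    \int[mu]_(s in `[0, t]) Iph (fun z => f s z.1 z.2 * rate1 s z).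
  rewrite -E1; congr (_ - _); apply: eq_Rintegral => z _; congr (_ * _);
    by rewrite /weight1 /momentum_weight /wave /sn /cs /=; field.
have {E2} <- : Iph (fun z => bet (f t z.1 z.2) * weight2 t z)
    - Iph (fun z => bet (f 0 z.1 z.2) * weight2 0 z) =
    \int[mu]_(s in `[0, t]) Iph (fun z => bet (f s z.1 z.2) * rate2 s z).
  rewrite -E2; congr (_ - _); apply: eq_Rintegral => z _; congr (_ * _);
    by rewrite /weight2 /wave /cs /=; ring.
by rewrite /corrected_energy; ring.
Qed.

Let cwave h t : continuous h -> continuous (wave h t) := @wave_continuous h t.

Let wave_le h N t : (forall x, `|h x| <= N) -> forall x, `|wave h t x| <= N.
Proof. by move=> hN x; exact: hN. Qed.

Let En_ge0 : 0 <= En := energy_ge0 (df (lexx 0)) (energyt (lexx 0)).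
Let X1_ge0 : 0 <= X1. Proof. by apply: Rintegral_ge0. Qed.
Let X2_ge0 : 0 <= X2.
Proof.
apply: Rintegral_ge0 => z _; rewrite divr_ge0 ?sqr_ge0//.
exact: (initial_ge0 hini).
Qed.
Let delta_ge0 : 0 <= delta. Proof. by apply: Rintegral_ge0. Qed.

Let bet_f_le (t : R) (t0 : 0 <= t) z :
  `|bet (f t z.1 z.2)| <= `|Q (f t z.1 z.2)| + C * f t z.1 z.2.
Proof. by apply: bet_le; exact: f_ge0. Qed.

Definition correction_bound : R := lam ^+ 2 + lam ^+ 2 * (2 + vb ^+ 2) + 2 * lam * (1 + C).
Definition rate_bound : R := (2 * lam ^+ 3 + lam ^+ 2 * La)
  + (lam ^+ 2 + lam * La) * (5 + 2 * vb ^+ 2) + 2 * La * ((2 + vb ^+ 2) * (1 + C)).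

Lemma correction_le (t : R) : 0 <= t ->
  `|free_energy t - corrected_energy t| <= eps * (correction_bound * A).
Proof.
move=> t0.
have cWW1 : continuous (fun x => wave W t x * wave W1 t x).
  by apply: continuous_mulr; exact: cwave.
have WW1_le x : `|wave W t x * wave W1 t x| <= lam ^+ 2.
  by rewrite normrM expr2 ler_pM// ?W_le ?W1_le.
have [_ E1] := modulated_energy_split vb eps_gt0 (df t0) (pV t0) (mass t0)
  (wave_periodic t pu) (wave_periodic t pW) (wave_derive t du) (wave_derive t dW)
  (wave_derive t dW1) (wave_int t) (cs_sn t).
have B1 := field1_bound eps_gt0 (df t0) (pV t0) (energyt t0) cWW1 WW1_le.
have B2 := moment1_bound vb (df t0) (mass t0) (energyt t0) cWW1 WW1_le.
have [_ B3] := entropy_bound (df t0) (mass t0) (cwave (t:=t) cW1) (wave_le t W1_le)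
  (mbet t0) (bet_f_le t0) (Qi t0).
have QE := (solution_casimir hsol t0 (admissible_continuous hQ) Qi0).2.
rewrite (X1t t0) in B3.
have R2 : Iph (fun z => bet (f t z.1 z.2) * weight2 t z) =
    - 2 * eps * cs t * Iph (fun z => bet (f t z.1 z.2) * wave W1 t z.1).
  have [//||_ ->] := @phase_lincomb
    [:: (- 2 * eps * cs t, fun z => bet (f t z.1 z.2) * wave W1 t z.1)]
    (fun z => bet (f t z.1 z.2) * weight2 t z).
  - split => //; apply: (phase_weight _ (wave_measurable t cW1) (fun x _ => wave_le t W1_le x)).1.
    exact: (entropy_bound (df t0) (mass t0) (cwave (t:=t) cW1) (wave_le t W1_le)
      (mbet t0) (bet_f_le t0) (Qi t0)).1.
  - by move=> z _ /=; rewrite /weight2; ring.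
  by rewrite /= addr0.
rewrite (energyt t0) in E1.
have -> : free_energy t - corrected_energy t = eps * (
    (sn t ^+ 2 - 1) * (eps * Jt (fun x => derive1 (V t) x * (wave W t x * wave W1 t x)))
    + sn t * cs t * Iph (fun z => f t z.1 z.2 * (z.2 - vb) * (wave W t z.1 * wave W1 t z.1))
    + 2 * cs t * Iph (fun z => bet (f t z.1 z.2) * wave W1 t z.1)).
  rewrite /free_energy /cas /fld /corrected_energy R2 /Cst /weight1 QE.
  by move: E1; rewrite -/En; lra.
rewrite normrM gtr0_norm// ler_pM2l//.
have s1 : `|sn t ^+ 2 - 1| <= 1.
  have := cs_sn t; have := sqr_ge0 (sn t); have := sqr_ge0 (cs t).
  by rewrite ler_norml; lra.
have s2 : `|sn t * cs t| <= 1 by rewrite normrM mulr_ile1 ?sin_le ?cos_le.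
have s3 : `|2 * cs t| <= 2 by rewrite normrM ger0_norm// ler_piMr ?cos_le.
have step (a b N : R) : `|a| <= N -> `|a * b| <= N * `|b|.
  by move=> aN; rewrite normrM ler_wpM2r.
apply: le_trans (ler_normD _ _) _; apply: le_trans (lerD (ler_normD _ _) (lexx _)) _.
apply: le_trans (lerD (lerD (step _ _ _ s1) (step _ _ _ s2)) (step _ _ _ s3)) _.
rewrite [`|eps * _|]normrM (gtr0_norm eps_gt0).
have P1 := mulr_ge0 (sqr_ge0 lam) En_ge0; have P2 := mulr_ge0 (sqr_ge0 lam) X1_ge0.
have P3 := mulr_ge0 (sqr_ge0 lam) X2_ge0; have v0 := sqr_ge0 vb.
have l2 := sqr_ge0 lam; have A0 : 0 <= lam * (En + X2 + C * (En + X1 + X2)).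
  by rewrite !(mulr_ge0, addr_ge0).
have P4 : 0 <= lam ^+ 2 * (vb ^+ 2 * (En + X1 + X2)).
  by apply: (mulr_ge0 l2 (mulr_ge0 v0 _)); rewrite !addr_ge0.
rewrite /correction_bound /A; move: B1 B2 B3; rewrite -/En.
set j1 := eps * _; set j2 := `|_|; set j3 := `|_| => B1 B2 B3.
have -> : (lam ^+ 2 + lam ^+ 2 * (2 + vb ^+ 2) + 2 * lam * (1 + C)) * (1 + En + (X1 + X2))
  = lam ^+ 2 * (1 / 2 + En) + lam ^+ 2 * (1 / 2 + 2 * En + vb ^+ 2) + 2 * (lam * (X1 + C))
    + 2 * lam ^+ 2 + lam ^+ 2 * (vb ^+ 2 * (En + X1 + X2)) + 3 * (lam ^+ 2 * X1)
    + 3 * (lam ^+ 2 * X2) + 2 * (lam * (En + X2 + C * (En + X1 + X2))) + 2 * lam.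
  by field.
move: lam_ge0; lra.
Qed.

Let fld_ge0 (t : R) : 0 <= fld t.
Proof. by rewrite mulr_ge0//; apply: Rintegral_ge0 => x _; exact: sqr_ge0. Qed.

Let wave1_int (t : R) : Jt (wave W1 t) = 0.
Proof.
exact: (torus_int_derivative (wave_periodic t pW) (wave_derive t dW) (cwave (t:=t) cW1)).
Qed.

Let field_weighted (t : R) : 0 <= t ->
  `|Jt (fun x => (eps * derive1 (V t) x - cs t * wave W t x) ^+ 2 * wave W1 t x)| <=
  2 * lam * fld t.
Proof.
move=> t0.
have c1 := @continuous_cstr 1.
have [Hi _] := j_square eps_gt0 (df t0) (pV t0) (wave_derive t dW) (cs t) c1.
have [Mi _] := j_square eps_gt0 (df t0) (pV t0) (wave_derive t dW) (cs t) (cwave (t:=t) cW1).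
have Fi : rintegrable mu (@torus R)
    (fun x => (eps * derive1 (V t) x - cs t * wave W t x) ^+ 2).
  by apply: (@torus_eq_rintegrable _ _ _ Hi) => x _; rewrite mulr1.
have -> : 2 * lam * fld t = Jt (fun x => lam *
    (eps * derive1 (V t) x - cs t * wave W t x) ^+ 2).
  rewrite (@RintegralZl _ _ _ mu)//; last exact: measurable_torus.
  by rewrite /fld; field.
apply: (@torus_le_Rintegral_norm).
- exact: (rintegrable_measurable Mi).
- exact: (@torus_rintegrableZ).
- move=> x _; rewrite normrM ger0_norm ?sqr_ge0// mulrC ler_wpM2r ?sqr_ge0//.
  exact: W1_le.
Qed.

(** The weighted kinetic energy of [transported_int] and the weighted entropy in
    [rate2] combine into the weighted Casimir integrand, so that the terms of
    order 1 are at most 2 lam times the free energy. *)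
Lemma energy_rate_le (t : R) : 0 <= t ->
  energy_rate t <= 2 * lam * (free_energy t + delta) + eps * (rate_bound * A).
Proof.
move=> t0.
have cwW := cwave (t:=t) cW; have cwW1 := cwave (t:=t) cW1; have cwW2 := cwave (t:=t) cW2.
have mwW1 := wave_measurable t cW1; have wW1_le x (_ : 0 <= x <= 1) := wave_le t W1_le x.
have cZ : continuous (deriv_WW1 (wave W t) (wave W1 t) (wave W2 t)).
  by apply: continuous_addr; apply: continuous_mulr.
have cY : continuous (deriv_WWW1 (wave W t) (wave W1 t) (wave W2 t)).
  apply: continuous_addr; last by apply: continuous_mulr => //; exact: continuous_mulr.
  apply: continuous_mulr; last exact: continuous_mulr.
  by apply: continuous_mulr => //; exact: continuous_cstr.
have Z_le x : `|deriv_WW1 (wave W t) (wave W1 t) (wave W2 t) x| <= lam ^+ 2 + lam * La.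
  apply: le_trans (ler_normD _ _) _.
  by rewrite !normrM expr2 lerD// ler_pM// ?W_le ?W1_le ?W2_le.
have Y_le x : `|deriv_WWW1 (wave W t) (wave W1 t) (wave W2 t) x| <= 2 * lam ^+ 3 + lam ^+ 2 * La.
  apply: le_trans (ler_normD _ _) _.
  rewrite !normrM [`|2|]ger0_norm// (exprS _ 2) expr2 lerD//.
    by rewrite -mulrA ler_pM2l// !ler_pM// ?mulr_ge0// ?W_le ?W1_le ?W2_le.
  by rewrite !ler_pM// ?mulr_ge0// ?W_le ?W1_le ?W2_le.
have [_ E1] := transported_int vb eps_gt0 (df t0) (pV t0)
  (wave_periodic t pu) (wave_periodic t pW) (wave_periodic t pW1)
  (wave_derive t du) (wave_derive t dW) (wave_derive t dW1) cwW2 (wave_int t) (sn t) (cs t).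
have [Q2t Q2_le] := solution_Q2 hQ hini hsol t0 Q2i0.
have bQ := bet_f_le t0.
have [bi _] := entropy_bound (df t0) (mass t0) cwW1 (wave_le t W1_le) (mbet t0) bQ (Qi t0).
have [b1i _] := phase_weight bi mwW1 wW1_le.
have [Q1i _] := phase_weight (Qi t0) mwW1 wW1_le.
have [di dE] := deltat t0.
have dbi : iph (fun z => Q (f t z.1 z.2) - bet (f t z.1 z.2)).
  by apply: (@phase_rintegrableB) => //; exact: Qi.
have [d1i d1_le] := phase_weight dbi mwW1 wW1_le.
rewrite dE in d1_le.
have [wi w_le] := entropy_moment_bound vb (df t0) (mass t0) (energyt t0) cwW2
  (wave_le t W2_le) C_ge0 (mbet t0) bQ (admissible0 hQ) Q2t.
have E2 : Iph (fun z => bet (f t z.1 z.2) * rate2 t z) =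
    sn t * (2 * Iph (fun z => Q (f t z.1 z.2) * wave W1 t z.1))
    - 2 * sn t * Iph (fun z => (Q (f t z.1 z.2) - bet (f t z.1 z.2)) * wave W1 t z.1)
    - 2 * eps * cs t * Iph (fun z => bet (f t z.1 z.2) * (z.2 - vb) * wave W2 t z.1).
  have [||_ ->] := @phase_lincomb
    [:: (2 * sn t, fun z => Q (f t z.1 z.2) * wave W1 t z.1);
        (- 2 * sn t, fun z => (Q (f t z.1 z.2) - bet (f t z.1 z.2)) * wave W1 t z.1);
        (- 2 * eps * cs t, fun z => bet (f t z.1 z.2) * (z.2 - vb) * wave W2 t z.1)]
    (fun z => bet (f t z.1 z.2) * rate2 t z).
  - by do !split.
  - by move=> z _ /=; rewrite /rate2; ring.
  by rewrite /=; ring.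
have ca : continuous (fun x => sn t * wave W t x).
  by apply: continuous_mulr => //; exact: continuous_cstr.
have CW := casimir_weighted hmu hphi hQ pd_int (df t0) (Qi t0) ca cwW1 (wave1_int t)
  (wave_le t W1_le).
rewrite (casE t0) /= in CW.
have FW := field_weighted t0.
have BY := field1_bound eps_gt0 (df t0) (pV t0) (energyt t0) cY Y_le.
have BZ := field2_bound eps_gt0 (df t0) (pV t0) (energyt t0) cZ Z_le.
have BZ' := moment2_bound vb (df t0) (mass t0) (energyt t0) cZ Z_le.
rewrite /energy_rate E2 /rate1 E1.
rewrite -[X in X * `|_|](gtr0_norm eps_gt0) -normrM in BY.
rewrite -[X in X * `|_|](ger0_norm (sqr_ge0 eps)) -normrM in BZ.
have step (a b N : R) : `|a| <= 1 -> `|b| <= N -> a * b <= N.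
  move=> a1 bN; apply: le_trans (ler_norm _) _; rewrite normrM.
  by rewrite -[leRHS]mul1r ler_pM.
have s1 : `|sn t| <= 1 := sin_le _; have c1 : `|cs t| <= 1 := cos_le _.
have sN : `|- sn t| <= 1 by rewrite normrN.
have cN : `|- cs t| <= 1 by rewrite normrN.
have s3 : `|- sn t ^+ 3| <= 1 by rewrite normrN normrX exprn_ile1.
have sc : `|sn t * cs t| <= 1 by rewrite normrM mulr_ile1.
have scN : `|- (sn t * cs t)| <= 1 by rewrite normrN.
have T1 := step _ _ _ s1 CW; have T2 := step _ _ _ sN FW.
have T3 := step _ _ _ s3 BY; have T4 := step _ _ _ sc BZ.
have T5 := step _ _ _ scN BZ'; have T6 := step _ _ _ sN d1_le.
have T7 := step _ _ _ cN w_le.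
move: T1 T2 T3 T4 T5 T6 T7; rewrite -/En.
move=> T1 T2 T3 T4 T5 T6 T7.
apply: rate_collect => //; [exact: ltW|exact: mulr_ge0|].
apply: rate_budget => //; [exact: sqr_ge0|exact: le_trans (normr_ge0 _) (Y_le 0)| |].
  exact: le_trans (normr_ge0 _) (Z_le 0).
apply: le_trans T7 _; rewrite ler_wpM2l// lerD2r lerD2l ler_pM2r//.
Qed.

Definition growth_constant : R := 3 * correction_bound + rate_bound / (2 * lam).

Let correction_bound_ge0 : 0 <= correction_bound.
Proof.
by rewrite /correction_bound; move: lam_ge0 C_ge0 => l c; rewrite !addr_ge0 ?mulr_ge0//;
  rewrite ?sqr_ge0// !addr_ge0// sqr_ge0.
Qed.

Let A_ge0 : 0 <= A.
Proof. by rewrite !addr_ge0. Qed.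

(** Gronwall's inequality applied to the corrected energy. The error of
    [energy_rate_le] is divided by the rate 2 lam; if lam = 0 this error vanishes
    as soon as La = 0, and so does the quotient since 1 / 0 = 0. *)
Lemma free_energy_growth (T : R) : 0 <= T -> (lam = 0 -> La = 0) ->
  free_energy T <= expR (2 * lam * T) *
    (free_energy 0 + eps * (growth_constant * A) + entropy_gap bet).
Proof.
move=> T0 deg.
pose err := eps * (correction_bound * A).
(* The first summand pays for comparing the two energies, the second for the
   source term of [energy_rate_le] divided by the rate. *)
pose n := eps * ((correction_bound + rate_bound / (2 * lam)) * A) + delta.
have err_ge0 : 0 <= err by apply: mulr_ge0; [exact: ltW|exact: mulr_ge0].
have rate_lam : 2 * lam * (rate_bound / (2 * lam)) = rate_bound.
  have [l0|l0] := eqVneq lam 0.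
    by rewrite /rate_bound l0 (deg l0) !(expr0n, mulr0, mul0r, addr0).
  by field.
have rate_ge0 : 0 <= rate_bound / (2 * lam).
  rewrite divr_ge0 ?mulr_ge0//; rewrite /rate_bound.
  have v0 := sqr_ge0 vb.
  have l2 := exprn_ge0 2 lam_ge0; have l3 := exprn_ge0 3 lam_ge0.
  have l2La := mulr_ge0 l2 La_ge0; have lLa := mulr_ge0 lam_ge0 La_ge0.
  have c1 : 0 <= lam ^+ 2 + lam * La by rewrite addr_ge0.
  have c2 : 0 <= 5 + 2 * vb ^+ 2 by move: v0; lra.
  have c3 : 0 <= (2 + vb ^+ 2) * (1 + C) by apply: mulr_ge0; rewrite addr_ge0.
  have := mulr_ge0 c1 c2; have := mulr_ge0 La_ge0 c3; move: l3 l2La; lra.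
have n_ge0 : 0 <= n.
  apply: addr_ge0 => //; apply: mulr_ge0; first exact: ltW.
  by apply: mulr_ge0 => //; exact: addr_ge0.
have rate_le s : 0 <= s -> energy_rate s <= 2 * lam * (corrected_energy s + n).
  move=> s0; apply: le_trans (energy_rate_le s0) _.
  have := correction_le s0; rewrite -/err ler_norml => /andP[_ h].
  have h2 : 2 * lam * free_energy s <= 2 * lam * (corrected_energy s + err).
    by rewrite ler_wpM2l ?mulr_ge0//; move: h; lra.
  have -> : 2 * lam * (corrected_energy s + n) =
      2 * lam * (corrected_energy s + err) + 2 * lam * delta
      + eps * (2 * lam * (rate_bound / (2 * lam)) * A).
    by rewrite /n /err; ring.
  by rewrite rate_lam; move: h2; lra.
have prim : primitive 0 T energy_rate corrected_energy.
  by move=> t /andP[t0 _]; exact: (corrected_energy_integral t0).2.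
have cy : {within `[0, T]%classic, continuous corrected_energy}.
  exact: (primitive_continuous T0 (corrected_energy_integral T0).1 prim).
have y_le t : 0 <= t <= T -> corrected_energy t <= corrected_energy 0 +
    \int[mu]_(s in `[0, t]) (2 * lam * (corrected_energy s + n)).
  move=> /andP[t0 tT]; have [ri ->] := corrected_energy_integral t0.
  rewrite lerD2l; apply: (@le_Rintegral _ _ _ mu) => //.
  - apply: within_continuous_rintegrable.
    have cyt : {within `[0, t]%classic, continuous corrected_energy}.
      apply: continuous_subspaceW cy; apply: subset_itvl; rewrite bnd_simp//.
    move=> x; apply: (@continuousM _ _ (cst (2 * lam) : subspace _ -> R)
      (fun s => corrected_energy s + n)); first exact: cst_continuous.
    apply: (@continuousD _ _ _ (corrected_energy : subspace _ -> R) (cst n)).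
      exact: cyt.
    exact: cst_continuous.
  - by move=> s; rewrite /= in_itv /= => /andP[s0 _]; exact: rate_le.
have G := gronwall_ineq (mulr_ge0 (ler0n _ 2) lam_ge0) n_ge0 T0 cy y_le.
have := correction_le T0; rewrite -/err ler_norml => /andP[_ hT].
have := correction_le (lexx 0); rewrite -/err ler_norml => /andP[h0 _].
have e1 : 1 <= expR (2 * lam * T) by rewrite -[leLHS](@expR0 R) ler_expR !mulr_ge0.
have -> : free_energy 0 + eps * (growth_constant * A) + entropy_gap bet =
    free_energy 0 + n + 2 * err.
  by rewrite /growth_constant /n /err /delta; ring.
move: e1 G; set e := expR _ => e1 G.
have : e * (corrected_energy 0 + n) <= e * (free_energy 0 + n + err).
  by rewrite ler_wpM2l//; [lra|move: h0; lra].
have : err <= e * err by rewrite ler_peMl.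
move: hT G; lra.
Qed.

End entropy_approximant.

Let s0 : R := phi 0.
Let C0 : R := `|Q s0| / s0.

(** The constants do not depend on the approximant of Q, and the gap tends to 0
    by dominated convergence. *)
Lemma free_energy_estimate (T : R) : 0 <= T -> (lam = 0 -> La = 0) ->
  free_energy T <= expR (2 * lam * T) *
    (free_energy 0 + eps * (growth_constant C0 * A)).
Proof.
move=> T0 deg.
have s0_gt0 : 0 < s0 := phi_gt0 hphi (lexx 0).
have qs0 : derive1 Q s0 = 0 := derive_phi0 hQ.
have C0_ge0 : 0 <= C0 by rewrite divr_ge0// ltW.
pose a_ n : R := s0 / n.+1%:R; pose b_ n : R := s0 + n%:R.
have a_gt0 n : 0 < a_ n by rewrite divr_gt0.
have a_le n : a_ n <= s0 by rewrite ler_pdivrMr// ler_peMr ?ler1n// ltW.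
have b_ge n : s0 <= b_ n by rewrite lerDl.
have ab n : a_ n <= b_ n := le_trans (a_le n) (b_ge n).
pose bet_ n := linearized Q (a_ n) (b_ n).
have dbet_ n s := is_derive_linearized hQ (a_gt0 n) (ab n) s.
have bet_le_ n s : 0 <= s -> `|bet_ n s| <= `|Q s| + C0 * s.
  exact: (linearized_bound hQ s0_gt0 qs0 (a_gt0 n) (ab n) (a_le n) (b_ge n)).
have cbet'_ n : continuous (fun s => derive1 Q (clamp (a_ n) (b_ n) s)).
  move=> x; apply: continuous_comp; first exact: clamp_continuous.
  apply: (admissible_derive_continuous hQ); exact: clamp_gt0.
have growth n : free_energy T <= expR (2 * lam * T) *
    (free_energy 0 + eps * (growth_constant C0 * A) + entropy_gap (bet_ n)).
  apply: (free_energy_growth C0_ge0 (linearized0 Q (a_gt0 n) (ab n)) (dbet_ n) (cbet'_ n)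
    _ (bet_le_ n) T0 deg).
  exact: (linearized_lip hQ (a_gt0 n) (ab n)).
have f00 z : 0 <= f0 z.1 z.2 by exact: (initial_ge0 hini).
have gap_cvg : entropy_gap (bet_ n) @[n --> \oo] --> (0 : R).
  have m0 : measurable_fun setT (fun z : R * R => f0 z.1 z.2) := initial_measurable hini.
  have bcont n : continuous (bet_ n).
    exact: is_derive_continuous (dbet_ n).
  have [||||_] := @phase_dominated
    (fun n z => `|Q (f0 z.1 z.2) - bet_ n (f0 z.1 z.2)|) (fun=> 0)
    (fun z => 2 * `|Q (f0 z.1 z.2)| + C0 * f0 z.1 z.2).
  - move=> n; apply: measurableT_comp => //; apply: measurable_funB.
      exact: rintegrable_measurable Qi0.
    apply: measurable_funTS; apply: (measurableT_comp (continuous_measurableT (bcont n))).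
    exact: m0.
  - move=> z _.
    have lc := linearized_cvg hQ s0_gt0 qs0 (f00 z).
    have := cvg_norm (cvgB (cvg_cst (Q (f0 z.1 z.2))) lc).
    by rewrite subrr normr0; apply.
  - apply: (@phase_rintegrableD);
      apply: (@phase_rintegrableZ).
      exact: rintegrable_norm.
    rewrite -(strong_initial hsol); exact: (density_integrable (df (lexx 0))).
  - move=> n z _; rewrite normr_id (le_trans (ler_normB _ _))//.
    by have := bet_le_ n _ (f00 z); lra.
  have -> : Iph (fun=> 0) = 0; last by apply.
  have := @Rintegral_cst _ _ _ mu2 _ measurable_phase 0.
  by rewrite mul0r.
have lim : expR (2 * lam * T) * (free_energy 0 + eps * (growth_constant C0 * A)
    + entropy_gap (bet_ n)) @[n --> \oo] --> expR (2 * lam * T) *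
    (free_energy 0 + eps * (growth_constant C0 * A) + 0).
  by apply: cvgMr; apply: cvgD => //; exact: cvg_cst.
rewrite addr0 in lim.
by apply: (cvgr_to_ge lim); apply: nearW => n; exact: growth.
Qed.

End main_estimate.

(** * Finite and infinite data *)

Section conclusion.

Lemma smooth_is_derive (V0 : R -> R) : smooth V0 -> forall n x,
  is_derive x (1 : R) (derive1n n V0) (derive1n n.+1 V0 x).
Proof. by move=> sV n x; rewrite derive1nS derive1E; apply/derivableP/sV. Qed.

Lemma smooth_continuous (V0 : R -> R) : smooth V0 -> forall n, continuous (derive1n n V0).
Proof. by move=> sV n; apply: derivable_continuousT => x; exact: sV. Qed.

Lemma derive1n_periodic (V0 : R -> R) : periodic1 V0 ->
  forall n, periodic1 (derive1n n V0).
Proof.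
by move=> pV; elim=> [//|n IH]; rewrite derive1nS; exact: derive1_periodic.
Qed.

(** The derivative vanishes somewhere in each period, and periods have length 1. *)
Lemma derive1_le (V0 : R -> R) (N : R) : periodic1 V0 -> smooth V0 ->
  (forall x, `|derive1n 2 V0 x| <= N) -> forall x, `|derive1 V0 x| <= N.
Proof.
move=> pV sV dN x.
have [c /andP[c0 c1] zc] := periodic_critical_point pV (sV 0).
have [y /andP[y0 y1] ->] := periodic_zero_mod x (derive1_periodic pV).
have := is_derive_lipschitz (smooth_is_derive sV 1) dN c y.
rewrite /= zc subr0 => h; apply: le_trans h _.
have N0 : 0 <= N := le_trans (normr_ge0 _) (dN 0).
by rewrite ler_piMr// ler_norml; apply/andP; split; lra.
Qed.

Lemma modulated_free_energy_ge0 (mup phi Q : R -> R) (vb : R)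
    (V0 : R -> R) (eps : R) (f : R -> R -> R -> R) (V : R -> R -> R) (t : R) :
  profile_function mup vb phi -> admissible phi Q -> (forall x v, 0 <= f t x v) ->
  (0 <= modulated_free_energy mup Q vb V0 eps f V t)%E.
Proof.
move=> hphi hQ f0; apply: adde_ge0; first exact: (casimir_ge0 hphi hQ).
apply: mule_ge0; first by rewrite lee_fin.
by apply: integral_ge0 => x _; rewrite lee_fin sqr_ge0.
Qed.

Lemma initial_Q_ge0 (Q : R -> R) (f0 : R -> R -> R) : (forall x v, 0 <= f0 x v) ->
  (0 <= initial_Q Q f0)%E.
Proof.
move=> f00; apply: integral_ge0 => z _; rewrite lee_fin addr_ge0// divr_ge0 ?sqr_ge0//.
Qed.

Lemma initial_Q_fin (phi Q : R -> R) (f0 : R -> R -> R) : admissible phi Q ->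
  (forall x v, 0 <= f0 x v) -> measurable_fun setT (fun z : R * R => f0 z.1 z.2) ->
  (initial_Q Q f0 < +oo)%E ->
  [/\ iph (fun z => Q (f0 z.1 z.2)), iph (fun z => Q (f0 z.1 z.2) ^+ 2 / f0 z.1 z.2) &
    initial_Q Q f0 = (Iph (fun z => `|Q (f0 z.1 z.2)|) +
      Iph (fun z => Q (f0 z.1 z.2) ^+ 2 / f0 z.1 z.2))%:E].
Proof.
move=> hQ f00 m0 fin.
have mQ : measurable_fun setT (fun z => Q (f0 z.1 z.2)).
  by apply: (measurable_continuous_comp (admissible_continuous hQ) m0) => z.
have mr : measurable_fun setT (fun z => Q (f0 z.1 z.2) ^+ 2 / f0 z.1 z.2).
  by apply: (measurable_square_ratio hQ m0) => z.
have r0 z : 0 <= Q (f0 z.1 z.2) ^+ 2 / f0 z.1 z.2 by rewrite divr_ge0 ?sqr_ge0.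
have [||si sE] := @phase_int_ge0_fin
    (fun z => `|Q (f0 z.1 z.2)| + Q (f0 z.1 z.2) ^+ 2 / f0 z.1 z.2) _ _ fin.
- by apply: measurable_funD => //; exact: measurableT_comp.
- by move=> z; rewrite addr_ge0.
have Qi : iph (fun z => Q (f0 z.1 z.2)).
  apply: (@phase_le_rintegrable _ _ (measurable_funTS mQ) si).
  by move=> z _; rewrite lerDl.
have ri : iph (fun z => Q (f0 z.1 z.2) ^+ 2 / f0 z.1 z.2).
  apply: (@phase_le_rintegrable _ _ (measurable_funTS mr) si).
  by move=> z _; rewrite ger0_norm// lerDr.
split => //; rewrite /initial_Q /phase_int sE; congr (_%:E).
apply: (@RintegralD _ _ _ mu2) => //; first exact: measurable_phase.
exact: rintegrable_norm.
Qed.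

End conclusion.

End stability.

Theorem theorem2p3 (R : realType) (mu phi Q : R -> R) (vb eta : R)
    (hmu : S_stable mu vb) (hphi : profile_function mu vb phi)
    (hQ : admissible phi Q) (heta : 0 < eta)
    (hmoment : (\int[@lebesgue_measure R]_v
                  (mu v * (1 + `|v| `^ (2 + eta)))%:E < +oo)%E) :
  exists K : R -> R -> R, (forall a b : R, 0 < K a b) /\
    forall V0 : R -> R, periodic1 V0 -> smooth V0 ->
      (Linfty_norm (derive1n 3 V0) < +oo)%E ->
    forall (eps : R) (f0 : R -> R -> R) (f : R -> R -> R -> R) (V : R -> R -> R),
      0 < eps -> initial_datum eps f0 (V 0) -> strong_solution eps f0 f V ->
    forall t : R, 0 <= t ->
      (modulated_free_energy mu Q vb V0 eps f V t <=
       (expR (2 * fine (Linfty_norm (derive1n 2 V0)) * t)%R)%:E *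
       (modulated_free_energy mu Q vb V0 eps f V 0%R +
        (K (fine (Linfty_norm (derive1n 2 V0)))
           (fine (Linfty_norm (derive1n 3 V0))) * eps)%:E *
        (1 + energy eps f0 (V 0%R) + initial_Q Q f0)))%E.
Proof.
pose C := `|Q (phi 0)| / phi 0.
(* Adding 1 makes the constant positive: then the right-hand side is infinite as
   soon as the entropy of the initial datum is. *)
exists (fun a b => 1 + `|growth_constant vb a b C|); split.
  by move=> a b; rewrite ltr_pwDl.
move=> V0 pV sV fin3 eps f0 f V eps_gt0 hini hsol t t0.
pose lam := fine (Linfty_norm (derive1n 2 V0)).
pose La := fine (Linfty_norm (derive1n 3 V0)).
pose K := 1 + `|growth_constant vb lam La C|.
suff : (modulated_free_energy mu Q vb V0 eps f V t <=
    (expR (2 * lam * t)%R)%:E * (modulated_free_energy mu Q vb V0 eps f V 0%R +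
    (K * eps)%:E * (1 + energy eps f0 (V 0%R) + initial_Q Q f0)))%E by [].
have K0 : 0 < K by rewrite ltr_pwDl.
have Keps : 0 < K * eps by rewrite mulr_gt0.
have f_ge0 (s : R) x v : 0 <= s -> 0 <= f s x v by exact: (strong_ge0 hsol).
have f00 x v : 0 <= f0 x v by exact: (initial_ge0 hini).
have L0_ge0 : (0 <= modulated_free_energy mu Q vb V0 eps f V 0)%E.
  apply: modulated_free_energy_ge0; [exact: hphi|exact: hQ|]. move=> x v; exact: f_ge0.
have Q0_ge0 := initial_Q_ge0 Q f00.
have EE := energy_fin eps_gt0 hini hsol.
have En0 : 0 <= fine (energy eps f0 (V 0)).
  exact: (energy_ge0 (solution_density hini hsol (lexx 0))
    (solution_energy eps_gt0 hini hsol (lexx 0))).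
have [Q0oo|Q0fin] := eqVneq (initial_Q Q f0) +oo%E.
  rewrite Q0oo EE -EFinD addey// gt0_muley ?lte_fin// addey ?gt_eqF//; last first.
    exact: lt_le_trans L0_ge0.
  by rewrite gt0_muley ?leey// lte_fin expR_gt0.
have [L0oo|L0fin] := eqVneq (modulated_free_energy mu Q vb V0 eps f V 0) +oo%E.
  rewrite L0oo addye; last first.
    rewrite gt_eqF// (@lt_le_trans _ _ 0%E)// mule_ge0//; first by rewrite lee_fin ltW.
    by rewrite EE adde_ge0// -EFinD lee_fin addr_ge0.
  by rewrite gt0_muley ?leey// lte_fin expR_gt0.
have Qlt : (initial_Q Q f0 < +oo)%E by rewrite ltey.
have [Qi ri QE] := initial_Q_fin hQ f00 (initial_measurable hini) Qlt.
have d0 : density f0 by rewrite -(strong_initial hsol); exact: (solution_density hini hsol).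
have cas0 : (casimir mu Q f0 < +oo)%E.
  have : (modulated_free_energy mu Q vb V0 eps f V 0 < +oo)%E by rewrite ltey.
  apply: le_lt_trans; rewrite /modulated_free_energy.
  have -> : casimir mu Q (fun x v => f 0 x (v - derive1 V0 (x - vb * 0) * sin (0 / eps)))
      = casimir mu Q f0.
    congr (casimir _ _ _); apply/funext => x; apply/funext => v.
    by rewrite mul0r sin0 mulr0 subr0 (strong_initial hsol).
  rewrite leeDl//; apply: mule_ge0; first by rewrite lee_fin.
  by apply: integral_ge0 => x _; rewrite lee_fin sqr_ge0.
have pd := profile_density_integrable hmu hphi hQ d0 Qi cas0.
have cV := @smooth_continuous _ V0 sV; have dV := smooth_is_derive sV.
pose k := \int[lebesgue_measure]_(x in @torus R) V0 x.
pose u x := V0 x - k.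
have pu : periodic1 u by move=> x; rewrite /u pV.
have du x : is_derive x (1 : R) u (derive1 V0 x).
  have H := is_derive_subr (dV 0 x) (is_derive_cst k x 1).
  by apply: (is_derive_eq H); rewrite subr0.
have u0 : \int[lebesgue_measure]_(x in @torus R) u x = 0.
  have c1 := @continuous_cstr R 1.
  have [||_ ->] := @torus_lincomb R
    [:: (1, V0); (- k, fun=> 1)] u.
  - by do !split; apply: tbounded_integrable; apply: tbounded_continuous; [exact: (cV 0)|].
  - by move=> x _ /=; rewrite /u; ring.
  by rewrite /= -/k torus_int1; ring.
have W1_le : forall x, `|derive1n 2 V0 x| <= lam.
  apply: le_Linfty_norm; first exact: cV.
  have [M _ hM] := periodic_continuous_bounded (derive1n_periodic pV 2) (cV 2).
  exact: le_lt_trans (Linfty_norm_bound hM) (ltry M).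
have W_le := derive1_le pV sV W1_le.
(* If lam = 0 then W1 and W2 vanish, so that 0 bounds W2, as the degenerate case
   of [free_energy_estimate] requires; the constant does not see La then. *)
pose La' := if lam == 0 then 0 else La.
have W2_le x : `|derive1n 3 V0 x| <= La'.
  rewrite /La'; case: eqP => [l0|_]; last first.
    by move: x; apply: le_Linfty_norm => //; exact: cV.
  have -> : derive1n 3 V0 = derive1 (cst 0).
    rewrite derive1nS; congr derive1; apply/funext => y /=.
    by apply/eqP; rewrite -normr_le0 -l0; exact: W1_le.
  by rewrite derive1_cst normr0.
have gE : growth_constant vb lam La' C = growth_constant vb lam La C.
  rewrite /growth_constant /La'; case: eqP => // ->.
  by rewrite mulr0 invr0 !mulr0.
have deg : lam = 0 -> La' = 0 by rewrite /La' => ->; rewrite eqxx.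
have est := free_energy_estimate hmu hphi hQ eps_gt0 hini hsol Qi ri pd pu
  (derive1n_periodic pV 1) (derive1n_periodic pV 2) (derive1n_periodic pV 3)
  du (dV 1) (dV 2) (cV 3) u0 W_le W1_le W2_le t0 deg.
rewrite (modulated_free_energyE hmu hphi hQ eps_gt0 hini hsol Qi pd (dV 1) t0 erefl).
rewrite (modulated_free_energyE hmu hphi hQ eps_gt0 hini hsol Qi pd (dV 1) (lexx 0) erefl).
rewrite EE QE -!EFinD -!EFinM lee_fin; apply: le_trans est _.
rewrite gE ler_wpM2l ?expR_ge0// lerD2l mulrA [_ * eps]mulrC.
apply: ler_wpM2r.
  apply: addr_ge0; first exact: addr_ge0.
  by apply: addr_ge0; apply: Rintegral_ge0 => z _ //; rewrite divr_ge0 ?sqr_ge0.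
apply: ler_wpM2l; first exact: ltW.
by rewrite /K -[leLHS]add0r lerD// ler_norm.
Qed.
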